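(* Let $\mathcal F$ be a dendritation of a compact surface $S$ without boundary, and for $x\in S$ let $\mathcal F(x)$ be the leaf of $\mathcal F$ through $x$. Then there is a residual set $G\subset S$ such that $\mathcal F(x)$ has no ramification point for all $x\in G$. Moreover, for all $x\in G$ the leaf $\mathcal F(x)$ with the plaque topology is a one-dimensional manifold: it is homeomorphic to $\mathbb R$, $[0,+\infty)$, $[0,1]$ or the circle.
   Context: $S$ carries a metric compatible with its topology $\tau$. A continuum is a compact connected metric space. A set is residual if it is a countable intersection of open dense subsets. Let $X$ be a compact metric space (here $X=S$) with topology $\tau$. For $Y\subset X$ and $x\in Y$, $\operatorname{Comp}_x(Y)$ is the connected component of $Y$ containing $x$; $\mathcal C(Y)$ is the set of non-empty subcontinua of $Y$. A decomposition of a compact set $Y\subset X$ is a map $Q\colon Y\to\mathcal C(Y)$ with $x\in Q(x)$ for all $x$, any two values equal or disjoint, and upper semicontinuous: for all $x\in Y$ and every open $V\supset Q(x)$ there is a neighborhood $W$ of $x$ with $Q(y)\subset V$ for all $y\in W\cap Y$. If $Z\subset Y$, the monotone restriction is $Q|^m_Z(x)=\operatorname{Comp}_x(Q(x)\cap Z)$, $x\in Z$. Decompositions $Q_i$ of $Y_i$ ($i=1,2$) are compatible if $Q_1|^m_{Y_1\cap Y_2}=Q_2|^m_{Y_1\cap Y_2}$. An atlas over an open cover $\mathcal U$ of $X$ is a collection $\mathcal A=\{Q_{\overline U}\}_{U\in\mathcal U}$ of pairwise compatible decompositions $Q_{\overline U}$ of the closures $\overline U$. A basis $\mathcal U$ of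 $\tau$ is complete if $V\in\mathcal U$ and $U\subset V$ open imply $U\in\mathcal U$. Put $Q_U=Q_{\overline U}|^m_U$. For an atlas over a complete basis, the open plaques are the sets $Q_U(x)$ with $x\in U\in\mathcal U$; they form a basis of a topology on $X$, the plaque topology. The leaf of $x$ is the set of $y$ for which there are open plaques $P_1,\dots,P_n$ with $x\in P_1$, $y\in P_n$ and $P_i\cap P_{i+1}\ne\emptyset$ for $1\le i<n$. The atlas is a Peano atlas if its open plaques are locally connected in the topology induced by $\tau$. It is a cw-atlas if (1) each leaf is a countable union of open plaques, (2) each leaf is a meagre subset of $(X,\tau)$, and (3) the diameters of the leaves are bounded away from zero. A Peano foliation is a maximal Peano atlas (maximal among Peano atlases); it is always over a complete basis. A dendritation of $S$ is a Peano foliation of $S$ with (containing) a cw-atlas. A point $y\in\mathcal F(x)$ is a ramification point if $\mathcal F(x)\setminus\{y\}$ has at least $3$ components in the plaque topology. *)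

(* Defs.v *)
From HB Require Import structures.
From mathcomp Require Import all_boot all_order all_algebra.
From mathcomp Require Import all_classical all_reals all_analysis.

Set Implicit Arguments.
Unset Strict Implicit.
Unset Printing Implicit Defensive.

Import Order.TTheory GRing.Theory Num.Theory.
Import numFieldNormedType.Exports.

Local Open Scope classical_set_scope.
Local Open Scope ring_scope.

(* A subset [A : set T] used as a type carries the
   topology induced by that of [T]. *)

Definition homeomorphic (T U : topologicalType) : Prop :=
  exists (f : T -> U) (g : U -> T),
    [/\ continuous f, continuous g, cancel f g & cancel g f].

Definition locally_connected (T : topologicalType) : Prop :=
  forall (x : T) (A : set T), nbhs x A ->
    exists C : set T, [/\ open C, C x, C `<=` A & connected C].

Definition nowhere_dense (T : topologicalType) (A : set T) : Prop :=
  (closure A)° = set0.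

Definition meagre (T : topologicalType) (A : set T) : Prop :=
  exists2 N : (set T)^nat, (forall i, nowhere_dense (N i)) & A = \bigcup_i N i.

Definition diameter (R : realType) (X : metricType R) (A : set X) : \bar R :=
  ereal_sup [set (mdist p.1 p.2)%:E | p in A `*` A].

(* Hausdorff and separability axioms are automatic for a metric on a compact
   space. *)
Definition compact_surface (R : realType) (S : metricType R) : Prop :=
  compact [set: S] /\
  forall x : S, exists U : set S, [/\ open U, U x & homeomorphic U (R * R)%type].

Definition half_line (R : realType) : set R := [set t | 0 <= t].

Definition unit_interval (R : realType) : set R := [set t | 0 <= t <= 1].

Definition circle (R : realType) : set (R * R) :=
  [set p | p.1 ^+ 2 + p.2 ^+ 2 = 1].

Arguments half_line R : clear implicits.
Arguments unit_interval R : clear implicits.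
Arguments circle R : clear implicits.

(* Boundary points are allowed. *)
Definition one_manifold (R : realType) (M : topologicalType) : Prop :=
  [/\ hausdorff_space M, @second_countable M &
    forall x : M, exists (U : set M) (V : set (half_line R)),
      [/\ open U, U x, open V & homeomorphic U V]].

Arguments one_manifold R M : clear implicits.

Section decompositions.
Context {X : topologicalType}.
Implicit Types (Y Z C : set X) (Q : X -> set X).

Definition continuum C : Prop := [/\ C !=set0, compact C & connected C].

(* Only the values of [Q] at points of [Y] matter. *)
Definition decomposition Y Q : Prop :=
  [/\ forall x, Y x -> continuum (Q x) /\ Q x `<=` Y,
      forall x, Y x -> Q x x,
      forall x y, Y x -> Y y -> Q x = Q y \/ Q x `&` Q y = set0 &
      forall x V, Y x -> open V -> Q x `<=` V ->
        \forall y \near x, Y y -> Q y `<=` V].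

Definition monotone_restriction Q Z (x : X) : set X :=
  connected_component (Q x `&` Z) x.

Definition compatible Y1 Q1 Y2 Q2 : Prop :=
  forall x, (Y1 `&` Y2) x ->
    monotone_restriction Q1 (Y1 `&` Y2) x =
    monotone_restriction Q2 (Y1 `&` Y2) x.

Definition complete_basis (B : set (set X)) : Prop :=
  basis B /\ forall U V, B V -> open U -> U `<=` V -> B U.

End decompositions.

(* An open cover, and for each of its members [U] a map [decomp U], meant as a
   decomposition of [closure U]; [decomp] is irrelevant off the cover. *)
Record preatlas (X : topologicalType) := Preatlas {
  cover : set (set X);
  decomp : set X -> X -> set X
}.

Section atlases.
Context {X : topologicalType}.
Implicit Types A B : preatlas X.

Definition atlas A : Prop :=
  [/\ forall U, cover A U -> open U,
      \bigcup_(U in cover A) U = [set: X],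
      forall U, cover A U -> decomposition (closure U) (decomp A U) &
      forall U V, cover A U -> cover A V ->
        compatible (closure U) (decomp A U) (closure V) (decomp A V)].

Definition complete_atlas A : Prop := atlas A /\ complete_basis (cover A).

Definition open_plaque A (P : set X) : Prop :=
  exists2 U, cover A U &
    exists2 x, U x & P = monotone_restriction (decomp A U) U x.

(* A copy of [X] carrying the plaque topology. *)
Definition plaque_space A : Type := X.

HB.instance Definition _ A := Choice.on (plaque_space A).

(* For a complete atlas, the open plaques form a basis of this topology, see
   [open_plaque_basis]. *)
HB.instance Definition _ A :=
  isSubBaseTopological.Build (plaque_space A) (open_plaque A) id.

Lemma plaque_refine A (P1 P2 : set X) (x : X) : complete_atlas A ->
  open_plaque A P1 -> open_plaque A P2 -> P1 x -> P2 x ->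
  exists P3, [/\ open_plaque A P3, P3 x & P3 `<=` P1 `&` P2].
Proof.
move=> [] [oA cA dA kA] [_ bA] [U1 cU1 [x1 U1x1 ->]] [U2 cU2 [x2 U2x2 ->]].
have rebase U z : cover A U -> U z ->
    monotone_restriction (decomp A U) U z x ->
    U x /\ monotone_restriction (decomp A U) U z =
           monotone_restriction (decomp A U) U x.
  move=> cU Uz zx; have [Qx Ux] := connected_component_sub zx; split => //.
  have clz := subset_closure Uz; have clx := subset_closure Ux.
  have [_ self disj _] := dA U cU.
  have Qzx : decomp A U z = decomp A U x.
    case: (disj z x clz clx) => // E.
    have : (decomp A U z `&` decomp A U x) x by split=> //; exact: self.
    by rewrite E.
  have := same_connected_component zx.
  by rewrite /monotone_restriction Qzx.
move=> /(rebase _ _ cU1 U1x1)[U1x ->] /(rebase _ _ cU2 U2x2)[U2x ->].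
pose V := U1 `&` U2.
have cV : cover A V.
  apply: (bA _ U1) => //; first by apply: openI; exact: oA.
  exact: subIsetl.
have Vx : V x by split.
have [conV selfV _ _] := dA V cV.
have clVx := subset_closure Vx.
have refine_sub U : cover A U -> V `<=` U ->
    monotone_restriction (decomp A V) V x `<=`
    monotone_restriction (decomp A U) U x.
  move=> cU VU; apply: connected_component_max.
  - by apply: connected_component_refl; split=> //; exact: selfV.
  - move=> y /connected_component_sub[Qy Vy]; split; last exact: VU.
    have clVU : closure V `<=` closure U by exact: closureS.
    have [CQ QV] := conV x clVx; have [_ _ connQ] := CQ.
    have := kA V U cV cU x (conj clVx (clVU _ clVx)).
    rewrite /monotone_restriction (setIidl clVU) (setIidl QV).
    rewrite connected_component_id //; last exact: selfV.
    by move=> E; move: Qy; rewrite E => /connected_component_sub[].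
  - exact: component_connected.
exists (monotone_restriction (decomp A V) V x); split.
- by exists V => //; exists x.
- by apply: connected_component_refl; split=> //; exact: selfV.
- move=> y Py; split.
  + by apply: (refine_sub U1 cU1) Py => ? [].
  + by apply: (refine_sub U2 cU2) Py => ? [].
Qed.

Lemma plaque_refine_seq A (x : X) (s : seq (set X)) : complete_atlas A ->
  (forall P, P \in s -> open_plaque A P /\ P x) ->
  exists P, [/\ open_plaque A P, P x & forall P', P' \in s -> P `<=` P'].
Proof.
move=> cA; elim: s => [_|P s IH sA].
  have [atA _] := cA; have [_ covA dA _] := atA.
  have [U cU Ux] : (\bigcup_(U in cover A) U) x by rewrite covA.
  exists (monotone_restriction (decomp A U) U x); split=> //.
    by exists U => //; exists x.
  apply: connected_component_refl; split=> //.
  have [_ self _ _] := dA U cU; apply: self.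
  exact: subset_closure.
have [|P1 [P1A P1x P1s]] := IH.
  by move=> i si; apply: sA; rewrite inE si orbT.
have [PA Px] := sA P (mem_head _ _).
have [P2 [P2A P2x P2s]] := plaque_refine cA PA P1A Px P1x.
exists P2; split=> // P'; rewrite inE => /orP[/eqP -> y /P2s[]//|P's y /P2s[_]].
exact: P1s.
Qed.

Lemma open_plaque_basis A : complete_atlas A ->
  @basis (plaque_space A) (open_plaque A).
Proof.
move=> cA; split.
  move=> P PA; exists [set P]; last by rewrite bigcup_set1.
  by move=> _ ->; apply: finI_from1.
move=> x N; rewrite nbhsE => -[W [oW Wx] WN].
have [D' D'sub WE] := oW; move: Wx; rewrite -WE => -[B D'B Bx].
have fiB : @finI_from (set X) X (open_plaque A) id B := D'sub _ D'B.
have [E Esub EB] := fiB.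
have [|P [PA Px PE]] := @plaque_refine_seq A x (finmap.enum_fset E) cA.
  move=> P PE; split; first by have := Esub P PE; rewrite inE.
  by move: Bx; rewrite -EB; apply.
exists P; first by [].
move=> y Py; apply: WN; rewrite -WE; exists B => //.
suff: B y by [].
rewrite -EB => P' P'E; exact: PE Py.
Qed.

Definition leaf A (x : X) : set (plaque_space A) :=
  [set y | exists (n : nat) (P : nat -> set X),
    [/\ forall i, (i <= n)%N -> open_plaque A (P i),
        P 0%N x, P n y &
        forall i, (i < n)%N -> P i `&` P i.+1 !=set0]].

Arguments leaf : clear implicits.

Definition peano_atlas A : Prop :=
  complete_atlas A /\ forall P, open_plaque A P -> locally_connected P.

Definition subatlas A B : Prop :=
  cover A `<=` cover B /\
  forall U, cover A U -> forall x, closure U x -> decomp A U x = decomp B U x.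

Definition peano_foliation A : Prop :=
  peano_atlas A /\
  forall B, peano_atlas B -> subatlas A B -> subatlas B A.

(* [#<=] compares cardinalities: the complement of [y] in the leaf has at least
   three components. *)
Definition ramification_point A (x : X) (y : plaque_space A) : Prop :=
  leaf A x y /\
  ([set: 'I_3] #<=
    [set connected_component (leaf A x `\ y) z | z in leaf A x `\ y])%card.

End atlases.

Arguments leaf {X} A x.
Arguments ramification_point {X} A x y.

Definition cw_atlas (R : realType) (X : metricType R) (A : preatlas X) : Prop :=
  [/\ complete_atlas A,
      forall x, exists2 P : (set X)^nat,
        (forall i, open_plaque A (P i)) & leaf A x = \bigcup_i P i,
      forall x, meagre (leaf A x : set X) &
      exists2 d : R, 0 < d & forall x, (d%:E <= diameter (leaf A x : set X))%E].

Definition dendritation (R : realType) (S : metricType R) (F : preatlas S) :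
    Prop :=
  peano_foliation F /\ exists2 A : preatlas S, cw_atlas A & subatlas A F.

(* Main.v *)
(** A triod in a leaf can be shrunk into a planar chart, and by (a form of)
    Moore's triod theorem only countably many leaves contain a triod inside a
    chart.  Indeed, choose disjoint continua [D 0], [D 1], [D 2] from a countable
    family so that [D j] meets the [j]-th leg of the triod and no other: three
    disjoint triods with the same chart and the same [D] would give a drawing of
    K_{3,3} in the plane, its edges being the legs enlarged by the [D j].  As
    leaves are meagre, the leaves without triods contain a residual set.

    The drawing is impossible because of a parity count.  For two disjoint chains
    in the plane, the winding of their difference along the boundary of the
    parameter square is zero; summed modulo 2 over all pairs of disjoint edges of
    K_{3,3}, this identity reads 0 = 1.

    A leaf is a connected, locally connected, locally compact, second countable
    space for the plaque topology.  If it is locally free of triods, then small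
    connected open sets have at most two boundary points, and one with exactly
    two is separated between them by each of its points, hence ordered.  A
    maximal open subset which is ordered in this way, with open rays and without
    end points, has at most two limits outside, one for each end, and together
    with them it is the whole leaf; a sum of distance functions parametrizes it
    by an interval. *)

From Pilot Require Import Defs.
From HB Require Import structures.
From mathcomp Require Import all_boot all_order all_algebra.
From mathcomp Require Import all_classical all_reals all_analysis.
From mathcomp Require Import borel_hierarchy lra ring.
From Stdlib Require Import Btauto.
(* [mathcomp.classical] also defines a [cover]. *)
Import Pilot.Defs.
Import Order.TTheory GRing.Theory Num.Theory.
Import numFieldNormedType.Exports.
Local Open Scope classical_set_scope.
Local Open Scope ring_scope.

Set Implicit Arguments.
Unset Strict Implicit.
Unset Printing Implicit Defensive.

(** * K_{3,3} is not planar *)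

(** Legs of triods are arbitrary continua, not arcs, so the planar part works with finite chains of
    points with small steps, and winding becomes the parity of crossings of one ray. The edges of
    the drawing overlap: those ending in a common [D j] share it, and the legs of one triod may meet
    anywhere. This is harmless, since the parity count involves only pairs of edges without a common
    vertex. Two topologies compete on a leaf. The Peano condition makes them agree on every open
    plaque, so that connected sets and continua can be moved between the surface and the leaf. The
    foliation gives the local structure; countability, meagreness and the lower bound on diameters
    belong to the cw-atlas and pass to the foliation because both have the same leaves. Curves are
    described by order relations rather than by maps, because unions of chains of relations give
    Zorn's lemma directly. The delicate point is a limit of one end only of a maximal arc: if the
    leaf continued beyond it, a second arc starting there could be appended. *)

Section crossing_parity.
Context {R : realFieldType}.
Implicit Types (u v : R * R) (e : R) (x y : nat -> R * R).

(** The half-plane of arguments in [[0, pi)], with only one of its two boundary rays, so that it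
    contains exactly one of [u] and [- u] when [u != 0]. *)
Definition upper u : bool := (0 < u.2) || ((u.2 == 0) && (0 < u.1)).

(* Whether a short step from [u] to [v] crosses the negative first axis. *)
Definition crosses u v : bool := (upper u (+) upper v) && (u.1 < 0).

Definition near_vec e u v : Prop := `|u.1 - v.1| < e /\ `|u.2 - v.2| < e.

Definition far_vec e u : Prop := e <= `|u.1| \/ e <= `|u.2|.

Lemma upperN u : u != 0 -> upper (- u) = ~~ upper u.
Proof.
case: u => a b; rewrite /upper /= oppr_gt0 oppr_gt0 oppr_eq0 => ab0.
have {ab0}: (a != 0) || (b != 0).
  by apply: contraNT ab0; rewrite negb_or !negbK => /andP[/eqP-> /eqP->].
by case: (ltgtP b 0) => //=; case: (ltgtP a 0) => //= -> ->; rewrite eqxx.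
Qed.

Lemma near_sign e (a c : R) : `|a - c| < e -> e <= `|a| ->
  (0 < a /\ 0 < c) \/ (a < 0 /\ c < 0).
Proof.
rewrite ltr_norml => /andP[h1 h2]; case: (lerP 0 a) => ha.
  by rewrite ger0_norm // => h3; left; split; lra.
by rewrite ltr0_norm // => h3; right; split; lra.
Qed.

Lemma upper_near e u v : near_vec e u v -> e <= `|u.2| -> upper u = upper v.
Proof.
case=> _ h1 h2; rewrite /upper.
by case: (near_sign h1 h2) => -[]; case: (ltgtP u.2 0) => //; case: (ltgtP v.2 0).
Qed.

Lemma sign_near e u v : near_vec e u v -> e <= `|u.1| ->
  (u.1 < 0) = (v.1 < 0).
Proof.
case=> h1 _ h2.
by case: (near_sign h1 h2) => -[]; case: (ltgtP u.1 0) => //; case: (ltgtP v.1 0).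
Qed.

(** All four vectors are close to [p], which is far from the origin. Either the first coordinate
    keeps its sign, and [crosses] is zero or the change of [upper], which adds up equally along both
    routes; or the second coordinate is large, and [upper] does not change. For the same reason
    [crosses] may test the sign at one end only. *)
Lemma crosses_square e p q r s : far_vec e p -> near_vec e p q ->
  near_vec e p r -> near_vec e p s ->
  crosses p q (+) crosses q r = crosses p s (+) crosses s r.
Proof.
move=> [fp|fp] pq pr ps; rewrite /crosses.
  have [<- <-] : (p.1 < 0) = (q.1 < 0) /\ (p.1 < 0) = (s.1 < 0).
    by split; [exact: sign_near pq fp|exact: sign_near ps fp].
  case: (p.1 < 0).
    by rewrite !andbT; case: (upper p); case: (upper q); case: (upper r);
       case: (upper s).
  by rewrite !andbF.
have [<- <- <-] : [/\ upper p = upper q, upper p = upper s & upper p = upper r].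
  by split; [exact: upper_near pq fp|exact: upper_near ps fp|exact: upper_near pr fp].
by rewrite addbb.
Qed.

(** The negated step crosses the negative axis when the step itself crosses the positive one, and
    the change of [upper] counts the crossings of both. *)
Lemma crossesN e u v : 0 < e -> far_vec e u -> far_vec e v -> near_vec e u v ->
  crosses (- u) (- v) = crosses u v (+) upper u (+) upper v.
Proof.
move=> e0 fu fv uv.
have nz w : far_vec e w -> w != 0.
  by move=> fw; apply/eqP => w0; move: fw; rewrite w0 /far_vec /= normr0; case; lra.
rewrite /crosses !upperN; [|exact: nz..].
case: fu => fu; last by have <- := upper_near uv fu; case: (upper u).
have : (- u).1 < 0 = ~~ (u.1 < 0).
  rewrite /= oppr_lt0; case: ltgtP => // u10; move: fu; rewrite -u10 normr0; lra.
move=> ->; by case: (upper u); case: (upper v); case: (u.1 < 0).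
Qed.

Definition parity x n v : bool :=
  \big[addb/false]_(t < n) crosses (x t - v) (x t.+1 - v).

Lemma parity0 x v : parity x 0 v = false.
Proof. by rewrite /parity big_ord0. Qed.

Lemma parityS x n v :
  parity x n.+1 v = parity x n v (+) crosses (x n - v) (x n.+1 - v).
Proof. by rewrite /parity big_ord_recr. Qed.

(** In each small square with corners [y t - p], [y t.+1 - p], [y t.+1 - q], [y t - q] the two
    routes agree, and inner sides cancel along the chain. A diagonal is a sum of two steps, hence
    the factor 2. *)
Lemma parity_step e y m p q :
  near_vec e p q ->
  (forall t, (t < m)%N -> near_vec e (y t) (y t.+1)) ->
  (forall t, (t <= m)%N -> far_vec (2 * e) (y t - p)) ->
  (forall t, (t <= m)%N -> far_vec (2 * e) (y t - q)) ->
  parity y m p (+) parity y m q =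
  crosses (y m - p) (y m - q) (+) crosses (y 0 - p) (y 0 - q).
Proof.
move=> pq; elim: m => [|m IH] ny fp fq.
  by rewrite !parity0 !addbb.
rewrite !parityS.
have {IH}IH := IH (fun t h => ny t (leqW h)) (fun t h => fp t (leqW h))
   (fun t h => fq t (leqW h)).
have sq : crosses (y m - p) (y m.+1 - p) (+) crosses (y m.+1 - p) (y m.+1 - q) =
          crosses (y m - p) (y m - q) (+) crosses (y m - q) (y m.+1 - q).
  have [n1 n2] := ny m (ltnSn m); have [p1 p2] := pq.
  apply: (@crosses_square (2 * e)); [exact: fp|..].
  - by split=> /=; move: n1 n2 p1 p2; rewrite !ltr_norml; lra.
  - by split=> /=; move: n1 n2 p1 p2; rewrite !ltr_norml; lra.
  - by split=> /=; move: n1 n2 p1 p2; rewrite !ltr_norml; lra.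
move: IH sq; move: (parity y m p) (parity y m q) (crosses (y 0 - p) (y 0 - q))
  (crosses (y m - p) (y m - q)) (crosses (y m - p) (y m.+1 - p))
  (crosses (y m - q) (y m.+1 - q)) (crosses (y m.+1 - p) (y m.+1 - q)).
by do 7!case.
Qed.

(* The winding of the difference [y t - x s] along the boundary of the
   parameter square vanishes. *)
Lemma parity_square e x n y m : 0 < e ->
  (forall s, (s < n)%N -> near_vec e (x s) (x s.+1)) ->
  (forall t, (t < m)%N -> near_vec e (y t) (y t.+1)) ->
  (forall s t, (s <= n)%N -> (t <= m)%N -> far_vec (2 * e) (x s - y t)) ->
  parity y m (x 0) (+) parity y m (x n) =
  parity x n (y m) (+) parity x n (y 0) (+)
  (upper (x 0 - y m) (+) upper (x n - y m) (+)
   upper (x 0 - y 0) (+) upper (x n - y 0)).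
Proof.
move=> e0; elim: n => [|n IH] nx ny f.
  rewrite !parity0 !addbb.
  by case: (upper (x 0 - y m)); case: (upper (x 0 - y 0)).
have {}IH := IH (fun s h => nx s (leqW h)) ny (fun s t h => f s t (leqW h)).
have fN s t : (s <= n.+1)%N -> (t <= m)%N -> far_vec (2 * e) (y t - x s).
  by move=> sn tm; case: (f _ _ sn tm) => h; [left|right]; rewrite distrC.
have st := parity_step (nx n (ltnSn n)) ny
   (fun t h => fN n t (leqnSn n) h) (fun t h => fN n.+1 t (leqnn _) h).
have e20 : 0 < 2 * e by lra.
have nn t : near_vec (2 * e) (x n - y t) (x n.+1 - y t).
  have [n1 n2] := nx n (ltnSn n).
  by split=> /=; move: n1 n2; rewrite !ltr_norml; lra.
have k1 := crossesN e20 (f n m (leqnSn _) (leqnn _))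
  (f n.+1 m (leqnn _) (leqnn _)) (nn m).
have k0 := crossesN e20 (f n 0%N (leqnSn _) (leq0n _))
  (f n.+1 0%N (leqnn _) (leq0n _)) (nn 0%N).
rewrite !(parityS x).
(* Turning [y t - x n] into [x n - y t] by [crossesN] is the source of the terms [upper]. *)
rewrite !opprB in k1 k0; rewrite k1 k0 in st; move: IH st.
move: (parity y m (x 0)) (parity y m (x n)) (parity y m (x n.+1))
 (parity x n (y m)) (parity x n (y 0)) (crosses _ _) (crosses _ _)
 (upper _) (upper _) (upper _) (upper _) (upper _) (upper _).
move=> P1 P2 P3 P4 P5 K1 K2 U1 U2 U3 U4 U5 U6 E1 E2.
have -> : P1 (+) P3 = (P1 (+) P2) (+) (P2 (+) P3).
  by case: P1 E1; case: P2 E2; case: P3.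
rewrite E1 E2 {E1 E2}.
by case: P4; case: P5; case: K1; case: K2; case: U1; case: U2; case: U3;
   case: U4; case: U5; case: U6.
Qed.

End crossing_parity.

(** * Chains in connected sets *)

Section connected_induction.
Context {T : topologicalType}.

(** The condition on [C] is symmetric in [y] and [y'], so the points where [P] holds and those where
    it fails are both relatively open in [A]. *)
Lemma connected_induction (A : set T) (P : T -> Prop) (x : T) :
  connected A -> A x -> P x ->
  (forall z, A z -> exists2 C, nbhs z C &
    forall y y', C y -> C y' -> A y -> A y' -> P y -> P y') ->
  forall y, A y -> P y.
Proof.
move=> cA Ax Px loc.
have open_inv (Q : T -> Prop) : (forall z, A z -> exists2 C, nbhs z C &
    forall y y', C y -> C y' -> A y -> A y' -> Q y -> Q y') ->
    exists2 U, open U & forall y, A y -> U y <-> Q y.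
  move=> Qloc; exists (\bigcup_(C in [set C | open C /\ A `&` C `<=` Q]) C).
    by apply: bigcup_open => C [].
  move=> y Ay; split=> [[C [_ CQ] Cy]|Qy]; first exact: CQ.
  have [C Cn CQ] := Qloc y Ay.
  exists (interior C); last exact: Cn.
  split; first exact: open_interior.
  move=> w [Aw /interior_subset Cw]; apply: (CQ y w) => //; exact: nbhs_singleton.
have [U oU UP] := open_inv P loc.
have [|V oV VP] := open_inv (fun y => ~ P y).
  move=> z /loc[C Cz CP]; exists C => // y y' Cy Cy' Ay Ay' nP Py'.
  exact/nP/(CP y' y).
have E : A `&` P = A.
  apply: cA; first by exists x.
    by exists U => //; apply/seteqP; split=> y [Ay] /UP; move/(_ Ay).
  exists (~` V); first exact: open_closedC.
  apply/seteqP; split=> y [Ay h]; split=> //; first by move/(VP _ Ay).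
  by apply: contrapT => nP; apply: h; apply/VP.
by move=> y; rewrite -E => -[].
Qed.

End connected_induction.

Section planar_chains.
Context {R : realType}.
Implicit Types (G H : set (R * R)).

Lemma connected_chain G (a b : R * R) (e : R) : 0 < e -> connected G ->
  G a -> G b -> exists (n : nat) (x : nat -> R * R),
    [/\ x 0 = a, x n = b, forall t, (t <= n)%N -> G (x t) &
        forall t, (t < n)%N -> near_vec e (x t) (x t.+1)].
Proof.
move=> e0 cG Ga Gb; move: b Gb.
apply: (connected_induction cG Ga); first by exists 0, (fun=> a).
move=> z Gz; exists (ball z.1 (e / 2) `*` ball z.2 (e / 2)).
  by exists (ball z.1 (e / 2), ball z.2 (e / 2)) => //; split;
    apply: nbhsx_ballx; lra.
move=> y y' [y1 y2] [y1' y2'] Gy Gy' [n [x [x0 xn xG xe]]].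
exists n.+1, (fun t => if (t <= n)%N then x t else y'); split=> //.
- by rewrite ltnn.
- by move=> t _; case: ifP => // tn; apply: xG.
move=> t; rewrite ltnS => tn; rewrite tn; case: ltnP => // h.
  by apply: xe.
have -> : t = n by apply/eqP; rewrite eqn_leq tn.
rewrite xn; move: y1 y2 y1' y2'; rewrite /ball /= /ball_ !ltr_norml.
by split; rewrite ltr_norml; lra.
Qed.

Lemma disjoint_compact_far G H : compact G -> compact H -> G `&` H = set0 ->
  \forall e \near (0 : R)^'+, forall x y, G x -> H y -> far_vec e (x - y).
Proof.
move=> /compact_near_coveringP cG cH GH.
have hR : hausdorff_space (R * R)%type by exact: norm_hausdorff.
have clH := compact_closed hR cH.
suff : \forall e \near (0 : R)^'+, G `<=` [set x | forall y, H y -> far_vec e (x - y)].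
  by apply: filterS => e h x y Gx; exact: h.
apply: cG => x Gx.
have : nbhs x (~` H).
  apply: open_nbhs_nbhs; split; first exact: closed_openC.
  by move=> Hx; have : (G `&` H) x by []; rewrite GH.
case=> -[B1 B2] /= [/nbhs_ballP[r1 /= r10 h1] /nbhs_ballP[r2 /= r20 h2]] BH.
(* Halving leaves room for two displacements, of [x'] from [x] by [r] and of [y] from [x'] by
   [e < r]. *)
pose r := Num.min r1 r2 / 2.
have r0 : 0 < r by rewrite divr_gt0 // lt_min r10.
have [rr1 rr2] : 2 * r <= r1 /\ 2 * r <= r2.
  by rewrite /r mulrC divfK // !ge_min !lexx orbT.
exists (ball x.1 r `*` ball x.2 r, [set e | e < r]).
  split; last exact: nbhs_right_lt.
  by exists (ball x.1 r, ball x.2 r) => //; split; apply: nbhsx_ballx.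
move=> [x' e] /= [[x1 x2] er] y Hy; apply: contrapT => /not_orP[/=].
move=> /negP + /negP; rewrite -!ltNge => e1 e2.
apply: (BH y) => //; split; [apply: h1|apply: h2];
  move: x1 x2 e1 e2; rewrite /ball /= /ball_ !ltr_norml; lra.
Qed.

End planar_chains.
Section planar_K33.
Context {R : realType}.

Let addbE (a b : bool) : a (+) b = xorb a b.
Proof. by case: a; case: b. Qed.

(* Summing [parity_square] over all pairs of disjoint edges counts every parity
   twice, but leaves an odd number of sign terms. *)
Theorem planar_K33 (o c : 'I_3 -> R * R) (G : 'I_3 -> 'I_3 -> set (R * R)) :
  (forall i j, [/\ compact (G i j), connected (G i j), G i j (o i) &
                   G i j (c j)]) ->
  ~ (forall i i' j j', i != i' -> j != j' -> G i j `&` G i' j' = set0).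
Proof.
move=> hG dG.
have [e e0 far] : exists2 e : R, 0 < e & forall i i' j j', i != i' -> j != j' ->
    forall x y, G i j x -> G i' j' y -> far_vec (2 * e) (x - y).
  have : \forall e \near (0 : R)^'+, forall i i' j j', i != i' -> j != j' ->
      forall x y, G i j x -> G i' j' y -> far_vec e (x - y).
    apply: filter_forall => i; apply: filter_forall => i'.
    apply: filter_forall => j; apply: filter_forall => j'.
    case: (eqVneq i i') => [_|ni]; first by apply: nearW.
    case: (eqVneq j j') => [_|nj]; first by apply: nearW.
    have [c1 _ _ _] := hG i j; have [c2 _ _ _] := hG i' j'.
    have := disjoint_compact_far c1 c2 (dG _ _ _ _ ni nj).
    by apply: filterS => e h _ _.
  move=> /(filterI (nbhs_right_gt 0)) /filter_ex[e [e0 h]].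
  exists (e / 2); first by rewrite divr_gt0.
  by rewrite mulrC divfK //.
have /all_sig2 : forall ij : 'I_3 * 'I_3, {nx : nat * (nat -> R * R) |
   nx.2 0 = o ij.1 /\ nx.2 nx.1 = c ij.2 &
   (forall t, (t <= nx.1)%N -> G ij.1 ij.2 (nx.2 t)) /\
   (forall t, (t < nx.1)%N -> near_vec e (nx.2 t) (nx.2 t.+1))}.
  move=> [i j]; have [_ cG Go Gc] := hG i j; apply: cid2.
  by have [n [x [? ? ? ?]]] := connected_chain e0 cG Go Gc; exists (n, x).
move=> [nx nxE nxG].
pose P i j v := parity (nx (i, j)).2 (nx (i, j)).1 v.
have sq i i' j j' : i != i' -> j != j' ->
    P i' j' (o i) (+) P i' j' (c j) = P i j (c j') (+) P i j (o i') (+)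
    (upper (o i - c j') (+) upper (c j - c j') (+)
     upper (o i - o i') (+) upper (c j - o i')).
  move=> ni nj; have [/= x0 xn] := nxE (i, j); have [/= y0 ym] := nxE (i', j').
  have [/= xG xe] := nxG (i, j); have [/= yG ye] := nxG (i', j').
  rewrite -x0 -xn -y0 -ym; apply: (parity_square e0) => //.
  by move=> s t sn tm; apply: (far i i' j j') => //; [exact: xG|exact: yG].
(* The points [c j] and [c j'] differ because they lie on disjoint edges. This antisymmetry is what
   makes the final count odd. *)
have anti j j' : j != j' -> upper (c j' - c j) = ~~ upper (c j - c j').
  move=> nj; rewrite -opprB upperN // subr_eq0; apply/eqP => E.
  have i01 : (0 : 'I_3) != 1 by [].
  have [_ _ _ h1] := hG 0 j; have [_ _ _ h2] := hG 1 j'.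
  have : (G 0 j `&` G 1 j') (c j) by split => //; rewrite E.
  by rewrite dG.
pose A i := P i 0 (c 1) (+) P i 0 (c 2) (+) P i 1 (c 0) (+) P i 1 (c 2) (+)
            P i 2 (c 0) (+) P i 2 (c 1).
(* Add [sq] over the six ordered pairs [j != j']. Every parity seen from some [o], and every [upper]
   involving some [o], occurs an even number of times. There remain [A i], [A i'] and three sums
   [upper (c j - c j') (+) upper (c j' - c j)], each equal to 1. *)
have odd i i' : i != i' -> A i (+) A i' = true.
  move=> ni.
  have [n01 n02 n12] : [/\ (0 : 'I_3) != 1, (0 : 'I_3) != 2 & (1 : 'I_3) != 2].
    by [].
  have [n10 n20 n21] : [/\ (1 : 'I_3) != 0, (2 : 'I_3) != 0 & (2 : 'I_3) != 1].
    by [].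
  move: (sq _ _ _ _ ni n01) (sq _ _ _ _ ni n02) (sq _ _ _ _ ni n12).
  move: (sq _ _ _ _ ni n10) (sq _ _ _ _ ni n20) (sq _ _ _ _ ni n21).
  rewrite (anti _ _ n01) (anti _ _ n02) (anti _ _ n12).
  have K : forall a b : bool, a = b -> a (+) b = false by case; case.
  move=> /K e1 /K e2 /K e3 /K e4 /K e5 /K e6.
  have -> : A i (+) A i' = ~~ (false (+) false (+) false (+) false (+) false (+) false).
    rewrite -{1}e1 -{1}e2 -{1}e3 -{1}e4 -{1}e5 -{1}e6 /A !addbE /negb.
    btauto.
  by [].
(* Three booleans cannot be pairwise different. *)
have o1 := odd 0 1 isT; have o2 := odd 0 2 isT; have o3 := odd 1 2 isT.
by move: o1 o2 o3; case: (A 0); case: (A 1); case: (A 2).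
Qed.

End planar_K33.

(** * Triods *)

Lemma ord3_ind (P : 'I_3 -> Prop) : P 0 -> P 1 -> P 2 -> forall j, P j.
Proof.
move=> p0 p1 p2 [[|[|[|//]]] h].
- by rewrite (_ : Ordinal h = 0) //; exact: val_inj.
- by rewrite (_ : Ordinal h = 1) //; exact: val_inj.
- by rewrite (_ : Ordinal h = 2) //; exact: val_inj.
Qed.

Section triods.
Context {T : topologicalType}.
Implicit Types (A C E K N V W : set T).

(** Legs may overlap: each only has to reach a point that the two others miss. Such triods are easy
    to assemble from continua, and they suffice for the drawing of K_{3,3}. *)
Definition triod_free W : Prop :=
  forall (o : T) (L : 'I_3 -> set T) (e : 'I_3 -> T),
    (forall i, [/\ continuum (L i), L i `<=` W, L i o & L i (e i)]) ->
    (forall i j, i != j -> ~ L i (e j)) -> False.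

Lemma ord3_of (P : T -> Prop) (a b c : T) : a != b -> a != c -> b != c ->
  P a -> P b -> P c ->
  exists e : 'I_3 -> T, injective e /\ forall i, P (e i).
Proof.
move=> ab ac bc Pa Pb Pc; exists (fun i => nth a [:: a; b; c] i); split.
  move=> i j /eqP; rewrite nth_uniq //=; first by move/eqP/val_inj.
  by rewrite !inE negb_or ab ac bc.
by case=> -[|[|[]]].
Qed.

Lemma continuumU K C : continuum K -> continuum C -> K `&` C !=set0 ->
  continuum (K `|` C).
Proof.
move=> [[x Kx] cK nK] [_ cC nC] KC; split; first by exists x; left.
  exact: compactU.
exact: connectedU.
Qed.

(** Any point of [K] is the centre of a triod whose legs are the unions of [K] with [F i]; so a
    connected middle piece can stand for the centre. *)
Lemma triod_free_hub W K (F : 'I_3 -> set T) (e : 'I_3 -> T) :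
  triod_free W -> continuum K -> K `<=` W ->
  (forall i, [/\ continuum (F i), F i `<=` W, K `&` F i !=set0 & F i (e i)]) ->
  (forall i, ~ K (e i)) -> (forall i j, i != j -> ~ F i (e j)) -> False.
Proof.
move=> tW cK KW hF Ke Fe; have [[p Kp] _ _] := cK.
apply: (tW p (fun i => K `|` F i) e) => [i|i j ij].
  have [cF FW KF Fi] := hF i; split=> //; first exact: continuumU.
  - by rewrite subUset.
  - by left.
  - by right.
by case; [exact: Ke|exact: Fe].
Qed.

(** If [e] were not a limit, [V] would cut out of the connected [E] a nonempty part both open and
    closed, hence all of [E], including [e]. *)
Lemma limit_in_germ E V (e : T) : connected E -> open V -> V `&` E !=set0 ->
  (forall w, closure V w -> E w -> V w \/ w = e) -> E e -> ~ V e ->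
  closure V e.
Proof.
move=> cE oV VE clV Ee nVe; apply: contrapT => nc; apply: nVe.
have VEE : E `&` V = E.
  apply: cE; first by rewrite setIC.
    by exists V.
  exists (closure V); first exact: closed_closure.
  apply/seteqP; split=> w [Ew Vw]; split=> //; first exact: subset_closure.
  by case: (clV w Vw Ew) => // we; rewrite we in Vw.
by rewrite -VEE in Ee; case: Ee.
Qed.

Hypothesis lcT : locally_connected T.

Lemma component_open A x : open A -> open (connected_component A x).
Proof.
move=> oA; rewrite openE => y Axy.
have Ay := connected_component_sub Axy.
have [C [oC Cy CA cC]] := lcT (open_nbhs_nbhs (conj oA Ay)).
apply: (@filterS _ (nbhs y) _ C); last exact: open_nbhs_nbhs.
by rewrite (same_connected_component Axy); exact: connected_component_max.
Qed.

Lemma component_closure A x w : open A -> closure (connected_component A x) w ->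
  A w -> connected_component A x w.
Proof.
move=> oA clw Aw.
have [C [oC Cw CA cC]] := lcT (open_nbhs_nbhs (conj oA Aw)).
have [v [Axv Cv]] := clw C (open_nbhs_nbhs (conj oC Cw)).
apply: (connected_component_trans Axv).
by exists C.
Qed.

Hypothesis hT : hausdorff_space T.

Lemma closed_set1T (y : T) : closed [set y].
Proof. exact: accessible_closed_set1 (hausdorff_accessible hT) y. Qed.

Lemma open_remove N (y : T) : open N -> open (N `\ y).
Proof.
move=> oN; rewrite setDE; apply: openI => //.
by apply: closed_openC; exact: closed_set1T.
Qed.

Lemma component_limit N y z : open N -> connected N -> N y -> N z -> z != y ->
  closure (connected_component (N `\ y) z) y.
Proof.
move=> oN cN Ny Nz zy; have oNy := open_remove y oN.
have Nyz : (N `\ y) z by split=> //; apply/eqP.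
apply: (limit_in_germ cN) => //.
- exact: component_open.
- by exists z; split=> //; exact: connected_component_refl.
- move=> w clw Nw; have [->|wy] := eqVneq w y; first by right.
  by left; apply: component_closure => //; split=> //; apply/eqP.
- by move=> /connected_component_sub[_ /(_ erefl)].
Qed.

Hypothesis lkT : forall x : T, exists2 K, compact K & nbhs x K.

Lemma small_nbhd (x : T) A : nbhs x A ->
  exists C, [/\ open C, C x, connected C, compact (closure C) & closure C `<=` A].
Proof.
move=> Ax; have [K cK Kx] := lkT x.
have clK := compact_closed hT cK.
have [B Bx BA] : exists2 B, nbhs x B & closure B `<=` A `&` K.
  by apply: (compact_regular hT cK Kx); exact: filterI.
have [C [oC Cx CB cC]] := lcT Bx.
have CAK := subset_trans (closureS CB) BA.
exists C; split=> //.
- apply: (subclosed_compact _ cK); first exact: closed_closure.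
  by move=> w /CAK[].
- by move=> w /CAK[].
Qed.

Lemma closure_continuum C (x : T) : C x -> connected C -> compact (closure C) ->
  continuum (closure C).
Proof.
by move=> Cx cC kC; split=> //;
  [exists x; exact: subset_closure|exact: connected_closure].
Qed.

(** A finite chain of compact closures of small connected open sets replaces a path. *)
Lemma open_connected_join A x y : open A -> connected A -> A x -> A y ->
  exists K, [/\ continuum K, K `<=` A, K x & K y].
Proof.
move=> oA cA Ax; move: y.
apply: (connected_induction cA Ax).
  exists [set x]; split=> //; last by move=> _ ->.
  by split; [exists x|exact: compact_set1|exact: connected1].
move=> z Az; have [C [oC Cz cC kC CA]] := small_nbhd (open_nbhs_nbhs (conj oA Az)).
exists C; first exact: open_nbhs_nbhs.
move=> y y' Cy Cy' _ _ [K [cK KA Kx Ky]].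
exists (K `|` closure C); split.
- apply: continuumU => //; first exact: (closure_continuum Cz).
  by exists y; split=> //; exact: subset_closure.
- by rewrite subUset.
- by left.
- by right; exact: subset_closure.
Qed.

Lemma open_connected_join3 A (q : 'I_3 -> T) : open A -> connected A ->
  (forall i, A (q i)) ->
  exists K, [/\ continuum K, K `<=` A & forall i, K (q i)].
Proof.
move=> oA cA Aq.
have [K [cK KA K0 K1]] := open_connected_join oA cA (Aq 0) (Aq 1).
have [H [cH HA H0 H1]] := open_connected_join oA cA (Aq 0) (Aq 2).
exists (K `|` H); split.
- by apply: continuumU => //; exists (q 0).
- by rewrite subUset.
- by apply: ord3_ind; [left|left|right].
Qed.

Lemma avoid_nbhs W (e : 'I_3 -> T) x (P : pred 'I_3) : open W -> W x ->
  (forall j, P j -> e j <> x) ->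
  nbhs x [set w | W w /\ forall j, P j -> w <> e j].
Proof.
move=> oW Wx Pe; apply: filterI; first exact: open_nbhs_nbhs.
apply: filter_forall => j; have [Pj|nPj] := boolP (P j); last first.
  by apply: nearW.
have : nbhs x (~` [set e j]).
  apply: open_nbhs_nbhs; split; first by apply: closed_openC; exact: closed_set1T.
  by move=> /esym; exact: Pe.
by apply: filterS => w we _.
Qed.

(** The hub is a continuum in [N] through points close to the three boundary points; the spokes are
    closures of small neighborhoods of the [e i], each missing the other two. *)
Lemma triod_free_boundary W N (e : 'I_3 -> T) : open W -> triod_free W ->
  open N -> connected N -> N `<=` W -> injective e ->
  (forall i, [/\ closure N (e i), ~ N (e i) & W (e i)]) -> False.
Proof.
move=> oW tW oN cN NW ie he.
have hE i : {E | [/\ open E, E (e i), connected E, compact (closure E) &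
   closure E `<=` [set w | W w /\ forall j, j != i -> w <> e j]]}.
  apply: cid; apply: small_nbhd; have [_ _ We] := he i.
  by apply: avoid_nbhs => // j ji /ie/eqP; rewrite (negbTE ji).
pose E i := proj1_sig (hE i).
have hq i : {q | N q /\ E i q}.
  apply: cid; have [cl _ _] := he i; have [oE Ee _ _ _] := proj2_sig (hE i).
  exact: (cl _ (open_nbhs_nbhs (conj oE Ee))).
have [|K [cK KN Kq]] := @open_connected_join3 N (fun i => proj1_sig (hq i)) oN cN.
  by move=> i; have [] := proj2_sig (hq i).
apply: (@triod_free_hub W K (fun i => closure (E i)) e) => //.
- exact: subset_trans KN NW.
- move=> i; have [oE Ee cE kE EW] := proj2_sig (hE i).
  split=> //; first exact: (closure_continuum Ee).
  + by move=> w /EW[].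
  + exists (proj1_sig (hq i)); split; first exact: Kq.
    by apply: subset_closure; have [] := proj2_sig (hq i).
  + exact: subset_closure.
- by move=> i /KN; have [_ h _] := he i.
- move=> i j ij; have [_ _ _ _ EW] := proj2_sig (hE i) => /EW[_ /(_ j)].
  by rewrite eq_sym => /(_ ij).
Qed.

(** Here the hub is the closure of a small neighborhood of [y] that misses one chosen point in each
    [V i], and the spokes run inside the [V i] from the hub to these points. *)
Lemma triod_free_cut W (y : T) (V : 'I_3 -> set T) : open W -> triod_free W ->
  W y -> (forall i, [/\ open (V i), connected (V i), V i `<=` W &
                      closure (V i) y]) ->
  (forall i, ~ V i y) -> (forall i j, i != j -> V i `&` V j = set0) -> False.
Proof.
move=> oW tW Wy hV Vy dV.
have he i : {e | V i e}.
  apply: cid; have [_ _ _ cl] := hV i.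
  by have [e [Ve _]] := cl setT filterT; exists e.
pose e i := proj1_sig (he i).
have Ve i : V i (e i) := proj2_sig (he i).
have ey i : e i <> y by move=> E; apply: (Vy i); rewrite -E.
have [B [oB By cB kB BW]] := small_nbhd
  (@avoid_nbhs W e y predT oW Wy (fun j _ => ey j)).
have hq i : {q | V i q /\ B q}.
  by apply: cid; have [_ _ _ cl] := hV i; exact: (cl _ (open_nbhs_nbhs (conj oB By))).
pose q i := proj1_sig (hq i).
have hF i : {F | [/\ continuum F, F `<=` V i, F (q i) & F (e i)]}.
  apply: cid; have [oV cV _ _] := hV i; have [Vq _] := proj2_sig (hq i).
  exact: open_connected_join.
apply: (@triod_free_hub W (closure B) (fun i => proj1_sig (hF i)) e) => //.
- exact: (closure_continuum By).
- by move=> w /BW[].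
- move=> i; have [cF FV Fq Fe] := proj2_sig (hF i); have [_ _ VW _] := hV i.
  split=> //; first exact: subset_trans FV VW.
  exists (q i); split=> //; apply: subset_closure.
  by have [] := proj2_sig (hq i).
- by move=> i /BW[_ /(_ i isT)].
- move=> i j ij /= Fj; have [_ FV _ _] := proj2_sig (hF i).
  have : (V i `&` V j) (e j) by split=> //; exact: FV.
  by rewrite dV.
Qed.

End triods.

(** * Open arcs *)

Section open_arcs.
Context {T : topologicalType}.
Implicit Types (lt : set (T * T)) (N W : set T).

Lemma connected_between (A B : set T) : connected A -> A `<=` B ->
  B `<=` closure A -> connected B.
Proof.
move=> cA AB BA U [x Ux] [C1 oC1 U1] [C2 cC2 U2].
have AC2 : A `&` C2 = A.
  apply: cA.
  - move: Ux; rewrite U1 => -[/BA clx C1x].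
    have [y [Ay C1y]] := clx _ (open_nbhs_nbhs (conj oC1 C1x)).
    exists y; split=> //; have : U y by rewrite U1; split=> //; exact: AB.
    by rewrite U2 => -[].
  - exists C1 => //; apply/seteqP; split=> y [Ay Cy]; split=> //.
      by have : U y; [rewrite U2; split=> //; exact: AB|rewrite U1 => -[]].
    by have : U y; [rewrite U1; split=> //; exact: AB|rewrite U2 => -[]].
  - by exists C2.
rewrite U2; apply/setIidPl => y /BA; rewrite (closure_id C2).1 //.
by apply: closureS; rewrite -AC2 => z [].
Qed.

Definition dom lt : set T := [set y | exists z, lt (y, z)].

(** The relation determines its field, so extension of arcs is plain inclusion of sets of pairs, as
    Zorn's lemma wants it. Since no element is last, [dom] is the whole field. The empty relation
    qualifies. *)
Definition open_arc lt : Prop :=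
  [/\ forall y z, lt (y, z) -> ~ lt (z, y),
      forall x y z, lt (x, y) -> lt (y, z) -> lt (x, z),
      forall y z, dom lt y -> dom lt z -> [\/ y = z, lt (y, z) | lt (z, y)],
      forall y z, lt (y, z) -> (exists w, lt (z, w)) /\ (exists w, lt (w, y)) &
      (forall y, open [set z | lt (y, z)] /\ open [set z | lt (z, y)]) /\
      connected (dom lt)].

Definition opposite lt : set (T * T) := [set p | lt (p.2, p.1)].

Lemma dom_opposite lt : open_arc lt -> dom (opposite lt) = dom lt.
Proof.
case=> _ _ _ ends _; apply/seteqP; split=> y [z /= yz].
  by have [] := ends _ _ yz.
by have [_ [w wy]] := ends _ _ yz; exists w.
Qed.

Lemma open_arc_opposite lt : open_arc lt -> open_arc (opposite lt).
Proof.
move=> alt; have E := dom_opposite alt; case: alt => asym tr tot ends [oR cD].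
split.
- by move=> y z; rewrite /opposite /=; exact: asym.
- by move=> x y z; rewrite /opposite /= => yx zy; exact: tr zy yx.
- by move=> y z; rewrite E => yD zD; case: (tot _ _ yD zD) => h;
    [apply: Or31|apply: Or33|apply: Or32].
- by move=> y z; rewrite /opposite /= => /ends[].
- by split; [move=> y; have [] := oR y|rewrite E].
Qed.

Hypothesis lcT : locally_connected T.
Hypothesis hT : hausdorff_space T.
Hypothesis lkT : forall x : T, exists2 K, compact K & nbhs x K.

Section two_ended.
Variables (W N : set T) (ends : bool -> T).
Hypotheses (oW : open W) (tW : triod_free W) (oN : open N) (cN : connected N).
Hypotheses (NW : closure N `<=` W) (ends_neq : ends true <> ends false).
Hypothesis endsN : forall c, closure N (ends c) /\ ~ N (ends c).
Hypothesis closureN : forall w, closure N w -> N w \/ exists c, w = ends c.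

Let comp y z := connected_component (N `\ y) z.

(** A piece of [N] cut at [y] is recognized by the boundary point of [N] that it reaches; this will
    order [N] from [ends true] to [ends false]. *)
Let side y c : set T := [set z | (N `\ y) z /\ closure (comp y z) (ends c)].

Let subW : N `<=` W.
Proof. by move=> x Nx; apply: NW; exact: subset_closure. Qed.

Let comp_end y z : N y -> (N `\ y) z -> closure (comp y z) y.
Proof. by move=> Ny [Nz /eqP zy]; exact: component_limit. Qed.

Let comp_sub y z : comp y z `<=` N `\ y.
Proof. exact: connected_component_sub. Qed.

Let comp_subN y z : comp y z `<=` N.
Proof. by move=> w /comp_sub[]. Qed.

Let comp_nself y z : ~ comp y z y.
Proof. by move=> /comp_sub[_]; exact. Qed.

Let comp_open y z : open (comp y z).
Proof. by apply: component_open => //; exact: open_remove. Qed.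

(** In a connected neighborhood of [ends c] that avoids [y] and the other end, a component of [N]
    minus [y] can have no boundary point but [ends c], so [limit_in_germ] applies. *)
Let end_germ y c : N y ->
  exists2 E, nbhs (ends c) E & forall w, E w -> N w -> side y c w.
Proof.
move=> Ny; have [cle Ne] := endsN c.
pose A := ~` [set y] `&` ~` [set ends (~~ c)].
have oA : open A by apply: openI; apply: closed_openC; exact: closed_set1T.
have Ae : A (ends c).
  split; first by move=> E; apply: Ne; rewrite E.
  by case: (c) ends_neq => //= h E; apply: h.
have [E [oE Ee EA cE]] := lcT (open_nbhs_nbhs (conj oA Ae)).
exists E; first exact: open_nbhs_nbhs.
move=> w Ew Nw; have [/= wy _] := EA _ Ew; have Nyw : (N `\ y) w by [].
split=> //; apply: (limit_in_germ cE) => //.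
- by exists w; split=> //; exact: connected_component_refl.
- move=> v clv Ev; have [/= vy ve] := EA _ Ev.
  have [Nv|[c' vc]] := closureN (closureS (@comp_subN y w) clv).
    by left; apply: component_closure => //; exact: open_remove.
  by right; rewrite vc; case: (c') (c) vc ve => -[] //= ->.
- by move=> /comp_subN.
Qed.

Let side_ex y c : N y -> exists z, side y c z.
Proof.
move=> Ny; have [E Ee Es] := end_germ c Ny; have [cle _] := endsN c.
by have [z [Nz Ez]] := cle _ Ee; exists z; exact: Es.
Qed.

Let comp_conn y z : connected (comp y z).
Proof. exact: component_connected. Qed.

Let ends_out y c : N y -> y != ends c.
Proof. by move=> Ny; apply/eqP => E; have [_] := endsN c; rewrite -E. Qed.

Let ends_neqN c : ends c != ends (~~ c).
Proof. by apply/eqP; case: c => // E; apply: ends_neq. Qed.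

(** A component reaching both ends would have three boundary points, [y] being the third. *)
Let side_disj y c z : N y -> side y c z -> ~ side y (~~ c) z.
Proof.
move=> Ny [Nyz clc] [_ clc'].
have outW c0 : [/\ ~ comp y z (ends c0) & W (ends c0)].
  have [cl nN] := endsN c0; split; last exact: NW.
  by move=> /comp_subN.
have [e [ie eP]] : exists e : 'I_3 -> T, injective e /\
    forall i, [/\ closure (comp y z) (e i), ~ comp y z (e i) & W (e i)].
  apply: (@ord3_of _ (fun v => [/\ closure (comp y z) v, ~ comp y z v & W v])
    y (ends c) (ends (~~ c))).
  - exact: ends_out.
  - exact: ends_out.
  - exact: ends_neqN.
  - by split; [exact: comp_end|exact: comp_nself|exact: subW].
  - by have [? ?] := outW c.
  - by have [? ?] := outW (~~ c).
apply: (@triod_free_boundary _ lcT hT lkT W (comp y z) e) => //.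
by move=> w /comp_subN; exact: subW.
Qed.

Let comp_eq y z w : comp y z w -> comp y z = comp y w.
Proof. exact: same_connected_component. Qed.

Let three_comps y (v : 'I_3 -> T) : N y -> (forall i, (N `\ y) (v i)) ->
  ~ (forall i j, i != j -> ~ comp y (v i) (v j)).
Proof.
move=> Ny Nv vv; apply: (@triod_free_cut _ lcT hT lkT W y (fun i => comp y (v i))) => //.
- exact: subW.
- move=> i; split=> //; last exact: comp_end.
  by move=> w /comp_subN; exact: subW.
- move=> i j ij; apply/seteqP; split=> // w [wi wj]; apply: (vv i j ij).
  by rewrite (comp_eq wi) -(comp_eq wj); apply: connected_component_refl.
Qed.

Let three_comps' y a b c : N y -> (N `\ y) a -> (N `\ y) b -> (N `\ y) c ->
  [\/ comp y a b, comp y a c | comp y b c].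
Proof.
move=> Ny Na Nb Nc; apply: contrapT => nor.
have ab : ~ comp y a b by move=> h; apply: nor; exact: Or31.
have ac : ~ comp y a c by move=> h; apply: nor; exact: Or32.
have bc : ~ comp y b c by move=> h; apply: nor; exact: Or33.
have sy u v : comp y u v -> comp y v u by exact: connected_component_sym.
pose v (i : 'I_3) := nth a [:: a; b; c] i.
apply: (@three_comps y v) => //; first by case=> -[|[|[|]]].
by case=> -[|[|[|//]]] ? [] [|[|[|//]]] ? // _; rewrite /v //= => h;
  first [exact: ab|exact: ac|exact: bc|exact: ab (sy _ _ h)
        |exact: ac (sy _ _ h)|exact: bc (sy _ _ h)].
Qed.

Let side_comp y c z w : side y c z -> comp y z w -> side y c w.
Proof.
move=> [Nz cl] zw; split; last by rewrite -(comp_eq zw).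
exact: comp_sub zw.
Qed.

(** Both sides are inhabited, and [triod_free_cut] rules out a third component. *)
Let side_tot y c z : N y -> (N `\ y) z -> side y c z \/ side y (~~ c) z.
Proof.
move=> Ny Nz; have [a sa] := side_ex c Ny; have [b sb] := side_ex (~~ c) Ny.
case: (three_comps' Ny Nz sa.1 sb.1) => h.
- by left; apply: (side_comp sa); exact: connected_component_sym.
- by right; apply: (side_comp sb); exact: connected_component_sym.
- by case: (side_disj Ny (side_comp sa h)).
Qed.

(* [comp y z] together with [y] is connected and misses [x], so it lies in one
   component of [N \ x]. *)
Let comp_shift y z x : N y -> (N `\ y) z -> N x -> x <> y -> ~ comp y z x ->
  comp y z `<=` comp x y.
Proof.
move=> Ny Nz Nx xy nx.
suff : comp y z `|` [set y] `<=` comp x y by move=> h w wz; apply: h; left.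
apply: connected_component_max; first by right.
  move=> w [wz|->]; last by split=> // E; apply: xy.
  by split; [exact: comp_subN wz|move=> E; apply: nx; rewrite -E].
apply: (connected_between (@comp_conn y z)); first exact: subsetUl.
by move=> w [|->]; [exact: subset_closure|exact: comp_end].
Qed.

(** Take [w] on the other side of [y]. Its component misses [z], so by [comp_shift] it lies in the
    component of [y] in [N] minus [z], which therefore reaches [ends (~~ c)]. *)
Let side_flip y z c : N y -> N z -> side y c z -> side z (~~ c) y.
Proof.
move=> Ny Nz sz; have [w sw] := side_ex (~~ c) Ny.
have nz : ~ comp y w z.
  by move=> /(side_comp sw); exact: side_disj.
have [[_ /= zy] _] := sz.
split; first by split=> // E; apply: zy.
apply: (closureS (comp_shift Ny sw.1 Nz zy nz)); exact: sw.2.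
Qed.

Let side_trans x y z c : N x -> N y -> side x c y -> side y c z -> side x c z.
Proof.
move=> Nx Ny sxy syz; have syx := side_flip Nx Ny sxy.
have nx : ~ comp y z x.
  by move=> /(side_comp syz); rewrite -[c in side y c x]negbK; move=> h;
     case: (side_disj Ny syx).
have xy : x <> y by case: sxy => -[_ /= h] _ E; apply: h.
apply: (side_comp sxy); apply: (comp_shift Ny syz.1 Nx xy nx).
by apply: connected_component_refl; exact: syz.1.
Qed.

(** A point precedes those on its side towards [ends false]. The last clause says that the arc
    starts at [ends true]; it allows another arc to be joined there. *)
Lemma two_ended_arc : exists lt, [/\ open_arc lt, dom lt = N &
  forall z, N z -> exists2 E, nbhs (ends true) E &
    forall w, E w -> N w -> lt (w, z)].
Proof.
pose lt := [set p : T * T | N p.1 /\ side p.1 false p.2].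
have ltN y z : lt (y, z) -> N y /\ N z by move=> [Ny [[]]].
have ltE y z : N y -> N z -> (lt (y, z) <-> side z true y).
  move=> Ny Nz; split; first by case=> _ /(side_flip Ny Nz).
  by move=> /(side_flip Nz Ny).
have domE : dom lt = N.
  apply/seteqP; split=> y; first by case=> z /ltN[].
  by move=> Ny; have [z sz] := side_ex false Ny; exists z.
exists lt; split=> //; last first.
  move=> z Nz; have [E Ee Es] := end_germ true Nz; exists E => // w Ew Nw.
  by apply/ltE => //; exact: Es.
split.
- move=> y z yz; have [Ny Nz] := ltN _ _ yz => /(ltE _ _ Nz Ny) zy.
  by case: yz => /= _ sz; case: (side_disj Ny zy).
- move=> x y z xy yz; have [Nx Ny] := ltN _ _ xy; have [_ Nz] := ltN _ _ yz.
  split=> //; exact: (side_trans Nx Ny xy.2 yz.2).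
- rewrite domE => y z Ny Nz; have [->|yz] := eqVneq y z; first exact: Or31.
  have [|h|h] := @side_tot y false z Ny; first by split=> //= E; rewrite E eqxx in yz.
    exact: Or32.
  by apply: Or33; apply/ltE.
- move=> y z /ltN[Ny Nz]; split.
    by have [w sw] := side_ex false Nz; exists w.
  have [w sw] := side_ex true Ny; exists w; apply/ltE => //.
  by case: sw => -[].
- split; last by rewrite domE.
  move=> y; have [Ny|nNy] := pselect (N y); last first.
    rewrite (_ : mkset _ = set0); last by apply/seteqP; split=> // z /ltN[].
    rewrite (_ : mkset _ = set0); last by apply/seteqP; split=> // z /ltN[].
    by split; exact: open0.
  have oS c : open (side y c).
    rewrite openE => z sz; apply: (@filterS _ (nbhs z) _ (comp y z)).
      by move=> w; exact: side_comp.
    apply: open_nbhs_nbhs; split; first exact: comp_open.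
    by apply: connected_component_refl; case: sz.
  split.
    rewrite (_ : mkset _ = side y false) //; apply/seteqP.
    by split=> z; [case|move=> sz; split].
  rewrite (_ : mkset _ = side y true) //; apply/seteqP; split=> z.
    by move=> h; have [Nz _] := ltN _ _ h; apply/ltE.
  by move=> sz; apply/ltE => //; case: sz => -[].
Qed.

End two_ended.
End open_arcs.

(** * Order topology, compact intervals and end limits of an open arc *)

Section arc_topology.
Context {T : topologicalType}.
Implicit Types (lt : set (T * T)) (N W G : set T).
Hypothesis lcT : locally_connected T.
Hypothesis hT : hausdorff_space T.
Hypothesis lkT : forall x : T, exists2 K, compact K & nbhs x K.

Definition above lt y : set T := [set z | lt (y, z)].

(** Convergence towards the upper end, expressed without a parametrization. Limits at the lower end
    are right limits of [opposite lt]. *)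
Definition right_limit lt (e : T) : Prop :=
  forall G, nbhs e G -> exists2 q, dom lt q & above lt q `<=` G.

Section one_arc.
Variable lt : set (T * T).
Hypothesis alt : open_arc lt.

Let asym y z : lt (y, z) -> ~ lt (z, y). Proof. by case: alt => + _ _ _ _; apply. Qed.

Let trans x y z : lt (x, y) -> lt (y, z) -> lt (x, z).
Proof. by case: alt => _ + _ _ _; apply. Qed.

Let tot y z : dom lt y -> dom lt z -> [\/ y = z, lt (y, z) | lt (z, y)].
Proof. by case: alt => _ _ + _ _; apply. Qed.

Let irr y : ~ lt (y, y).
Proof. by move=> yy; exact: (asym yy yy). Qed.

Lemma dom_l y z : lt (y, z) -> dom lt y.
Proof. by exists z. Qed.

Lemma dom_r y z : lt (y, z) -> dom lt z.
Proof. by case: alt => _ _ _ ends _ /ends[[w zw] _]; exists w. Qed.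

Lemma ex_below y : dom lt y -> exists w, lt (w, y).
Proof. by case: alt => _ _ _ ends _ [z /ends[]]. Qed.

Lemma open_above y : open (above lt y).
Proof. by case: alt => _ _ _ _ [+ _] => /(_ y)[]. Qed.

Lemma open_below y : open (above (opposite lt) y).
Proof. by case: alt => _ _ _ _ [+ _] => /(_ y)[]. Qed.

Lemma connected_dom : connected (dom lt).
Proof. by case: alt => _ _ _ _ []. Qed.

Lemma open_dom : open (dom lt).
Proof.
rewrite openE => y /ex_below[w wy].
apply: (@filterS _ (nbhs y) _ (above lt w)); first by move=> z /dom_r.
by apply: open_nbhs_nbhs; split; first exact: open_above.
Qed.

Lemma not_above y z : dom lt y -> dom lt z -> ~ lt (z, y) -> y = z \/ lt (y, z).
Proof. by move=> yD zD nzy; case: (tot yD zD); [left|right|]. Qed.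

Lemma connected_convex G x y w : connected G -> G `<=` dom lt -> G x -> G y ->
  lt (x, w) -> lt (w, y) -> G w.
Proof.
move=> cG GD Gx Gy xw wy; apply: contrapT => nGw.
have E : G `&` above lt w = G.
  apply: cG; first by exists y.
    by exists (above lt w) => //; exact: open_above.
  exists (~` above (opposite lt) w).
    by apply: open_closedC; exact: open_below.
  apply/seteqP; split=> z [Gz h]; split=> //; first exact: asym.
  by case: (not_above (dom_r xw) (GD _ Gz) h) => // wz; rewrite wz in nGw.
by rewrite -E in Gx; case: Gx => _; exact: asym.
Qed.

(** Otherwise the points below [x] would be open and closed in the connected field, hence all of
    it. *)
Lemma meets_below C x : dom lt x -> open C -> C x -> exists2 y, C y & lt (y, x).
Proof.
move=> xD oC Cx; apply: contrapT => nC.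
have E : dom lt `&` above (opposite lt) x = dom lt.
  apply: connected_dom.
  - by have [w wx] := ex_below xD; exists w; split=> //; exact: dom_l wx.
  - by exists (above (opposite lt) x) => //; exact: open_below.
  - exists (~` (above lt x `|` C)).
      by apply: open_closedC; apply: openU => //; exact: open_above.
    apply/seteqP; split=> z [zD h]; split=> //.
      by case=> [|Cz]; [exact: asym|apply: nC; exists z].
    have nxz : ~ lt (x, z) by move=> xz; apply: h; left.
    by case: (not_above zD xD nxz) => // zx; case: h; right; rewrite zx.
by have := xD; rewrite -{1}E => -[_]; exact: irr.
Qed.

End one_arc.

(** A connected neighborhood of [x] in the field is convex and has points on both sides of [x]. *)
Lemma arc_nbhd lt (x : T) N : open_arc lt -> dom lt x -> nbhs x N ->
  exists y z, [/\ lt (y, x), lt (x, z) &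
    forall w, lt (y, w) -> lt (w, z) -> N w].
Proof.
move=> alt xD Nx.
have [C [oC Cx CN cC]] := lcT (filterI Nx (open_nbhs_nbhs (conj (open_dom alt) xD))).
have [y Cy yx] := meets_below alt xD oC Cx.
have xD' : dom (opposite lt) x by rewrite dom_opposite.
have [z Cz xz] := meets_below (open_arc_opposite alt) xD' oC Cx.
exists y, z; split=> // w yw wz; have [] // := CN w.
by apply: (connected_convex alt cC _ Cy Cz yw wz) => v /CN[].
Qed.

Definition arc_interval lt (v u : T) : set T :=
  [set w | [/\ dom lt w, ~ lt (w, v) & ~ lt (u, w)]].

(** Connected induction on the moving end point: within a small neighborhood with compact closure,
    moving it enlarges the interval by at most a part of that closure. Both orders of the end points
    are carried along, since the moving one may lie on either side of [v]. *)
Lemma arc_interval_compact lt v u : open_arc lt -> dom lt v -> dom lt u ->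
  compact (arc_interval lt v u).
Proof.
move=> alt vD.
suff : forall z, dom lt z ->
    compact (arc_interval lt v z) /\ compact (arc_interval lt z v).
  by move=> h /h[].
have [asym trans tot ends _] := alt.
have closed_nabove y : closed [set w | ~ lt (y, w)].
  by apply: open_closedC; exact: open_above.
have closed_nbelow y : closed [set w | ~ lt (w, y)].
  by apply: open_closedC; exact: open_below.
have grow K a b : compact K -> K `<=` dom lt -> arc_interval lt a b `<=` K ->
    compact (arc_interval lt a b).
  move=> cK KD IK.
  rewrite (_ : arc_interval lt a b =
    K `&` [set w | ~ lt (w, a)] `&` [set w | ~ lt (b, w)]).
    by apply: compact_closedI => //; exact: compact_closedI.
  apply/seteqP; split=> w; first by move=> h; split; [split|]; [exact: IK|case: h..].
  by move=> [[Kw ?] ?]; split=> //; exact: KD.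
apply: (connected_induction (connected_dom alt) vD).
  suff : compact (arc_interval lt v v) by [].
  apply: (grow [set v]); [exact: compact_set1|by move=> _ ->|].
  by move=> w [wD ? ?]; case: (tot _ _ wD vD).
move=> z zD.
have [C [oC Cz cC kC CD]] := small_nbhd lcT hT lkT
  (open_nbhs_nbhs (conj (open_dom alt) zD)).
have [a [b [az zb abC]]] := arc_nbhd alt zD (open_nbhs_nbhs (conj oC Cz)).
exists [set w | lt (a, w) /\ lt (w, b)].
  apply: filterI; apply: open_nbhs_nbhs; split=> //; first exact: open_above.
  exact: open_below.
move=> s t [as_ sb] [at_ tb] sD tD [k1 k2].
have step w c d : dom lt w -> lt (a, c) -> lt (d, b) -> ~ lt (w, c) ->
    ~ lt (d, w) -> dom lt c -> dom lt d -> closure C w.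
  move=> wD ac db wc dw cD dD; apply: subset_closure; apply: abC.
    by case: (tot _ _ cD wD) => [<-//|cw|//]; exact: trans ac cw.
  by case: (tot _ _ wD dD) => [->//|wd|//]; exact: trans wd db.
split.
  apply: (grow (arc_interval lt v s `|` closure C)); first exact: compactU.
    by move=> w [[]|/CD].
  move=> w [wD wv tw]; have [sw|] := pselect (lt (s, w)); last by left.
  by right; apply: (step w s t) => //; exact: asym.
apply: (grow (arc_interval lt s v `|` closure C)); first exact: compactU.
  by move=> w [[]|/CD].
move=> w [wD wv tw]; have [sw|] := pselect (lt (w, s)); last by left.
by right; apply: (step w t s) => //; exact: asym.
Qed.

(** If [G] misses some [u] above [q] and some [v] below, its part between them is open, and closed
    by compactness of the interval; so all of [G] lies on the arc, contrary to the choice of [e]. *)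
Lemma arc_end lt G e q : open_arc lt -> connected G -> G e -> ~ dom lt e ->
  dom lt q -> G q -> above lt q `<=` G \/ above (opposite lt) q `<=` G.
Proof.
move=> alt cG Ge ne qD Gq; apply: contrapT => /not_orP[].
move=> /existsNP[u /not_implyP[qu nGu]] /existsNP[v /not_implyP[vq nGv]].
have [asym trans tot ends _] := alt.
have vq' : lt (v, q) := vq.
have uD := dom_r alt qu; have vD := dom_l vq'.
apply: ne; suff E : G `&` (above lt v `&` above (opposite lt) u) = G.
  by move: Ge; rewrite -E => -[_ [_ eu]]; exists u.
apply: cG; first by exists q.
  exists (above lt v `&` above (opposite lt) u) => //.
  by apply: openI; [exact: open_above|exact: open_below].
exists (arc_interval lt v u).
  by apply: compact_closed => //; exact: arc_interval_compact.
apply/seteqP; split=> w [Gw].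
  by case=> vw wu; split=> //; split; [exact: dom_r vw|exact: asym|exact: asym].
case=> wD wv uw; split=> //; split.
  by case: (not_above alt vD wD wv) => // E; rewrite E in nGv.
by case: (not_above alt wD uD uw) => // E; rewrite -E in nGu.
Qed.

Lemma arc_end_cases lt e : open_arc lt -> closure (dom lt) e -> ~ dom lt e ->
  right_limit lt e \/ right_limit (opposite lt) e.
Proof.
move=> alt cle ne; apply: contrapT => /not_orP[].
move=> /existsNP[G1 /not_implyP[n1 h1]] /existsNP[G2 /not_implyP[n2 h2]].
have [G [oG Ge GG cG]] := lcT (filterI n1 n2).
have [q [qD Gq]] := cle G (open_nbhs_nbhs (conj oG Ge)).
case: (arc_end alt cG Ge ne qD Gq) => h.
  by apply: h1; exists q => // w /h/GG[].
by apply: h2; exists q; [rewrite dom_opposite|move=> w /h/GG[]].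
Qed.

Lemma right_limit_meet lt q r : open_arc lt -> dom lt q -> dom lt r ->
  exists w, lt (q, w) /\ lt (r, w).
Proof.
move=> alt qD rD; have [asym trans tot _ _] := alt.
case: (tot _ _ qD rD) => [<-|qr|rq].
- by have [w qw] := qD; exists w.
- by have [w rw] := rD; exists w; split=> //; exact: trans qr rw.
- by have [w qw] := qD; exists w; split=> //; exact: trans rq qw.
Qed.

Lemma right_limit_unique lt e e' : open_arc lt ->
  right_limit lt e -> right_limit lt e' -> e = e'.
Proof.
move=> alt re re'; apply: hT => A B Ae Be'.
have [q qD qA] := re _ Ae; have [r rD rB] := re' _ Be'.
have [w [qw rw]] := right_limit_meet alt qD rD.
by exists w; split; [exact: qA|exact: rB].
Qed.

Lemma right_limit_out lt e : open_arc lt -> right_limit lt e -> ~ dom lt e.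
Proof.
move=> alt re eD; have [asym _ _ _ _] := alt; have [z ez] := eD.
have [q qD qz] := re _ (open_nbhs_nbhs (conj (open_below alt z) ez)).
have [w [qw zw]] := right_limit_meet alt qD (dom_r alt ez).
by have /asym := qz _ qw.
Qed.

Lemma right_limit_closure lt e : open_arc lt -> right_limit lt e ->
  closure (dom lt) e.
Proof.
move=> alt re G /re[q qD qG]; have [z qz] := qD.
by exists z; split; [exact: dom_r qz|exact: qG].
Qed.

End arc_topology.

(** * Maximal open arcs *)

Section maximal_arc.
Context {T : topologicalType}.
Implicit Types (lt : set (T * T)) (N W G : set T).
Hypothesis lcT : locally_connected T.
Hypothesis hT : hausdorff_space T.
Hypothesis lkT : forall x : T, exists2 K, compact K & nbhs x K.

Section germs.
Variables (W G : set T) (e v : T).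
Hypotheses (oW : open W) (tW : triod_free W) (oG : open G) (cG : connected G).
Hypotheses (Ge : G e) (GW : closure G `<=` W) (Gv : G v) (ve : v != e).

Let A := connected_component (G `\ e) v.

Let oGe : open (G `\ e). Proof. exact: open_remove. Qed.

Let oA : open A. Proof. exact: component_open. Qed.

Let AG : A `<=` G `\ e. Proof. exact: connected_component_sub. Qed.

Let Av : A v.
Proof. by apply: connected_component_refl; split=> //; exact/eqP. Qed.

Lemma germ_component p : A p -> exists2 E, nbhs e E & forall w, E w -> A w ->
  w <> p /\ closure (connected_component (A `\ p) w) e.
Proof.
move=> Ap; have [_ pe] := AG Ap.
have ep : (G `\ p) e by split=> // E; apply: pe.
have [E [oE Ee EG cE]] := lcT (open_nbhs_nbhs (conj (open_remove hT p oG) ep)).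
exists E; first exact: open_nbhs_nbhs.
move=> w Ew Aw; have [_ /= wp] := EG _ Ew; split=> //.
apply: (limit_in_germ cE) => //.
- by apply: component_open => //; exact: open_remove.
- by exists w; split=> //; exact: connected_component_refl.
- move=> u clu Eu; have [Gu /= up] := EG _ Eu.
  have [->|ue] := eqVneq u e; first by right.
  left; apply: component_closure => //; first exact: open_remove.
  split=> //; apply: component_closure => //; last by split=> //; exact/eqP.
  by apply: closureS clu => x /connected_component_sub[].
- by move=> /connected_component_sub[/AG[_ /(_ erefl)]].
Qed.

(** The piece of [A] minus [v] near [e] has [e] and [v] in its boundary and no third boundary point,
    so [two_ended_arc] orders it, starting at [e]. *)
Lemma germ_arc : exists z lt, [/\ open_arc lt,
  dom lt = connected_component (A `\ v) z, (A `\ v) z, closure (dom lt) e &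
  forall p, dom lt p -> exists2 E, nbhs e E &
    forall w, E w -> dom lt w -> lt (w, p)].
Proof.
have [E Ee EA] := germ_component Av.
have cAe : closure A e by exact: component_limit.
have [z [Az Ez]] := cAe _ Ee.
have [zv cle] := EA z Ez Az; have Avz : (A `\ v) z by [].
pose B := connected_component (A `\ v) z.
have BA : B `<=` A by move=> w /connected_component_sub[].
have BG : B `<=` G by move=> w /BA/AG[].
have nBv : ~ B v by move=> /connected_component_sub[_]; exact.
have nBe : ~ B e by move=> /BA/AG[_]; exact.
have oB : open B by apply: component_open => //; exact: open_remove.
have cB : connected B by exact: component_connected.
have GW' : G `<=` W by move=> w Gw; apply: GW; exact: subset_closure.
have BW : closure B `<=` W by apply: subset_trans GW; exact: closureS.
have clv : closure B v.
  apply: component_limit => //; first exact: component_connected.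
  exact/eqP.
pose ends c := if c then e else v.
have [lt [alt dlt ltE]] : exists lt, [/\ open_arc lt, dom lt = B &
    forall p, B p -> exists2 E, nbhs (ends true) E &
      forall w, E w -> B w -> lt (w, p)].
  apply: (@two_ended_arc _ lcT hT lkT W) => //.
  - by move=> E'; move: ve; rewrite -[v]/(ends false) -E' /= eqxx.
  - by case.
  - move=> w clw; apply: contrapT => /not_orP[nw /forallNP we].
    have [f [fi fP]] : exists f : 'I_3 -> T, injective f /\
        forall i, [/\ closure B (f i), ~ B (f i) & W (f i)].
      apply: (@ord3_of _ (fun x => [/\ closure B x, ~ B x & W x]) w v e) => //.
      + by apply/eqP; exact: (we false).
      + by apply/eqP; exact: (we true).
      + by split=> //; exact: BW.
      + by split=> //; exact: BW.
      + by split=> //; exact: GW'.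
    apply: (@triod_free_boundary _ lcT hT lkT W B f) => //.
    exact: subset_trans BG GW'.
exists z, lt; split=> //; rewrite ?dlt //; exact: ltE.
Qed.

End germs.

Definition maximal_open_arc lt : Prop :=
  open_arc lt /\ forall lt', open_arc lt' -> lt `<=` lt' -> lt' `<=` lt.

Lemma opposite_maximal lt : maximal_open_arc lt -> maximal_open_arc (opposite lt).
Proof.
move=> [alt mx]; split; first exact: open_arc_opposite.
move=> lt' alt' sub [y z] yz.
by apply: (mx (opposite lt') (open_arc_opposite alt') _ (z, y)) => // -[a b] /(sub (b, a)).
Qed.

Lemma open_arc_bigcup (F : set (set (T * T))) : F `<=` open_arc ->
  total_on F subset -> open_arc (\bigcup_(lt in F) lt).
Proof.
move=> Fa tF.
have both p q : (\bigcup_(lt in F) lt) p -> (\bigcup_(lt in F) lt) q ->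
    exists lt, [/\ F lt, lt p & lt q].
  move=> [l1 F1 p1] [l2 F2 q2]; case: (tF _ _ F1 F2) => s.
    by exists l2; split=> //; exact: s.
  by exists l1; split=> //; exact: s.
have domU : dom (\bigcup_(lt in F) lt) = \bigcup_(lt in F) dom lt.
  apply/seteqP; split=> x; first by case=> y [l Fl xy]; exists l => //; exists y.
  by case=> l Fl [y xy]; exists y, l.
split.
- move=> y z yz zy; have [l [Fl l1 l2]] := both _ _ yz zy.
  by have [asym _ _ _ _] := Fa _ Fl; exact: (asym y z).
- move=> x y z xy yz; have [l [Fl l1 l2]] := both _ _ xy yz.
  by have [_ tr _ _ _] := Fa _ Fl; exists l => //; exact: (tr x y z).
- move=> y z [y' yy] [z' zz]; have [l [Fl l1 l2]] := both _ _ yy zz.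
  have [_ _ tot _ _] := Fa _ Fl.
  have [||->|h|h] := tot y z; [by exists y'|by exists z'|exact: Or31|..].
    by apply: Or32; exists l.
  by apply: Or33; exists l.
- move=> y z [l Fl yz]; have [_ _ _ ends _] := Fa _ Fl.
  by have [[w h] [w' h']] := ends _ _ yz; split; [exists w, l|exists w', l].
split.
  move=> y; split.
    rewrite (_ : mkset _ = \bigcup_(lt in F) above lt y).
      by apply: bigcup_open => l Fl; apply: open_above; exact: Fa.
    by apply/seteqP; split=> z [l Fl h]; exists l.
  rewrite (_ : mkset _ = \bigcup_(lt in F) above (opposite lt) y).
    by apply: bigcup_open => l Fl; apply: open_below; exact: Fa.
  by apply/seteqP; split=> z [l Fl h]; exists l.
rewrite domU; have [[x [l0 F0 x0]]|D0] := pselect ((\bigcup_(lt in F) dom lt) !=set0).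
  rewrite (_ : \bigcup_(lt in F) dom lt =
    \bigcup_(lt in [set l | F l /\ l0 `<=` l]) dom lt).
    apply: bigcup_connected.
      by exists x => l [_ s]; have [y xy] := x0; exists y; exact: s.
    by move=> l [Fl _]; apply: connected_dom; exact: Fa.
  apply/seteqP; split=> y [l Fl ly]; last by exists l => //; case: Fl.
  case: (tF _ _ F0 Fl) => s; first by exists l.
  by exists l0; [split|have [z yz] := ly; exists z; exact: s].
rewrite (_ : \bigcup_(lt in F) dom lt = set0); first exact: connected0.
by apply/seteqP; split=> // y Dy; apply: D0; exists y.
Qed.

(** Were there other points arbitrarily close to [e], an arc [ltB] disjoint from the given one would
    issue from [e]. The given arc, then [e], then [ltB] would form a larger open arc. *)
Lemma right_limit_neighbourhood lt e W : maximal_open_arc lt ->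
  open W -> triod_free W -> W e -> right_limit lt e ->
  ~ right_limit (opposite lt) e -> nbhs e (dom lt `|` [set e]).
Proof.
move=> [alt mx] oW tW We re nle.
have ne := right_limit_out alt re.
have [asym trans tot ends _] := alt.
have oD := open_dom alt.
(* No lower ray of the arc lies in [G0]. By [arc_end], a connected subset of [G] that contains [e]
   and a point of the arc then contains the upper ray of this point. *)
have /existsNP[G0 /not_implyP[G0e nG0]] := nle.
have [G [oG Ge cG kG GWG]] := small_nbhd lcT hT lkT
  (filterI (open_nbhs_nbhs (conj oW We)) G0e).
have GW : closure G `<=` W by move=> w /GWG[].
have GG0 w : G w -> G0 w by move=> /subset_closure/GWG[].
have up H q : connected H -> H e -> H `<=` G -> dom lt q -> H q -> above lt q `<=` H.
  move=> cH He HG qD Hq; case: (arc_end lcT hT lkT alt cH He ne qD Hq) => // h.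
  by case: nG0; exists q; [rewrite dom_opposite|move=> w /h/HG/GG0].
apply: contrapT => nn.
have [v [Gv nv ve]] : exists v, [/\ G v, ~ dom lt v & v <> e].
  apply: contrapT => h; apply: nn.
  apply: (@filterS _ (nbhs e) _ G); last exact: open_nbhs_nbhs.
  move=> w Gw; apply: contrapT => /not_orP[w1 w2].
  by apply: h; exists w.
have /eqP ve' := ve.
have oGe : open (G `\ e) by exact: open_remove.
pose comp w := connected_component (G `\ e) w.
(* [dom lt `&` G] is clopen in [G \ e]. *)
have clD w : closure (dom lt) w -> G w -> dom lt w \/ w = e.
  move=> clw Gw; have [|nw] := pselect (dom lt w); first by left.
  right; case: (arc_end_cases lcT hT lkT alt clw nw) => lw.
    exact: (right_limit_unique hT alt lw re).
  case: nG0; have [q qD qG] := lw _ (open_nbhs_nbhs (conj oG Gw)).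
  by exists q => // x /qG/GG0.
have comp_dom w u : comp w u -> dom lt w -> dom lt u.
  move=> wu wD; have [Gw ew] : (G `\ e) w.
    apply: contrapT => nw; move: wu; rewrite /comp.
    by rewrite connected_component_out.
  have E : comp w `&` dom lt = comp w.
    apply: component_connected.
    - by exists w; split=> //; exact: connected_component_refl.
    - by exists (dom lt).
    - exists (closure (dom lt)); first exact: closed_closure.
      apply/seteqP; split=> x [xw h]; split=> //; first exact: subset_closure.
      have [Gx xe] := connected_component_sub xw.
      by case: (clD x h Gx).
  by move: wu; rewrite -E => -[].
have [q0 q0D q0G] := re _ (open_nbhs_nbhs (conj oG Ge)).
have [q [q0q _]] := right_limit_meet alt q0D q0D.
have qD := dom_r alt q0q; have Gq := q0G _ q0q.
have qe : q != e by apply/eqP => E; rewrite E in qD.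
have [z [ltB [aB domB Az clB nearB]]] := germ_arc oW tW oG cG Ge GW Gv ve'.
pose A := comp v; pose B := dom ltB.
have BA : B `<=` A by rewrite /B domB => w /connected_component_sub[].
have AD w : A w -> ~ dom lt w.
  by move=> vw wD; apply: nv; apply: comp_dom wD; exact: connected_component_sym.
have BD w : B w -> ~ dom lt w by move=> /BA/AD.
have nBe : ~ B e by move=> /BA/connected_component_sub[_]; exact.
have GW' : G `<=` W by move=> w Gw; apply: GW; exact: subset_closure.
have oC w : open (comp w) by exact: component_open.
have oB : open B by exact: open_dom.
have cut3 (V : 'I_3 -> set T) : (forall i, [/\ open (V i), connected (V i),
     V i `<=` G `\ e & closure (V i) e]) ->
     (forall i j, i != j -> V i `&` V j = set0) -> False.
  move=> hV; apply: (@triod_free_cut _ lcT hT lkT W e V) => //.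
    move=> i; have [? ? s ?] := hV i; split=> //.
    by move=> w /s[/GW'].
  by move=> i; have [_ _ s _] := hV i => /s[_]; exact.
have cut3' V1 V2 V3 : [/\ open V1, open V2 & open V3] ->
    [/\ connected V1, connected V2 & connected V3] ->
    [/\ V1 `<=` G `\ e, V2 `<=` G `\ e & V3 `<=` G `\ e] ->
    [/\ closure V1 e, closure V2 e & closure V3 e] ->
    [/\ V1 `&` V2 = set0, V1 `&` V3 = set0 & V2 `&` V3 = set0] -> False.
  move=> [? ? ?] [? ? ?] [? ? ?] [? ? ?] [d1 d2 d3].
  apply: (cut3 (fun i => nth V1 [:: V1; V2; V3] i)).
    by case=> -[|[|[|]]].
  case=> -[|[|[|//]]] ? [] [|[|[|//]]] ? // _; by rewrite //= setIC.
have clC w : G w -> w <> e -> closure (comp w) e.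
  by move=> Gw /eqP we; exact: component_limit.
have subC w : comp w `<=` G `\ e by exact: connected_component_sub.
have disC w u : ~ comp w u -> comp w `&` comp u = set0.
  move=> nwu; apply/seteqP; split=> // x [wx ux]; apply: nwu.
  by apply: (connected_component_trans wx); exact: connected_component_sym.
have BG : B `<=` G `\ e by apply: subset_trans BA (subC v).
have cq : closure (comp q) e by apply: clC => //; exact/eqP.
have Gqq : comp q q by apply: connected_component_refl; split=> //; exact/eqP.
(* Near [e] there is only the old arc, [e] and the new arc: a point elsewhere would provide a third
   open connected set accumulating at [e], next to [comp q] and either [A] or [B]. *)
have near0 : nbhs e [set w | [\/ dom lt w, w = e | B w]].
  have Av : A v by exact: connected_component_refl.
  have [E Ee EA] := germ_component oG Ge Av.
  apply: (@filterS _ (nbhs e) _ (E `&` G)); last first.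
    by apply: filterI => //; exact: open_nbhs_nbhs.
  move=> w [Ew Gw]; have [wD|nw] := pselect (dom lt w); first exact: Or31.
  have [->|/eqP we] := eqVneq w e; first exact: Or32.
  have Gww : comp w w by exact: connected_component_refl.
  apply: Or33; have Aw : A w.
    apply: contrapT => nAw.
    apply: (@cut3' (comp q) A (comp w)); split; rewrite ?disC //.
    - exact: oC.
    - exact: component_connected.
    - exact: component_connected.
    - exact: component_connected.
    - exact: subC.
    - exact: clC.
    - exact: clC.
    - by move=> /comp_dom/(_ qD).
    - by move=> /comp_dom/(_ qD).
  have [wv clw] := EA w Ew Aw.
  pose H := connected_component (A `\ v) w.
  have Avw : (A `\ v) w by [].
  have Hw : H w by exact: connected_component_refl.
  have oAv : open (A `\ v) by apply: (open_remove hT v); exact: oC.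
  have HA : H `<=` A by move=> x /connected_component_sub[].
  apply: contrapT => nBw.
  apply: (@cut3' (comp q) B H); split=> //.
  - exact: component_open.
  - exact: component_connected.
  - exact: connected_dom.
  - exact: component_connected.
  - exact: subset_trans HA (subC v).
  - apply/seteqP; split=> // x [qx /BD]; apply; exact: comp_dom qx qD.
  - apply/seteqP; split=> // x [qx /HA/AD]; apply; exact: comp_dom qx qD.
  - apply/seteqP; split=> // x [Bx Hx]; apply: nBw.
    rewrite /B domB in Bx *; apply: (connected_component_trans Bx).
    exact: connected_component_sym.
have near1 y : dom lt y -> nbhs e [set w | [\/ lt (y, w), w = e | B w]].
  move=> yD; have ey : (G `\ y) e by split=> // E; rewrite E in ne.
  have [H [oH He HG cH]] := lcT (open_nbhs_nbhs (conj (open_remove hT y oG) ey)).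
  apply: filterS (filterI near0 (open_nbhs_nbhs (conj oH He))).
  move=> w [[wD|we|Bw] Hw]; [|exact: Or32|exact: Or33].
  have HG' : H `<=` G by move=> x /HG[].
  have wH := up _ _ cH He HG' wD Hw.
  have nHy : ~ H y by move=> /HG[_]; exact.
  apply: Or31; case: (tot _ _ yD wD) => // [yw|wy]; first by rewrite yw in nHy.
  by case: nHy; exact: wH.
have near2 y : B y -> nbhs e [set w | [\/ dom lt w, w = e | ltB (w, y)]].
  move=> By; have [E Ee EB] := nearB y By.
  apply: filterS (filterI near0 Ee) => w [[wD|we|Bw] Ew];
    [exact: Or31|exact: Or32|apply: Or33; exact: EB].
(* The concatenation. Its rays are open at [e], where the two arcs meet, by [near1] and [near2]. *)
pose lt' : set (T * T) := [set p | [\/ lt p, ltB p, dom lt p.1 /\ (p.2 = e \/ B p.2)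
   | p.1 = e /\ B p.2]].
have lD y z' : lt (y, z') -> dom lt y /\ dom lt z'.
  by move=> h; split; [exact: dom_l h|exact: dom_r alt _ _ h].
have BD' y z' : ltB (y, z') -> B y /\ B z'.
  by move=> h; split; [exact: dom_l h|exact: dom_r aB _ _ h].
have [asymB transB totB endsB _] := aB.
have [b Bb] : exists b, B b by have [b [Bb _]] := clB setT filterT; exists b.
have dom' : dom lt' = dom lt `|` [set e] `|` ([set e] `|` B).
  apply/seteqP; split=> y.
    case=> z' [/= /lD[yD _]|/= /BD'[yB _]|[/= yD _]|[/= -> _]].
    - by left; left.
    - by right; right.
    - by left; left.
    - by left; right.
  have He : dom lt' e by exists b; apply: Or44.
  case=> -[h|h]; rewrite ?h //.
    by exists e; apply: Or43; split=> //; left.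
  by have [z' yz] := h; exists z'; apply: Or42.
have lowD y z' : lt' (y, z') -> dom lt z' -> lt (y, z').
  move=> [//|/= /BD'[_ /BD]//|[/= _ [->//|/BD//]]|[/= _ /BD//]].
have highB y z' : lt' (y, z') -> B y -> ltB (y, z').
  move=> h By; case: h => [/= /lD[yD _]|//|[/= yD _]|[/= ye _]].
  - by case: (BD y).
  - by case: (BD y).
  - by case: nBe; rewrite -ye.
have lowe y : lt' (y, e) -> dom lt y.
  by move=> [/= /lD[]//|/= /BD'[_ /nBe]//|[]//|[/= _ /nBe]].
have highe y : lt' (e, y) -> B y.
  by move=> [/= /lD[]//|/= /BD'[/nBe]//|[]//|[]].
have inl y z' : lt' (y, z') -> [\/ dom lt y, y = e | B y].
  move=> yz; have : dom lt' y by exists z'.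
  by rewrite dom' => -[[?|->]|[->|?]]; [exact: Or31|exact: Or32|exact: Or32|exact: Or33].
have inr y z' : lt' (y, z') -> [\/ dom lt z', z' = e | B z'].
  move=> [/= /lD[_ ?]|/= /BD'[_ ?]|[/= _ [->|?]]|[/= _ ?]];
    by [exact: Or31|exact: Or32|exact: Or33].
have alt' : open_arc lt'.
  split.
  - move=> y z' yz zy; case: (inr _ _ yz) => h.
    + have l1 := lowD _ _ yz h; have [yD _] := lD _ _ l1.
      exact: (asym y z' l1 (lowD _ _ zy yD)).
    + by subst z'; apply: (BD y); [exact: highe|exact: lowe].
    + have l1 := highB _ _ zy h; have [_ yB] := BD' _ _ l1.
      exact: (asymB z' y l1 (highB _ _ yz yB)).
  - move=> x y z' xy yz; case: (inr _ _ yz) => h.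
    + have l1 := lowD _ _ yz h; have [yD _] := lD _ _ l1.
      by apply: Or41; exact: (trans x y z' (lowD _ _ xy yD) l1).
    + subst z'; have yD := lowe _ yz; have [xD _] := lD _ _ (lowD _ _ xy yD).
      by apply: Or43; split=> //; left.
    + case: (inl _ _ xy) => hx.
      * by apply: Or43; split=> //; right.
      * by apply: Or44.
      * have l1 := highB _ _ xy hx; have [_ yB] := BD' _ _ l1.
        by apply: Or42; exact: (transB x y z' l1 (highB _ _ yz yB)).
  - move=> y z'; rewrite dom' => hy hz.
    have {}hy : [\/ dom lt y, y = e | B y].
      by case: hy => -[h|h]; [exact: Or31|exact: Or32|exact: Or32|exact: Or33].
    have {}hz : [\/ dom lt z', z' = e | B z'].
      by case: hz => -[h|h]; [exact: Or31|exact: Or32|exact: Or32|exact: Or33].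
    case: hy hz => [yD|->|yB] [zD|->|zB].
    + by case: (tot _ _ yD zD) => h; [exact: Or31|apply: Or32; exact: Or41|
        apply: Or33; exact: Or41].
    + by apply: Or32; apply: Or43; split=> //; left.
    + by apply: Or32; apply: Or43; split=> //; right.
    + by apply: Or33; apply: Or43; split=> //; left.
    + exact: Or31.
    + by apply: Or32; apply: Or44.
    + by apply: Or33; apply: Or43; split=> //; right.
    + by apply: Or33; apply: Or44.
    + by case: (totB _ _ yB zB) => h; [exact: Or31|apply: Or32; exact: Or42|
        apply: Or33; exact: Or42].
  - move=> y z' yz; split.
      have : dom lt' z'.
        by rewrite dom'; case: (inr _ _ yz) => h; [left; left|left; right|right; right].
      by [].
    case: (inl _ _ yz) => h.
    + by have [w wy] := ex_below alt h; exists w; apply: Or41.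
    + by exists q; apply: Or43; split=> //; left.
    + by have [w wy] := ex_below aB h; exists w; apply: Or42.
  - split; last first.
      rewrite dom'; apply: connectedU; first by exists e; split; [right|left].
        apply: (connected_between (connected_dom alt)); first exact: subsetUl.
        by move=> w [|->]; [exact: subset_closure|exact: right_limit_closure].
      apply: (connected_between (connected_dom aB)); first exact: subsetUr.
      by move=> w [->|]; [|exact: subset_closure].
    have nb (U : set T) w : open U -> U w -> nbhs w U.
      by move=> oU Uw; exact: open_nbhs_nbhs.
    move=> y; split; rewrite openE => w [] /=.
    + move=> h; apply: filterS (nb _ w (open_above alt y) h) => u; exact: Or41.
    + move=> h; apply: filterS (nb _ w (open_above aB y) h) => u; exact: Or42.
    + move=> [yD [->|Bw]].
        apply: filterS (near1 y yD) => u [h|h|h]; first exact: Or41.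
          by apply: Or43; split=> //; left.
        by apply: Or43; split=> //; right.
      by apply: filterS (nb _ w oB Bw) => u Bu; apply: Or43; split=> //; right.
    + move=> [-> Bw]; apply: filterS (nb _ w oB Bw) => u Bu; exact: Or44.
    + move=> h; apply: filterS (nb _ w (open_below alt y) h) => u; exact: Or41.
    + move=> h; apply: filterS (nb _ w (open_below aB y) h) => u; exact: Or42.
    + by move=> [wD yr]; apply: filterS (nb _ w oD wD) => u uD; apply: Or43.
    + move=> [-> By]; apply: filterS (near2 y By) => u [h|h|h].
      * by apply: Or43; split=> //; right.
      * exact: Or44.
      * exact: Or42.
have : lt (q, e) by apply: (mx lt') => //; [move=> p; exact: Or41|apply: Or43; split=> //; left].
by move=> /lD[].
Qed.

End maximal_arc.

(** * The complement of a maximal arc *)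

Section arc_complement.
Context {T : topologicalType}.
Implicit Types (lt : set (T * T)) (N W G : set T).
Hypothesis lcT : locally_connected T.
Hypothesis hT : hausdorff_space T.
Hypothesis lkT : forall x : T, exists2 K, compact K & nbhs x K.

(** Both ends of the arc converge to [e], so off [e] the arc has no boundary points; as [G] avoids
    [x], being above [x] is then open and closed in the component. *)
Lemma component_above lt G e x u : open_arc lt -> right_limit lt e ->
  right_limit (opposite lt) e -> G `<=` ~` [set x] -> dom lt x -> lt (x, u) ->
  (G `\ e) u -> connected_component (G `\ e) u `<=` above lt x.
Proof.
move=> alt re le Gx xD xu Gu.
set C := connected_component _ _.
have [asym trans tot ends _] := alt.
suff E : C `&` above lt x = C by move=> w; rewrite -E => -[].
apply: component_connected.
- by exists u; split=> //; exact: connected_component_refl.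
- by exists (above lt x) => //; exact: open_above.
exists (closure (dom lt) `&` ~` above (opposite lt) x).
  apply: closedI; first exact: closed_closure.
  by apply: open_closedC; exact: open_below.
apply/seteqP; split=> w [Cw h]; split=> //.
  split; last exact: asym.
  by apply: subset_closure; exact: (dom_r alt h).
have [clw nwx] := h; have [Gw we] := connected_component_sub Cw.
have wD : dom lt w.
  apply: contrapT => nw; apply: we.
  case: (arc_end_cases lcT hT lkT alt clw nw) => lw.
    exact: (right_limit_unique hT alt lw re).
  exact: (right_limit_unique hT (open_arc_opposite alt) lw le).
by case: (not_above alt xD wD nwx) => // xw; case: (Gx w).
Qed.

(** The ends of the arc already provide two open connected sets accumulating at [e], one above [x]
    and one below. A point off the arc close to [e] would provide a third. *)
Lemma two_limits_neighbourhood lt e W : open_arc lt -> open W ->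
  triod_free W -> W e -> right_limit lt e -> right_limit (opposite lt) e ->
  nbhs e (dom lt `|` [set e]).
Proof.
move=> alt oW tW We re le.
have ne := right_limit_out alt re.
have alt' := open_arc_opposite alt.
have [asym trans tot ends _] := alt.
have [x xD _] := re setT filterT.
have Wxe : (W `\ x) e by split=> // E; rewrite E in ne.
have [G [oG Ge cG kG GW]] := small_nbhd lcT hT lkT
  (open_nbhs_nbhs (conj (open_remove hT x oW) Wxe)).
have GW' w : G w -> (W `\ x) w by move=> /subset_closure/GW.
have Gx : G `<=` ~` [set x] by move=> w /GW'[].
apply: contrapT => nn.
have [v [Gv nv ve]] : exists v, [/\ G v, ~ dom lt v & v <> e].
  apply: contrapT => h; apply: nn.
  apply: (@filterS _ (nbhs e) _ G); last exact: open_nbhs_nbhs.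
  move=> w Gw; apply: contrapT => /not_orP[w1 w2].
  by apply: h; exists w.
have [q qD qG] := re G (open_nbhs_nbhs (conj oG Ge)).
have [u [qu xu]] := right_limit_meet alt qD xD.
have [r rD rG] := le G (open_nbhs_nbhs (conj oG Ge)).
have xD' : dom (opposite lt) x by rewrite dom_opposite.
have [s [rs xs]] := right_limit_meet alt' rD xD'.
have uD := dom_r alt xu; have sD : dom lt s by exists x.
have Gu : (G `\ e) u by split; [exact: qG|move=> E; rewrite E in uD].
have Gs : (G `\ e) s by split; [exact: rG|move=> E; rewrite E in sD].
have Gve : (G `\ e) v by [].
pose comp w := connected_component (G `\ e) w.
have cu : comp u `<=` above lt x by exact: component_above.
have cs : comp s `<=` above (opposite lt) x by exact: (component_above alt').
have nuv w : comp u w -> ~ comp v w.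
  move=> uw vw; apply: nv; apply: (@dom_r _ lt alt x); apply: cu.
  by apply: (connected_component_trans uw); exact: connected_component_sym.
have nsv w : comp s w -> ~ comp v w.
  move=> sw vw; apply: nv; have : above (opposite lt) x v.
    apply: cs; apply: (connected_component_trans sw).
    exact: connected_component_sym.
  by move=> h; exists x.
have nus w : comp u w -> ~ comp s w.
  by move=> /cu uw /cs sw; exact: (asym x w).
pose V (i : 'I_3) := comp (nth u [:: u; s; v] i).
have VG (i : 'I_3) : (G `\ e) (nth u [:: u; s; v] i).
  by case: i => -[|[|[|]]].
apply: (@triod_free_cut _ lcT hT lkT W e V) => //.
- move=> i; split.
  + by apply: component_open => //; exact: open_remove.
  + exact: component_connected.
  + by move=> w /connected_component_sub[/GW'[]].
  + have [Gi ei] := VG i; apply: component_limit => //; exact/eqP.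
- by move=> i /connected_component_sub[_]; exact.
- case=> -[|[|[|//]]] ? [] [|[|[|//]]] ? // _; apply/seteqP; split=> // w [];
  rewrite /V //= => h1 h2; do [exact: nus h1 h2|exact: nus h2 h1|
    exact: nsv h1 h2|exact: nsv h2 h1|exact: nuv h1 h2|exact: nuv h2 h1].
Qed.

Hypothesis cT : connected [set: T].
Hypothesis tT : forall y : T, exists W, [/\ open W, W y & triod_free W].

Lemma clopen_setT (A : set T) : open A -> closed A -> A !=set0 -> A = setT.
Proof.
by move=> oA cA A0; apply: cT => //; [exists A|exists A]; rewrite // setTI.
Qed.

Lemma not_isolated (p p' : T) G : p <> p' -> open G -> G p ->
  exists v, G v /\ v <> p.
Proof.
move=> pp oG Gp; apply: contrapT => h; apply: pp.
have Gp1 : G = [set p].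
  apply/seteqP; split=> w; last by move=> ->.
  by move=> Gw; apply: contrapT => wp; apply: h; exists w.
have : [set p] = setT.
  by apply: clopen_setT; [rewrite -Gp1|exact: closed_set1T|exists p].
by move=> E; have : [set: T] p' by []; rewrite -E.
Qed.

Lemma exists_open_arc (p p' : T) : p <> p' ->
  exists2 lt : set (T * T), open_arc lt & dom lt !=set0.
Proof.
move=> pp; have [W [oW Wp tW]] := tT p.
have [G [oG Gp cG kG GW]] := small_nbhd lcT hT lkT (open_nbhs_nbhs (conj oW Wp)).
have [v [Gv /eqP vp]] := not_isolated pp oG Gp.
have [z [lt [alt dlt Az _ _]]] := germ_arc lcT hT lkT oW tW oG cG Gp GW Gv vp.
by exists lt => //; exists z; rewrite dlt; exact: connected_component_refl.
Qed.

Lemma exists_maximal_arc (p p' : T) : p <> p' ->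
  exists2 lt : set (T * T), maximal_open_arc lt & dom lt !=set0.
Proof.
move=> pp; have [lt0 a0 [x [y xy]]] := exists_open_arc pp.
have [lt [alt mx]] := Zorn_bigcup (@open_arc_bigcup T).
have mlt : maximal_open_arc lt.
  split=> // lt' alt' sub; apply: contrapT => ns.
  by apply: (mx lt').
(* The empty relation is an open arc as well, but not a maximal one, since [lt0] extends it. *)
exists lt => //; apply: contrapT => n0.
have lt_empty : lt = set0.
  by apply/seteqP; split=> // -[a b] ab; apply: n0; exists a, b.
have : lt (x, y) by apply: (mlt.2 lt0 a0) => //; rewrite lt_empty.
by rewrite lt_empty.
Qed.

(** Every boundary point of the arc has a neighborhood inside the closure of the arc. This closure
    is thus open and closed, hence the whole space, and every point off the arc is a boundary
    point. *)
Lemma maximal_arc_complement lt e : maximal_open_arc lt -> dom lt !=set0 ->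
  ~ dom lt e -> nbhs e (dom lt `|` [set e]) /\
    (right_limit lt e \/ right_limit (opposite lt) e).
Proof.
move=> mlt D0.
have alt : open_arc lt := mlt.1.
have H w : closure (dom lt) w -> ~ dom lt w -> nbhs w (dom lt `|` [set w]) /\
    (right_limit lt w \/ right_limit (opposite lt) w).
  move=> clw nw; have cases := arc_end_cases lcT hT lkT alt clw nw; split=> //.
  have [W [oW Ww tW]] := tT w.
  have [r|nr] := pselect (right_limit lt w); last first.
    have l : right_limit (opposite lt) w by case: cases.
    rewrite -(dom_opposite alt).
    by apply: (right_limit_neighbourhood lcT hT lkT (opposite_maximal mlt) oW).
  have [l|nl] := pselect (right_limit (opposite lt) w).
    exact: (two_limits_neighbourhood alt oW).
  exact: (right_limit_neighbourhood lcT hT lkT mlt oW).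
suff E : closure (dom lt) = setT by apply: H; rewrite E.
apply: clopen_setT.
- rewrite openE => w clw; have [wD|nw] := pselect (dom lt w).
    apply: (@filterS _ (nbhs w) _ (dom lt)); first exact: subset_closure.
    by apply: open_nbhs_nbhs; split=> //; exact: open_dom.
  have [nb _] := H w clw nw.
  apply: (@filterS _ (nbhs w) _ _ _ _ nb) => u [|->//]; exact: subset_closure.
- exact: closed_closure.
- by have [x xD] := D0; exists x; exact: subset_closure.
Qed.

End arc_complement.

(** * Parametrization of arcs *)

Section dense_sequence.
Context {T : topologicalType}.

Lemma second_countable_dense (x0 : T) : @second_countable T ->
  exists p : nat -> T, forall U : set T, open U -> U !=set0 -> exists n, U (p n).
Proof.
move=> [B /countable_injP[f fi] [oB bB]].
have h n : exists q : T, forall U, B U -> f U = n -> U !=set0 -> U q.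
  have [[U [BU fU [q Uq]]]|nU] := pselect (exists U, [/\ B U, f U = n & U !=set0]).
    exists q => V BV fV _; suff -> : V = U by [].
    by apply: fi; rewrite ?inE // fU.
  by exists x0 => U BU fU U0; case: nU; exists U.
have [p hp] := choice h; exists p => U oU [x Ux].
have [V [BV Vx] VU] := bB x U (open_nbhs_nbhs (conj oU Ux)).
by exists (f V); apply: VU; apply: hp => //; exists x.
Qed.

End dense_sequence.

Section dyadic_sums.
Context {R : realType}.
Implicit Types (a b : nat -> R).

Lemma dyadic_sum_bound n : \sum_(k < n) (2 ^- k : R) <= 2.
Proof.
suff : \sum_(k < n) (2 ^- k : R) = 2 - 2 * 2 ^- n.
  by move=> ->; rewrite gerBl mulr_ge0 // invr_ge0 exprn_ge0.
elim: n => [|n IH]; first by rewrite big_ord0 expr0 invr1; lra.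
rewrite big_ord_recr /= {}IH exprS invfM.
by move: (2 ^- n : R) => t; lra.
Qed.

(** For terms in [[0, 1]] this is the sum of the series; as a supremum it is compared term by term
    without convergence statements. *)
Definition dyadic_sup a : R := sup [set \sum_(k < n) a k * 2 ^- k | n in setT].

Let dyadic_ge0 k : 0 <= (2 ^- k : R).
Proof. by rewrite invr_ge0 exprn_ge0. Qed.

Lemma dyadic_sum_shift a b c n : 0 <= c -> (forall k, a k <= b k + c) ->
  \sum_(k < n) a k * 2 ^- k <= \sum_(k < n) b k * 2 ^- k + 2 * c.
Proof.
move=> c0 ab; apply: (@le_trans _ _ (\sum_(k < n) (b k * 2 ^- k + c * 2 ^- k))).
  by apply: ler_sum => k _; rewrite -mulrDl ler_wpM2r.
rewrite big_split /= lerD2l -mulr_sumr mulrC ler_wpM2r //.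
exact: dyadic_sum_bound.
Qed.

Lemma dyadic_sum_le2 a n : (forall k, a k <= 1) ->
  \sum_(k < n) a k * 2 ^- k <= 2.
Proof.
move=> a1; have a1' k : a k <= 0 + 1 by rewrite add0r.
apply: le_trans (@dyadic_sum_shift a (fun=> 0) 1 n ler01 a1') _.
by rewrite big1 => [|k _]; rewrite ?mul0r // add0r mulr1.
Qed.

Lemma dyadic_sup_le2 a : (forall k, a k <= 1) -> dyadic_sup a <= 2.
Proof.
move=> a1; apply: ge_sup; first by exists 0, 0%N; rewrite ?big_ord0.
by move=> _ [n _ <-]; exact: dyadic_sum_le2.
Qed.

Lemma dyadic_sup_ub a n : (forall k, a k <= 1) ->
  \sum_(k < n) a k * 2 ^- k <= dyadic_sup a.
Proof.
move=> a1; apply: ub_le_sup; last by exists n.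
by exists 2 => _ [m _ <-]; exact: dyadic_sum_le2.
Qed.

Lemma dyadic_sup_shift a b c : 0 <= c -> (forall k, b k <= 1) ->
  (forall k, a k <= b k + c) -> dyadic_sup a <= dyadic_sup b + 2 * c.
Proof.
move=> c0 b1 ab; apply: ge_sup; first by exists 0, 0%N; rewrite ?big_ord0.
move=> _ [n _ <-]; apply: le_trans (dyadic_sum_shift n c0 ab) _.
by rewrite lerD2r dyadic_sup_ub.
Qed.

Lemma dyadic_sup_lt a b m : (forall k, b k <= 1) -> (forall k, 0 <= a k) ->
  (forall k, a k <= b k) -> a m < b m -> dyadic_sup a < dyadic_sup b.
Proof.
move=> b1 a0 ab abm; pose d := (b m - a m) * 2 ^- m.
have d0 : 0 < d by rewrite mulr_gt0 ?subr_gt0 // invr_gt0 exprn_gt0.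
apply: (@lt_le_trans _ _ (dyadic_sup a + d)); first by rewrite ltrDl.
rewrite -lerBrDr; apply: ge_sup; first by exists 0, 0%N; rewrite ?big_ord0.
move=> _ [n _ <-]; rewrite lerBrDr.
(* The partial sum is lengthened so as to contain the index [m]. *)
have mN : (m < n + m.+1)%N by rewrite addnS ltnS leq_addl.
apply: le_trans (dyadic_sup_ub (n + m.+1) b1).
apply: (@le_trans _ _ (\sum_(k < n + m.+1) a k * 2 ^- k + d)).
  rewrite lerD2r big_split_ord /= lerDl; apply: sumr_ge0 => k _.
  by rewrite mulr_ge0.
rewrite (bigD1 (Ordinal mN)) //= [leRHS](bigD1 (Ordinal mN)) //=.
rewrite addrAC /d -mulrDl [a m + _]addrC subrK lerD2l.
by apply: ler_sum => k _; rewrite ler_wpM2r.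
Qed.

End dyadic_sums.

Section parametrization.
Context {R : realType} {T : topologicalType} {X : metricType R}.
Variables (iota : T -> X) (lt : set (T * T)).
Hypotheses (iotaC : continuous iota) (iotaI : injective iota).
Hypotheses (lcT : locally_connected T) (alt : open_arc lt).

Let dist (y z : T) : R := mdist (iota y) (iota z).

(* How far one gets from [p] on the way from [p] up to [x]. *)
Let excursion p x : set R := [set 0] `|`
  [set Num.min 1 (dist p z) | z in [set z | lt (p, z) /\ ~ lt (x, z)]].

Let psi p x : R := sup (excursion p x).

Let asym y z : lt (y, z) -> ~ lt (z, y). Proof. by case: alt => + _ _ _ _; apply. Qed.

Let trans x y z : lt (x, y) -> lt (y, z) -> lt (x, z).
Proof. by case: alt => _ + _ _ _; apply. Qed.

Let tot y z : dom lt y -> dom lt z -> [\/ y = z, lt (y, z) | lt (z, y)].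
Proof. by case: alt => _ _ + _ _; apply. Qed.

Let irr y : ~ lt (y, y).
Proof. by move=> yy; exact: (asym yy yy). Qed.

Let exc_le1 p x r : excursion p x r -> r <= 1.
Proof. by case=> [->|[z _ <-]]; rewrite ?ler01 // ge_min lexx. Qed.

Let exc_ub p x r : excursion p x r -> r <= psi p x.
Proof. by apply: ub_le_sup; exists 1 => s; exact: exc_le1. Qed.

Let psi_ge0 p x : 0 <= psi p x.
Proof. by apply: exc_ub; left. Qed.

Let psi_ub p x c : (forall r, excursion p x r -> r <= c) -> psi p x <= c.
Proof. by move=> h; apply: ge_sup => //; exists 0; left. Qed.

Let psi_le1 p x : psi p x <= 1.
Proof. by apply: psi_ub => r; exact: exc_le1. Qed.

Let psi_mono p x y : lt (x, y) -> psi p x <= psi p y.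
Proof.
move=> xy; apply: psi_ub => r [->|[z [pz xz] <-]]; first exact: psi_ge0.
by apply: exc_ub; right; exists z => //; split=> // yz; apply: xz; exact: trans yz.
Qed.

(** A point reached between [x] and [y] is farther from [p] than [x] by at most [c]; if [p] itself
    lies in this interval, the whole distance is at most [c]. *)
Let psi_step p x y c : lt (x, y) -> 0 <= c ->
  (forall z w, arc_interval lt x y z -> arc_interval lt x y w -> dist z w <= c) ->
  psi p y <= psi p x + c.
Proof.
move=> xy c0 hc; apply: psi_ub => r [->|[z [pz yz] <-]].
  by rewrite addr_ge0.
have [xz|nxz] := pselect (lt (x, z)); last first.
  rewrite -[leLHS]addr0 lerD //; apply: exc_ub; right; exists z => //.
have xD := dom_l xy; have pD := dom_l pz; have zD := dom_r alt pz.
have Iz : arc_interval lt x y z by split=> //; exact: asym.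
have [px|npx] := pselect (lt (p, x)).
  apply: (@le_trans _ _ (Num.min 1 (dist p x) + c)); last first.
    by rewrite lerD2r; apply: exc_ub; right; exists x => //; split=> //; exact: irr.
  have Ix : arc_interval lt x y x by split=> //; exact: asym.
  have := hc _ _ Ix Iz; rewrite /dist => h.
  have := metric_triangle (iota p) (iota x) (iota z).
  case: (leP 1 (mdist (iota p) (iota x))) => ?;
    case: (leP 1 (mdist (iota p) (iota z))) => ?; lra.
have Ip : arc_interval lt x y p.
  by split=> // yp; apply: yz; exact: trans yp pz.
apply: (@le_trans _ _ (dist p z)); first by rewrite ge_min lexx orbT.
by apply: le_trans (hc _ _ Ip Iz) _; rewrite lerDr.
Qed.

Lemma arc_between x y : lt (x, y) -> exists z, lt (x, z) /\ lt (z, y).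
Proof.
move=> xy; apply: contrapT => h.
have yD := dom_r alt xy; have xD := dom_l xy.
have E : dom lt `&` above lt x = dom lt.
  apply: connected_dom => //.
  - by exists y.
  - by exists (above lt x) => //; exact: open_above.
  - exists (~` above (opposite lt) y).
      by apply: open_closedC; exact: open_below.
    apply/seteqP; split=> w [wD hw]; split=> //.
      by move=> wy; apply: h; exists w.
    case: (tot xD wD) => // [xw|wx]; case: hw; first by rewrite -xw.
    exact: trans wx xy.
by have := xD; rewrite -{1}E => -[_]; exact: irr.
Qed.

(** For a dense sequence [p] the functions [psi (p k)] are nondecreasing, and the one with [p m]
    between [x] and [y] vanishes at [x] but not at [y]. The weights [2 ^- k] make the sum finite and
    transmit a common bound on the increments. *)
Lemma arc_parametrization : @second_countable T -> exists f : T -> R,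
  [/\ forall x y, lt (x, y) -> f x < f y,
      forall x, dom lt x -> {for x, continuous f} &
      forall x, 0 <= f x <= 2].
Proof.
move=> scT; have [[x0 _]|D0] := pselect (dom lt !=set0); last first.
  exists (fun=> 0); split; last by rewrite lexx ler0n.
    by move=> x y xy; case: D0; exists x, y.
  by move=> x xD; case: D0; exists x.
have [p hp] := second_countable_dense x0 scT.
pose f x := dyadic_sup (fun k => psi (p k) x).
have f_mono x y : lt (x, y) -> f x < f y.
  move=> xy; have [z [xz zy]] := arc_between xy.
  have [m [xm my]] : exists m, (above lt x `&` above (opposite lt) y) (p m).
    apply: hp; last by exists z.
    by apply: openI; [exact: open_above|exact: open_below].
  apply: (@dyadic_sup_lt _ _ _ m) => //; first by move=> k; exact: psi_mono.
  apply: (@le_lt_trans _ _ 0).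
    apply: psi_ub => r [->//|[w [pw xw] _]].
    by case: xw; exact: trans xm pw.
  apply: (@lt_le_trans _ _ (Num.min 1 (dist (p m) y))).
    rewrite lt_min ltr01 /= mdist_gt0; apply/eqP => /iotaI E.
    by move: my; rewrite E; exact: irr.
  by apply: exc_ub; right; exists y => //; split=> //; exact: irr.
exists f; split=> //; last first.
  move=> x; apply/andP; split.
    have := @dyadic_sup_ub _ (fun k => psi (p k) x) 0 (fun k => psi_le1 _ _).
    by rewrite big_ord0.
  exact: dyadic_sup_le2.
move=> x xD; apply/cvgrPdist_lt => e e0.
(* Points of [A] are at distance at most [c] from each other, and [dyadic_sup_shift] doubles [c]; so
   [f] varies by at most [e / 2] near [x]. *)
pose c := e / 4; have c0 : 0 < c by rewrite divr_gt0.
pose A := [set w | dist x w < c / 2].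
have Ax : nbhs x A.
  have c20 : 0 < c / 2 by rewrite divr_gt0.
  apply: (@filterS _ (nbhs x) _ (iota @^-1` ball (iota x) (c / 2))).
    by move=> w; rewrite /= ballEmdist.
  by apply: iotaC; exact: nbhsx_ballx.
have [a [b [ax xb abA]]] := arc_nbhd lcT alt xD Ax.
have small z w : lt (a, z) -> lt (z, b) -> lt (a, w) -> lt (w, b) ->
    dist z w <= c.
  move=> az zb aw wb; have := abA _ az zb; have := abA _ aw wb.
  rewrite /A /= /dist; have := metric_triangle (iota z) (iota x) (iota w).
  by rewrite (metric_sym (iota z) (iota x)); lra.
have step y z : lt (a, y) -> lt (y, z) -> lt (z, b) -> f z <= f y + 2 * c.
  move=> ay yz zb; apply: dyadic_sup_shift => [|k|k]; [exact: ltW|exact: psi_le1|].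
  apply: psi_step => //; first exact: ltW.
  have yD := dom_l yz; have zD := dom_r alt yz.
  have inI u : arc_interval lt y z u -> lt (a, u) /\ lt (u, b).
    move=> [uD uy zu]; split.
      by case: (not_above alt yD uD uy) => [<-//|]; exact: trans ay.
    by case: (not_above alt uD zD zu) => [->//|uz]; exact: trans uz zb.
  by move=> u v /inI[? ?] /inI[? ?]; exact: small.
have nb : nbhs x (above lt a `&` above (opposite lt) b).
  by apply: filterI; apply: open_nbhs_nbhs; split=> //; [exact: open_above|exact: open_below].
apply: filterS nb => y [ay yb].
have yD := dom_r alt ay.
case: (tot xD yD) => [<-|xy|yx]; first by rewrite subrr normr0.
  have := f_mono _ _ xy; have := step _ _ ax xy yb; rewrite ltr_norml /c; lra.
have := f_mono _ _ yx; have := step _ _ ay yx xb; rewrite ltr_norml /c; lra.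
Qed.

End parametrization.

(** * Homeomorphisms of subsets *)

Section subtype_homeomorphisms.
Implicit Types (T U V : topologicalType).

Lemma sub_nbhsP T (A : set T) (x : A) (N : set A) :
  nbhs x N <-> exists2 M, nbhs (val x) M & forall y : A, M (val y) -> N y.
Proof.
split.
  move=> Nx; have [_ [[M oM <-] Mx] MN] : exists2 O, open_nbhs x O & O `<=` N.
    by move: Nx; rewrite nbhsE.
  by exists M => //; apply: open_nbhs_nbhs; split.
move=> [M Mx MN].
by apply: (@filterS _ (nbhs x) _ (val @^-1` M)) => //; exact: initial_continuous.
Qed.

Lemma sub_open T (A : set T) (O : set T) : open O -> open (val @^-1` O : set A).
Proof. by move=> oO; exists O. Qed.

Lemma homeomorphic_sym T U : homeomorphic T U -> homeomorphic U T.
Proof. by move=> [f [g [*]]]; exists g, f. Qed.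

Lemma homeomorphic_trans U T V :
  homeomorphic T U -> homeomorphic U V -> homeomorphic T V.
Proof.
move=> [f [g [cf cg fg gf]]] [f' [g' [cf' cg' fg' gf']]].
exists (f' \o f), (g \o g'); split.
- by move=> x; apply: continuous_comp; [exact: cf|exact: cf'].
- by move=> x; apply: continuous_comp; [exact: cg'|exact: cg].
- by move=> x /=; rewrite fg' fg.
- by move=> x /=; rewrite gf gf'.
Qed.

(** The map lives on the ambient spaces and neighborhoods are taken there, which keeps subtypes out
    of the applications. *)
Lemma homeomorphic_sub T U (A : set T) (V : set U) (f : T -> U) :
  (forall x, A x -> V (f x)) -> (forall y, V y -> exists2 x, A x & f x = y) ->
  (forall x y, A x -> A y -> f x = f y -> x = y) ->
  (forall x H, A x -> nbhs (f x) H ->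
    exists2 G, nbhs x G & forall y, A y -> G y -> H (f y)) ->
  (forall x G, A x -> nbhs x G ->
    exists2 H, nbhs (f x) H & forall y, A y -> H (f y) -> G y) ->
  homeomorphic A V.
Proof.
move=> fV fs fi fc fo.
have vA (x : A) : A (val x) by apply: set_mem; exact: valP.
have vV (y : V) : V (val y) by apply: set_mem; exact: valP.
pose F (x : A) : V := exist _ (f (val x)) (mem_set (fV _ (vA x))).
have gex (y : V) : {x | A x & f x = val y} by apply: cid2; exact/fs/vV.
pose G (y : V) : A := exist _ (s2val (gex y)) (mem_set (s2valP (gex y))).
have fG y : f (val (G y)) = val y by exact: (s2valP' (gex y)).
have FG : cancel G F by move=> y; apply: val_inj; exact: fG.
have GF : cancel F G.
  by move=> x; apply: val_inj; apply: fi; [exact: vA|exact: vA|exact: fG].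
exists F, G; split=> //.
- move=> x N /sub_nbhsP[H Hx HN]; apply/sub_nbhsP.
  have [K Kx KH] := fc (val x) H (vA x) Hx.
  by exists K => // y Ky; apply: HN; apply: KH.
- move=> y N /sub_nbhsP[K Ky KN]; apply/sub_nbhsP.
  have [H Hy HK] := fo _ K (vA (G y)) Ky.
  rewrite fG in Hy.
  by exists H => // z Hz; apply: KN; apply: HK; rewrite ?fG.
Qed.

Lemma homeomorphic_setT T : homeomorphic T [set: T].
Proof.
pose f (x : T) : [set: T] := exist _ x (mem_set I).
exists f, val; split.
- by move=> x N /sub_nbhsP[M Mx MN]; apply: filterS Mx => y; exact: (MN (f y)).
- exact: initial_continuous.
- by [].
- by move=> x; exact: val_inj.
Qed.

(** Charts of [one_manifold] take values in subsets of the subtype [half_line R]; this reduces them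
    to subsets of the line. *)
Lemma homeomorphic_nested U (B W : set U) : W `<=` B ->
  homeomorphic W [set v : B | W (val v)].
Proof.
move=> WB; pose V := [set v : B | W (val v)].
have vW (x : W) : W (val x) by apply: set_mem; exact: valP.
have vV (y : V) : W (val (val y)) by apply: (set_mem (valP y)).
pose f0 (x : W) : B := exist _ (val x) (mem_set (WB _ (vW x))).
have Vf0 x : V (f0 x) by exact: vW.
pose f (x : W) : V := exist _ (f0 x) (mem_set (Vf0 x)).
pose g (y : V) : W := exist _ (val (val y)) (mem_set (vV y)).
exists f, g; split.
- move=> x N /sub_nbhsP[M /sub_nbhsP[K Kx KM] MN]; apply/sub_nbhsP.
  by exists K => // y Ky; apply: MN; apply: KM.
- move=> y N /sub_nbhsP[K Ky KN]; apply/sub_nbhsP.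
  exists (val @^-1` K); last by move=> z Kz; exact: KN.
  by apply/sub_nbhsP; exists K.
- by move=> x; exact: val_inj.
- by move=> y; apply: val_inj; exact: val_inj.
Qed.

End subtype_homeomorphisms.

Section unit_parametrization.
Context {R : realType} {T : topologicalType}.
Implicit Types (lt : set (T * T)) (h : T -> R).
Hypothesis lcT : locally_connected T.
Hypothesis hT : hausdorff_space T.
Hypothesis lkT : forall x : T, exists2 K, compact K & nbhs x K.

Definition unit_param lt h : Prop :=
  [/\ forall x y, lt (x, y) -> h x < h y,
      forall x, dom lt x -> {for x, continuous h},
      forall x, dom lt x -> 0 < h x < 1 &
      forall t : R, 0 < t < 1 -> exists2 x, dom lt x & h x = t].

Lemma unit_param_opposite lt h : open_arc lt -> unit_param lt h ->
  unit_param (opposite lt) (fun x => 1 - h x).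
Proof.
move=> alt [hm hc hr hs]; rewrite /unit_param dom_opposite //; split.
- by move=> x y /hm; rewrite ltrD2l ltrN2.
- by move=> x xD; apply: cvgB; [exact: cvg_cst|exact: hc].
- by move=> x /hr /andP[h0 h1]; apply/andP; split; lra.
- move=> t /andP[t0 t1]; have [|x xD hx] := hs (1 - t); first by apply/andP; split; lra.
  by exists x => //; rewrite hx; lra.
Qed.

(** An affine change sends the infimum and supremum of the values to 0 and 1. They are not attained
    because the arc has no end points; connectedness gives all values between. *)
Lemma exists_unit_param {X : metricType R} (iota : T -> X) lt :
  continuous iota -> injective iota -> @second_countable T ->
  open_arc lt -> dom lt !=set0 -> exists h, unit_param lt h.
Proof.
move=> ic ii scT alt [x0 x0D].
have [f [fm fc fb]] := arc_parametrization ic ii lcT alt scT.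
pose I := f @` dom lt.
have I0 : I !=set0 by exists (f x0), x0.
have Iu : has_ubound I by exists 2 => _ [x _ <-]; case/andP: (fb x).
have Il : has_lbound I by exists 0 => _ [x _ <-]; case/andP: (fb x).
pose a := inf I; pose b := sup I.
have fa x : dom lt x -> a < f x.
  move=> xD; have [w wx] := ex_below alt xD; apply: le_lt_trans (fm _ _ wx).
  by apply: ge_inf => //; exists w => //; exact: dom_l wx.
have fbb x : dom lt x -> f x < b.
  move=> xD; have [w xw] := xD; apply: lt_le_trans (fm _ _ xw) _.
  by apply: ub_le_sup => //; exists w => //; exact: (dom_r alt xw).
have ab : 0 < b - a by rewrite subr_gt0; apply: lt_trans (fbb _ x0D); exact: fa.
have nz : b - a != 0 by rewrite gt_eqF.
exists (fun x => (f x - a) / (b - a)); split.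
- by move=> x y /fm xy; rewrite ltr_pM2r ?invr_gt0 // ltrD2r.
- move=> x xD; apply: cvgMr_tmp; apply: cvgB; [exact: fc|exact: cvg_cst].
- move=> x xD; apply/andP; split; first by rewrite divr_gt0 // subr_gt0 fa.
  by rewrite ltr_pdivrMr // mul1r ltrD2r fbb.
- move=> t /andP[t0 t1]; pose s := a + t * (b - a).
  have sa : a < s by rewrite ltrDl mulr_gt0.
  have sb : s < b by rewrite /s; nra.
  have [_ [x xD <-] xs] : exists2 r, I r & r < s by apply: inf_lt.
  have [_ [y yD <-] ys] : exists2 r, I r & s < r by apply: sup_gt.
  have cI : connected I.
    apply: connected_continuous_connected; first exact: connected_dom.
    by apply: continuous_in_subspaceT => z /set_mem; exact: fc.
  have /connected_intervalP itv := cI.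
  have [z zD fz] : I s.
    by apply: (itv (f x) (f y)); [exists x|exists y|rewrite !ltW].
  by exists z => //; rewrite fz /s addrC addKr mulfK.
Qed.

Section one_param.
Variables (lt : set (T * T)) (h : T -> R).
Hypotheses (alt : open_arc lt) (hp : unit_param lt h).

Lemma param_lt x y : dom lt x -> dom lt y -> h x < h y -> lt (x, y).
Proof.
move=> xD yD; have [hm _ _ _] := hp; have [_ _ tot _ _] := alt.
by case: (tot _ _ xD yD) => [->|//|/hm h1 h2]; [rewrite ltxx|lra].
Qed.

Lemma param_inj x y : dom lt x -> dom lt y -> h x = h y -> x = y.
Proof.
move=> xD yD E; have [hm _ _ _] := hp; have [_ _ tot _ _] := alt.
by case: (tot _ _ xD yD) => // /hm; rewrite E ltxx.
Qed.

Lemma param_nbhs x G : dom lt x -> nbhs x G ->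
  exists2 e : R, 0 < e & forall y, dom lt y -> `|h y - h x| < e -> G y.
Proof.
move=> xD Gx; have [hm _ _ _] := hp.
have [a [b [ax xb abG]]] := arc_nbhd lcT alt xD Gx.
have aD := dom_l ax; have bD := dom_r alt xb.
exists (Num.min (h x - h a) (h b - h x)).
  by rewrite lt_min !subr_gt0 !hm.
move=> y yD; rewrite lt_min => /andP[h1 h2].
by apply: abG; apply: param_lt => //; move: h1 h2; rewrite !ltr_norml; lra.
Qed.

Lemma nbhs_param x e : dom lt x -> 0 < e ->
  nbhs x [set y | dom lt y /\ `|h y - h x| < e].
Proof.
move=> xD e0; have [_ hc _ _] := hp; apply: filterI.
  by apply: open_nbhs_nbhs; split=> //; exact: open_dom.
have /cvgrPdist_lt/(_ e e0) := hc x xD.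
by apply: filterS => y; rewrite distrC.
Qed.

Lemma left_limit_nbhs e G : right_limit (opposite lt) e -> nbhs e G ->
  exists2 d : R, 0 < d & forall y, dom lt y -> h y < d -> G y.
Proof.
move=> le Gn; have [_ _ hr _] := hp; have [q qD qG] := le G Gn.
rewrite dom_opposite // in qD.
exists (h q); first by have /andP[] := hr q qD.
by move=> y yD yq; apply: qG; exact: param_lt.
Qed.

(** Let [q] have height [d]. By [arc_end], a connected neighborhood of [e] that misses [q] and
    contains no upper ray has no point above [q]. *)
Lemma nbhs_left_limit e d : right_limit (opposite lt) e -> ~ right_limit lt e ->
  nbhs e (dom lt `|` [set e]) -> 0 < d ->
  nbhs e [set y | y = e \/ dom lt y /\ h y < d].
Proof.
move=> le nre nb d0; have [hm hc hr hs] := hp.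
have ne : ~ dom lt e.
  by rewrite -(dom_opposite alt); exact: right_limit_out (open_arc_opposite alt) le.
wlog d1 : d d0 / d < 1.
  move=> H; have m0 : 0 < Num.min d (1 / 2) by case: (leP d (1 / 2)) => ?; lra.
  have m1 : Num.min d (1 / 2) < 1 by case: (leP d (1 / 2)) => ?; lra.
  have := H _ m0 m1.
  by apply: filterS => y [|[yD]]; [left|rewrite lt_min => /andP[? _]; right].
have [|q qD hq] := hs d; first by rewrite d0.
have /existsNP[G0 /not_implyP[G0e nG0]] := nre.
have nq : nbhs e (~` [set q]).
  apply: open_nbhs_nbhs; split; first by apply: closed_openC; exact: closed_set1T.
  by move=> E; rewrite E in ne.
have [H [oH He HG cH]] := lcT (filterI (filterI nb G0e) nq).
apply: (@filterS _ (nbhs e) _ H); last exact: open_nbhs_nbhs.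
move=> w Hw; have [[[wD|->] _] /= wq] := HG w Hw; [right|by left].
split=> //; rewrite -hq; apply: hm.
have [asym _ tot _ _] := alt.
case: (tot _ _ wD qD) => // qw.
case: (arc_end lcT hT lkT alt cH He ne wD Hw) => hh.
  by case: nG0; exists w => // u /hh/HG[[]].
by have [_ /(_ erefl)] := HG q (hh q qw).
Qed.

(** The points of heights between [d] and [1 - d] form a compact interval, whose complement is a
    neighborhood of [e]. *)
Lemma nbhs_two_limits e d : right_limit (opposite lt) e -> right_limit lt e ->
  nbhs e (dom lt `|` [set e]) -> 0 < d ->
  nbhs e [set y | y = e \/ dom lt y /\ (h y < d \/ 1 - d < h y)].
Proof.
move=> le re nb d0; have [hm hc hr hs] := hp.
have ne := right_limit_out alt re.
wlog d1 : d d0 / d < 1.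
  move=> H; have m0 : 0 < Num.min d (1 / 2) by case: (leP d (1 / 2)) => ?; lra.
  have m1 : Num.min d (1 / 2) < 1 by case: (leP d (1 / 2)) => ?; lra.
  have := H _ m0 m1.
  apply: filterS => y [|[yD hy]]; [by left|right; split=> //].
  case: hy; first by rewrite lt_min => /andP[? _]; left.
  by case: (leP d (1 / 2)) => ? ?; right; lra.
have [|q qD hq] := hs d; first by rewrite d0.
have [|r rD hr'] := hs (1 - d); first by apply/andP; split; lra.
have nq : nbhs e (~` arc_interval lt q r).
  apply: open_nbhs_nbhs; split; last by case.
  apply: closed_openC; apply: compact_closed => //.
  exact: arc_interval_compact.
apply: filterS (filterI nb nq) => y [[yD|->] nI]; [right|by left].
split=> //; apply: contrapT => /not_orP[/negP h1 /negP h2]; apply: nI.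
by split=> // /hm; lra.
Qed.

End one_param.
End unit_parametrization.

(** * Model intervals and the circle *)

Section subtype_homeomorphism_criteria.

Lemma homeomorphic_inverse (T U : topologicalType) (A : set T) (V : set U)
    (f : T -> U) (g : U -> T) :
  (forall x, A x -> V (f x)) -> (forall y, V y -> A (g y)) ->
  (forall x, A x -> g (f x) = x) -> (forall y, V y -> f (g y) = y) ->
  (forall x, A x -> {for x, continuous f}) ->
  (forall y, V y -> {for y, continuous g}) -> homeomorphic A V.
Proof.
move=> fV gA fK gK fc gc; apply: (@homeomorphic_sub _ _ A V f) => //.
- by move=> y Vy; exists (g y); [exact: gA|exact: gK].
- by move=> x y Ax Ay /(congr1 g); rewrite !fK.
- by move=> x H Ax Hx; exists (f @^-1` H); [exact: fc|].
- move=> x G Ax Gx; exists (g @^-1` G); last by move=> y Ay; rewrite /= fK.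
  by apply: (gc (f x) (fV x Ax)); rewrite fK.
Qed.

Lemma homeomorphic_compact (T U : topologicalType) (V : set U) (f : T -> U) :
  compact [set: T] -> hausdorff_space U -> continuous f -> injective f ->
  f @` setT = V -> homeomorphic T V.
Proof.
move=> cT hU cf fi fV; apply: (homeomorphic_trans (homeomorphic_setT T)).
apply: (@homeomorphic_sub _ _ setT V f) => //.
- by move=> x _; rewrite -fV; exists x.
- by move=> y; rewrite -fV => -[x _ <-]; exists x.
- by move=> x y _ _; exact: fi.
- by move=> x H _ Hx; exists (f @^-1` H); [exact: cf|].
- move=> x G _ Gx; exists (~` (f @` (~` interior G))); last first.
    move=> y _ nfy; apply: interior_subset; apply: contrapT => nGy.
    by apply: nfy; exists y.
  apply: open_nbhs_nbhs; split; last by move=> [y nGy /fi E]; apply: nGy; rewrite E.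
  apply: closed_openC; apply: compact_closed => //.
  apply: continuous_compact; first exact: continuous_subspaceT.
  apply: (subclosed_compact _ cT) => //.
  by apply: open_closedC; exact: open_interior.
Qed.

End subtype_homeomorphism_criteria.

Section real_models.
Context {R : realType}.
Implicit Types (s t : R).

(** The inverse of [of_line], which is the usual map [s / (1 + |s|)] onto [(-1, 1)] rescaled to
    [(0, 1)]. *)
Definition to_line t : R := (2 * t - 1) / (1 - `|2 * t - 1|).

Definition of_line s : R := (s / (1 + `|s|) + 1) / 2.

Lemma of_line_range s : 0 < of_line s < 1.
Proof.
have h : 0 < 1 + `|s| by rewrite ltr_pwDl.
have h1 : s / (1 + `|s|) < 1.
  by rewrite ltr_pdivrMr // mul1r; have := ler_norm s; lra.
have h2 : - 1 < s / (1 + `|s|).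
  by rewrite ltr_pdivlMr // mulN1r; have := ler_norm (- s); rewrite normrN; lra.
by rewrite /of_line; apply/andP; split; lra.
Qed.

Lemma to_lineK t : 0 < t < 1 -> of_line (to_line t) = t.
Proof.
move=> /andP[t0 t1]; rewrite /of_line /to_line.
have [h|h] := lerP 0 (2 * t - 1).
  rewrite (ger0_norm h) ger0_norm; last by rewrite divr_ge0 //; lra.
  by field; rewrite ?andbT; apply/andP; split; apply/eqP; lra.
rewrite (ltr0_norm h) ltr0_norm; last by rewrite pmulr_llt0 // invr_gt0; lra.
by field; apply/andP; split; apply/eqP; lra.
Qed.

Lemma of_lineK s : to_line (of_line s) = s.
Proof.
rewrite /of_line /to_line.
have -> : 2 * ((s / (1 + `|s|) + 1) / 2) - 1 = s / (1 + `|s|).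
  by field; apply/eqP; have := normr_ge0 s; lra.
have [h|h] := lerP 0 s.
  rewrite (ger0_norm h) ger0_norm; last by rewrite divr_ge0 //; lra.
  by field; apply/andP; split; apply/eqP; lra.
rewrite (ltr0_norm h) ltr0_norm; last by rewrite pmulr_llt0 // invr_gt0; lra.
by field; apply/andP; split; apply/eqP; lra.
Qed.

Lemma continuous_to_line t : 0 < t < 1 -> {for t, continuous to_line}.
Proof.
move=> /andP[t0 t1].
have c1 : {for t, continuous (fun t => 2 * t - 1 : R)}.
  by apply: cvgB; [apply: cvgM; [exact: cvg_cst|exact: cvg_id]|exact: cvg_cst].
apply: cvgM; first exact: c1.
apply: cvgV; last by apply: cvgB; [exact: cvg_cst|exact: cvg_norm].
have [h|h] := lerP 0 (2 * t - 1); first by rewrite (ger0_norm h); apply/eqP; lra.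
by rewrite (ltr0_norm h); apply/eqP; lra.
Qed.

Lemma continuous_of_line : continuous of_line.
Proof.
move=> s; apply: cvgM; last exact: cvg_cst.
apply: cvgD; last exact: cvg_cst.
apply: cvgM; first exact: cvg_id.
apply: cvgV; last by apply: cvgD; [exact: cvg_cst|apply: cvg_norm; exact: cvg_id].
by apply/eqP; have := normr_ge0 s; lra.
Qed.

Lemma open_interval_line : homeomorphic [set t : R | 0 < t < 1] R.
Proof.
apply: (homeomorphic_trans _ (homeomorphic_sym (homeomorphic_setT R))).
apply: (@homeomorphic_inverse _ _ _ _ to_line of_line) => //.
- by move=> s _; exact: of_line_range.
- exact: to_lineK.
- by move=> s _; exact: of_lineK.
- exact: continuous_to_line.
- by move=> s _; exact: continuous_of_line.
Qed.

Lemma half_open_interval_half_line :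
  homeomorphic [set t : R | 0 <= t < 1] (half_line R).
Proof.
apply: (@homeomorphic_inverse _ _ _ _ (fun t => t / (1 - t)) (fun s => s / (1 + s))).
- by move=> t /andP[t0 t1]; rewrite /half_line /= divr_ge0 //; lra.
- move=> s s0; rewrite /half_line /= in s0; apply/andP; split.
    by rewrite divr_ge0 //; lra.
  by rewrite ltr_pdivrMr; lra.
- move=> t /andP[t0 t1]; have n1 : 1 - t != 0 by apply/eqP; lra.
  have -> : 1 + t / (1 - t) = (1 - t)^-1 by field.
  by rewrite invrK divfK.
- move=> s; rewrite /half_line /= => s0.
  have n1 : 1 + s != 0 by apply/eqP; lra.
  have -> : 1 - s / (1 + s) = (1 + s)^-1 by field.
  by rewrite invrK divfK.
- move=> t /andP[t0 t1]; apply: cvgM; first exact: cvg_id.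
  apply: cvgV; first by apply/eqP; lra.
  by apply: cvgB; [exact: cvg_cst|exact: cvg_id].
- move=> s; rewrite /half_line /= => s0; apply: cvgM; first exact: cvg_id.
  apply: cvgV; first by apply/eqP; lra.
  by apply: cvgD; [exact: cvg_cst|exact: cvg_id].
Qed.

(* The point of the circle whose stereographic projection from [(1, 0)] is
   [to_line t] for [0 < t < 1]; it is [(1, 0)] for [t = 0] and [t = 1]. *)
Definition to_circle t : R * R :=
  let p := 2 * t - 1 in let q := 1 - `|2 * t - 1| in
  ((p ^+ 2 - q ^+ 2) / (p ^+ 2 + q ^+ 2), (2 * p * q) / (p ^+ 2 + q ^+ 2)).

(** The coordinates [p = 2 * t - 1] and [q = 1 - |p|] do not vanish together, since
    [|p| + q = 1]. *)
Let denominator_gt0 t : 0 < (2 * t - 1) ^+ 2 + (1 - `|2 * t - 1|) ^+ 2.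
Proof.
move: (2 * t - 1) => p; have [h|h] := lerP 0 p.
  by rewrite ger0_norm //; have := sqr_ge0 (p - 1 / 2); lra.
by rewrite ltr0_norm //; have := sqr_ge0 (p + 1 / 2); lra.
Qed.

Lemma to_circle_circle t : circle R (to_circle t).
Proof.
rewrite /circle /to_circle /=; have := denominator_gt0 t.
move: (2 * t - 1) => p; move: (1 - `|p|) => q D0.
by field; apply/eqP; lra.
Qed.

Lemma to_circle0 : to_circle 0 = (1, 0).
Proof.
by rewrite /to_circle mulr0 sub0r normrN normr1 subrr; congr pair; field.
Qed.

Lemma to_circle1 : to_circle 1 = (1, 0).
Proof.
rewrite /to_circle mulr1 (_ : 2 - 1 = 1); last by lra.
by rewrite normr1 subrr; congr pair; field.
Qed.

Let q_gt0 t : 0 < t < 1 -> 0 < 1 - `|2 * t - 1|.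
Proof. by move=> /andP[t0 t1]; rewrite subr_gt0 ltr_norml; apply/andP; split; lra. Qed.

Lemma to_circle_stereographic t : 0 < t < 1 ->
  (to_circle t).1 < 1 /\ (to_circle t).2 / (1 - (to_circle t).1) = to_line t.
Proof.
move=> /q_gt0; rewrite /to_circle /to_line /=; have := denominator_gt0 t.
move: (2 * t - 1) => p; move: (1 - `|p|) => q D0 q0; split.
  by rewrite ltr_pdivrMr // mul1r; nra.
have -> : 1 - (p ^+ 2 - q ^+ 2) / (p ^+ 2 + q ^+ 2) =
   2 * q ^+ 2 / (p ^+ 2 + q ^+ 2).
  by field; rewrite gt_eqF.
have nq : q != 0 by rewrite gt_eqF.
have : p ^+ 2 + q ^+ 2 != 0 by rewrite gt_eqF.
by move: (p ^+ 2 + q ^+ 2) => D nD; field; rewrite nq nD.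
Qed.

Lemma to_circle_inj t t' : 0 < t < 1 -> 0 < t' < 1 ->
  to_circle t = to_circle t' -> t = t'.
Proof.
move=> ht ht' E; rewrite -(to_lineK ht) -(to_lineK ht'); congr of_line.
by rewrite -(to_circle_stereographic ht).2 E (to_circle_stereographic ht').2.
Qed.

Lemma to_circle_surj z : circle R z -> z <> (1, 0) ->
  exists2 t, 0 < t < 1 & to_circle t = z.
Proof.
case: z => a b; rewrite /circle /= => ab nz.
have a1 : a < 1.
  rewrite ltNge; apply/negP => a1; apply: nz.
  have b0 : b = 0 by apply/eqP; rewrite -sqrf_eq0; apply/eqP; nra.
  by move: ab; rewrite b0 expr0n addr0 => ab; congr pair; nra.
pose t := of_line (b / (1 - a)); have ht : 0 < t < 1 := of_line_range _.
exists t => //; have [] := to_circle_stereographic ht; rewrite of_lineK.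
have := to_circle_circle t; case: (to_circle t) => c d; rewrite /circle /= => cd c1.
have nc : 1 - c != 0 by rewrite subr_eq0 gt_eqF.
have na : 1 - a != 0 by rewrite subr_eq0 gt_eqF.
move=> /eqP; rewrite eqr_div // => /eqP E.
(* Squaring [E] and inserting the equations of the circle leaves [c - a] multiplied by nonzero
   factors. *)
have ca : c = a.
  have : (1 - c) * (1 - a) * (c - a) = 0.
    have E2 : d ^+ 2 * (1 - a) ^+ 2 = b ^+ 2 * (1 - c) ^+ 2 by rewrite -!exprMn E.
    have d2 : d ^+ 2 = 1 - c ^+ 2 by lra.
    have b2 : b ^+ 2 = 1 - a ^+ 2 by lra.
    by move: E2; rewrite d2 b2; nra.
  by move=> /eqP; rewrite 2!mulf_eq0 (negbTE nc) (negbTE na) subr_eq0 => /eqP.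
by subst c; congr pair; exact: (mulIf na).
Qed.

Lemma continuous_to_circle : continuous to_circle.
Proof.
move=> t.
have cp : {for t, continuous (fun t => 2 * t - 1 : R)}.
  by apply: cvgB; [apply: cvgM; [exact: cvg_cst|exact: cvg_id]|exact: cvg_cst].
have cq : {for t, continuous (fun t => 1 - `|2 * t - 1| : R)}.
  by apply: cvgB; [exact: cvg_cst|exact: cvg_norm].
have cp2 : {for t, continuous (fun t => (2 * t - 1) ^+ 2 : R)} by exact: cvgM.
have cq2 : {for t, continuous (fun t => (1 - `|2 * t - 1|) ^+ 2 : R)} by exact: cvgM.
have cD : {for t, continuous (fun t => ((2 * t - 1) ^+ 2 + (1 - `|2 * t - 1|) ^+ 2)^-1 : R)}.
  apply: cvgV; last exact: cvgD.
  by apply/eqP; have := denominator_gt0 t; lra.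
have c1 : {for t, continuous (fun t => (to_circle t).1)}.
  by apply: cvgM => //; exact: cvgB.
have c2 : {for t, continuous (fun t => (to_circle t).2)}.
  apply: cvgM => //; apply: cvgM => //.
  by apply: cvgM; [exact: cvg_cst|].
move=> A [[B C] /= [nB nC] BC].
have h1 : nbhs t [set s | B (to_circle s).1] := c1 B nB.
have h2 : nbhs t [set s | C (to_circle s).2] := c2 C nC.
by apply: filterS (filterI h1 h2) => s [Bs Cs]; exact: (BC (to_circle s)).
Qed.

End real_models.

(** * Classification of curves without triods *)

Section charts.
Context {R : realType} {T : topologicalType}.
Implicit Types (lt : set (T * T)) (h : T -> R).

Lemma homeomorphic_coordinate (A : set T) (V : set R) (k : T -> R) :
  (forall x, A x -> V (k x)) -> (forall t, V t -> exists2 x, A x & k x = t) ->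
  (forall x y, A x -> A y -> k x = k y -> x = y) ->
  (forall x (e : R), A x -> 0 < e ->
     exists2 G, nbhs x G & forall y, A y -> G y -> `|k y - k x| < e) ->
  (forall x G, A x -> nbhs x G ->
     exists2 e : R, 0 < e & forall y, A y -> `|k y - k x| < e -> G y) ->
  homeomorphic A V.
Proof.
move=> kV ks ki kc ko; apply: (@homeomorphic_sub _ _ A V k) => //.
  move=> x H Ax /nbhs_ballP[e /= e0 eH]; have [G Gx Ge] := kc x e Ax e0.
  by exists G => // y Ay /(Ge y Ay) hy; apply: eH; rewrite /ball /= distrC.
move=> x G Ax /(ko x G Ax)[e e0 eG]; exists (ball (k x) e); first exact: nbhsx_ballx.
by move=> y Ay; rewrite /ball /= distrC; exact: eG.
Qed.

Lemma half_line_chart (U : set T) (O W : set R) : open O ->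
  W = half_line R `&` O -> homeomorphic U W ->
  exists V : set (half_line R), open V /\ homeomorphic U V.
Proof.
move=> oO WE UW; exists (val @^-1` O); split; first exact: sub_open.
apply: (homeomorphic_trans UW).
rewrite (_ : val @^-1` O = [set v : half_line R | W (val v)]).
  by apply: homeomorphic_nested; rewrite WE => t [].
apply/seteqP; split=> v /=; rewrite WE; last by case.
by split=> //; apply: set_mem; exact: valP.
Qed.

Hypothesis lcT : locally_connected T.
Hypothesis hT : hausdorff_space T.
Hypothesis lkT : forall x : T, exists2 K, compact K & nbhs x K.

Lemma arc_open_interval lt h : open_arc lt -> unit_param lt h ->
  homeomorphic (dom lt) [set t : R | 0 < t < 1].
Proof.
move=> alt hp; have [hm hc hr hs] := hp.
apply: (@homeomorphic_coordinate _ _ h) => //.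
- by move=> x y xD yD; exact: (param_inj alt hp).
- move=> x e xD e0; exists [set y | dom lt y /\ `|h y - h x| < e].
    exact: nbhs_param.
  by move=> y _ [].
- by move=> x G xD Gx; exact: (param_nbhs lcT alt hp).
Qed.

Let ext lt h (e : T) (c : R) (x : T) : R := if x == e then c else h x.

Let extE lt h e c : ext lt h e c e = c.
Proof. by rewrite /ext eqxx. Qed.

Let ext_dom lt h e c x : ~ dom lt e -> dom lt x -> ext lt h e c x = h x.
Proof. by move=> ne xD; rewrite /ext; case: eqP => // E; rewrite E in xD. Qed.

Lemma arc_half_open_interval lt h e : open_arc lt -> unit_param lt h ->
  right_limit (opposite lt) e -> ~ right_limit lt e ->
  nbhs e (dom lt `|` [set e]) ->
  homeomorphic (dom lt `|` [set e]) [set t : R | 0 <= t < 1].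
Proof.
move=> alt hp le nre nb; have [hm hc hr hs] := hp.
have ne : ~ dom lt e.
  by rewrite -(dom_opposite alt); exact: right_limit_out (open_arc_opposite alt) le.
have kD x : dom lt x -> ext lt h e 0 x = h x by exact: ext_dom.
have ke : ext lt h e 0 e = 0 by exact: extE.
apply: (@homeomorphic_coordinate _ _ (ext lt h e 0)).
- move=> x [xD|->]; last by rewrite /= ke lexx ltr01.
  by rewrite /= kD //; have /andP[h0 h1] := hr x xD; rewrite h1 ltW.
- move=> t /andP[]; rewrite le_eqVlt => /orP[/eqP <- _|t0 t1].
    by exists e; [right|].
  have [|x xD hx] := hs t; first by rewrite t0.
  by exists x; [left|rewrite kD].
- move=> x y [xD|->] [yD|->]; rewrite ?ke ?kD //.
  + exact: (param_inj alt hp).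
  + by move=> E; exfalso; have /andP[] := hr x xD; lra.
  + by move=> E; exfalso; have /andP[] := hr y yD; lra.
- move=> x d [xD|->] d0.
    exists [set y | dom lt y /\ `|h y - h x| < d]; first exact: nbhs_param.
    by move=> y _ [yD]; rewrite !kD.
  exists [set y | y = e \/ dom lt y /\ h y < d].
    exact: (nbhs_left_limit lcT hT lkT alt hp).
  move=> y _ [->|[yD yd]]; first by rewrite subrr normr0.
  by rewrite kD // ke subr0 ger0_norm //; have /andP[/ltW] := hr y yD.
- move=> x G [xD|->] Gx.
    have [d d0 dG] := param_nbhs lcT alt hp xD Gx.
    have /andP[h0 h1] := hr x xD.
    (* The bound [h x] is the distance to the value 0 given to [e], so it excludes [e]. *)
    exists (Num.min d (h x)); first by rewrite lt_min d0.
    move=> y [yD|->]; rewrite lt_min => /andP[]; rewrite ?ke ?kD //.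
      by move=> yd _; exact: dG.
    by move=> _; rewrite sub0r normrN ger0_norm ?ltxx // ltW.
  have [d d0 dG] := left_limit_nbhs alt hp le Gx.
  exists d => // y [yD|->]; last by move=> _; exact: nbhs_singleton.
  rewrite kD // ke subr0 ger0_norm; first exact: dG.
  by have /andP[/ltW] := hr y yD.
Qed.

Lemma arc_closed_interval lt h e e' : open_arc lt -> unit_param lt h ->
  right_limit (opposite lt) e -> ~ right_limit lt e ->
  right_limit lt e' -> ~ right_limit (opposite lt) e' ->
  nbhs e (dom lt `|` [set e]) -> nbhs e' (dom lt `|` [set e']) ->
  (forall x, [\/ dom lt x, x = e | x = e']) ->
  homeomorphic T (unit_interval R).
Proof.
move=> alt hp le nre re' nle' nb nb' full; have [hm hc hr hs] := hp.
have alt' := open_arc_opposite alt; have hp' := unit_param_opposite alt hp.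
have ne : ~ dom lt e.
  by rewrite -(dom_opposite alt); exact: right_limit_out alt' le.
have ne' : ~ dom lt e' by exact: right_limit_out alt re'.
have ee' : e != e' by apply/eqP => E; apply: nre; rewrite E.
pose k := ext lt (ext lt h e 0) e' 1.
have kD x : dom lt x -> k x = h x by move=> xD; rewrite /k !ext_dom.
have ke : k e = 0 by rewrite /k {1}/ext (negbTE ee') extE.
have ke' : k e' = 1 by rewrite /k extE.
apply: (homeomorphic_trans (homeomorphic_setT T)).
have h01 y : dom lt y -> `|h y| = h y /\ `|h y - 1| = 1 - h y.
  move=> /hr /andP[h0 h1]; split; first by rewrite ger0_norm ?ltW.
  by rewrite ltr0_norm ?opprB // subr_lt0.
have lt2opp x G : nbhs x G -> right_limit lt x ->
    exists2 d : R, 0 < d & forall y, dom lt y -> 1 - h y < d -> G y.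
  move=> Gx rx; have [d d0 dG] := left_limit_nbhs alt' hp' rx Gx.
  by exists d => // y yD; apply: dG; rewrite dom_opposite.
apply: (@homeomorphic_coordinate _ _ k).
- move=> x _; rewrite /unit_interval /=; case: (full x) => [xD|->|->].
  + by rewrite kD //; have /andP[h0 h1] := hr x xD; rewrite !ltW.
  + by rewrite ke lexx ler01.
  + by rewrite ke' lexx ler01.
- move=> t /andP[]; rewrite le_eqVlt => /orP[/eqP <- _|t0]; first by exists e.
  rewrite le_eqVlt => /orP[/eqP -> |t1]; first by exists e'.
  have [|x xD hx] := hs t; first by rewrite t0.
  by exists x; [|rewrite kD].
- move=> x y _ _; case: (full x) (full y) => [xD|->|->] [yD|->|->];
    rewrite ?ke ?ke' ?kD //.
  + exact: (param_inj alt hp).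
  + by move=> E; exfalso; have /andP[] := hr x xD; lra.
  + by move=> E; exfalso; have /andP[] := hr x xD; lra.
  + by move=> E; exfalso; have /andP[] := hr y yD; lra.
  + by move=> /eqP; rewrite eq_sym oner_eq0.
  + by move=> E; exfalso; have /andP[] := hr y yD; lra.
  + by move=> /eqP; rewrite oner_eq0.
- move=> x d _ d0; case: (full x) => [xD|->|->].
  + exists [set y | dom lt y /\ `|h y - h x| < d]; first exact: nbhs_param.
    by move=> y _ [yD]; rewrite !kD.
  + exists [set y | y = e \/ dom lt y /\ h y < d].
      exact: (nbhs_left_limit lcT hT lkT alt hp).
    move=> y _ [->|[yD yd]]; first by rewrite subrr normr0.
    by rewrite kD // ke subr0 (h01 y yD).1.
  + exists [set y | y = e' \/ dom (opposite lt) y /\ 1 - h y < d].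
      by apply: (nbhs_left_limit lcT hT lkT alt' hp') => //; rewrite dom_opposite.
    move=> y _ [->|[]]; first by rewrite subrr normr0.
    by rewrite dom_opposite // => yD yd; rewrite kD // ke' (h01 y yD).2.
- move=> x G _ Gx; case: (full x) Gx => [xD|->|->] Gx.
  + have [d d0 dG] := param_nbhs lcT alt hp xD Gx.
    have /andP[h0 h1] := hr x xD.
    exists (Num.min d (Num.min (h x) (1 - h x))); first by rewrite !lt_min d0 h0 subr_gt0.
    move=> y _; rewrite !lt_min => /and3P[].
    case: (full y) => [yD|->|->]; rewrite ?ke ?ke' ?kD //.
    * by move=> yd _ _; exact: dG.
    * by rewrite sub0r normrN (h01 x xD).1 ltxx.
    * by rewrite distrC (h01 x xD).2 ltxx.
  + have [d d0 dG] := left_limit_nbhs alt hp le Gx.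
    exists (Num.min d 1); first by rewrite lt_min d0 ltr01.
    move=> y _; rewrite lt_min => /andP[]; rewrite ke subr0.
    case: (full y) => [yD|->|->]; rewrite ?ke ?ke' ?kD //.
    * by rewrite (h01 y yD).1 => yd _; exact: dG.
    * by move=> _ _; exact: nbhs_singleton.
    * by rewrite normr1 ltxx.
  + have [d d0 dG] := lt2opp _ _ Gx re'.
    exists (Num.min d 1); first by rewrite lt_min d0 ltr01.
    move=> y _; rewrite lt_min => /andP[]; rewrite ke'.
    case: (full y) => [yD|->|->]; rewrite ?ke ?ke' ?kD //.
    * by rewrite (h01 y yD).2 => yd _; exact: dG.
    * by rewrite sub0r normrN normr1 ltxx.
    * by move=> _ _; exact: nbhs_singleton.
Qed.

Section loop.
Variables (lt : set (T * T)) (h : T -> R) (e : T).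
Hypotheses (alt : open_arc lt) (hp : unit_param lt h).
Hypotheses (le : right_limit (opposite lt) e) (re : right_limit lt e).
Hypotheses (nb : nbhs e (dom lt `|` [set e])) (full : forall x, dom lt x \/ x = e).

Let ne : ~ dom lt e. Proof. exact: right_limit_out alt re. Qed.

(** A filter without cluster points contains a set missing a neighborhood of [e]. This neighborhood
    contains both ends of the arc, so the set lies in a compact interval. *)
Lemma loop_compact : compact [set: T].
Proof.
have [_ _ _ hs] := hp.
move=> F FF _; apply: contrapT => nF.
have ncl (x : T) : exists2 G, nbhs x G & exists2 A, F A & A `&` G = set0.
  apply: contrapT => h0; apply: nF; exists x; split=> // A G FA Gx.
  by apply: contrapT => /nonemptyPn AG; apply: h0; exists G => //; exists A.
have [G Gx [A FA AG]] := ncl e.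
have alt' := open_arc_opposite alt; have hp' := unit_param_opposite alt hp.
have [d d0 dG] := left_limit_nbhs alt hp le Gx.
have [d' d0' dG'] := left_limit_nbhs alt' hp' re Gx.
pose c := Num.min (Num.min d d') (1 / 2).
have c0 : 0 < c by rewrite !lt_min d0 d0' divr_gt0.
have [cd cd'] : c <= d /\ c <= d' by rewrite !ge_min !lexx !orbT.
have c1 : c <= 1 / 2 by rewrite ge_min lexx orbT.
have [|q qD hq] := hs c; first by apply/andP; split; lra.
have [|r rD hr'] := hs (1 - c); first by apply/andP; split; lra.
have AI : A `<=` arc_interval lt q r.
  move=> w Aw; have nGw : ~ G w.
    by move=> Gw; have : (A `&` G) w by []; rewrite AG.
  have wD : dom lt w.
    by case: (full w) => // we; case: nGw; rewrite we; exact: nbhs_singleton.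
  have [hm _ _ _] := hp.
  split=> // /hm hw; apply: nGw; first by apply: dG => //; lra.
  by apply: dG'; [rewrite dom_opposite|lra].
have cI := arc_interval_compact lcT hT lkT alt qD rD.
have [x [Ix clx]] := cI F FF (filterS AI FA).
have [G' Gx' [A' FA' AG']] := ncl x.
by have [z] := clx A' G' FA' Gx'; rewrite AG'.
Qed.

Let k := ext lt h e 0.
Let kD x : dom lt x -> k x = h x. Proof. exact: ext_dom. Qed.
Let ke : k e = 0. Proof. exact: extE. Qed.

Lemma loop_circle : homeomorphic T (circle R).
Proof.
have [hm hc hr hs] := hp.
have hU : hausdorff_space (R * R)%type by exact: norm_hausdorff.
have inj01 x y : dom lt x -> dom lt y -> to_circle (h x) = to_circle (h y) -> x = y.
  by move=> xD yD /to_circle_inj E; apply: (param_inj alt hp) => //; apply: E; exact: hr.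
have notpole x : dom lt x -> to_circle (h x) <> (1, 0).
  by move=> xD E; have [] := to_circle_stereographic (hr x xD); rewrite E ltxx.
apply: (@homeomorphic_compact _ _ _ (to_circle \o k)) => //.
- exact: loop_compact.
- move=> x N; case: (full x) => [xD|->] /=.
    rewrite kD // => Nx.
    have c1 : {for x, continuous (to_circle \o h)}.
      by apply: continuous_comp; [exact: hc|exact: continuous_to_circle].
    have h1 : nbhs x [set y | N (to_circle (h y))] := c1 N Nx.
    have h2 : nbhs x (dom lt).
      by apply: open_nbhs_nbhs; split=> //; exact: open_dom.
    by apply: filterS (filterI h1 h2) => y [Ny yD] /=; rewrite kD.
  rewrite ke => N0.
  (* Near [e] the parameter is close to 0 or to 1, where [to_circle] has the same value. *)
  have N1 : nbhs (to_circle (1 : R)) N by rewrite to_circle1 -to_circle0.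
  have /nbhs_ballP[d1 /= d10 h1] := continuous_to_circle N0.
  have /nbhs_ballP[d2 /= d20 h2] := continuous_to_circle N1.
  have d0 : 0 < Num.min d1 d2 by rewrite lt_min d10.
  apply: filterS (nbhs_two_limits lcT hT lkT alt hp le re nb d0).
  move=> y /= [->|[yD hy]]; first by rewrite ke; exact: nbhs_singleton.
  rewrite kD //; have /andP[h0 h1'] := hr y yD.
  case: hy => hy; [apply: h1|apply: h2]; rewrite /ball /= ltr_norml;
    move: hy; rewrite ?lt_min; case: (leP d1 d2) => ?; lra.
- move=> x y /=; case: (full x) (full y) => [xD|->] [yD|->]; rewrite ?ke ?kD ?to_circle0 //.
  + exact: inj01.
  + by move=> /notpole.
  + by move=> /esym /notpole.
- apply/seteqP; split=> [_ [x _ <-]|z cz]; first exact: to_circle_circle.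
  have [->|nz] := pselect (z = (1, 0)); first by exists e => //=; rewrite ke to_circle0.
  have [t ht <-] := to_circle_surj cz nz; have [x xD hx] := hs t ht.
  by exists x => //=; rewrite kD // hx.
Qed.

(** Removing the point [x0] of height [1 / 2] and exchanging the two halves of the parameter
    interval puts [e] in the middle. *)
Lemma loop_chart : exists2 U, open U /\ U e &
  homeomorphic U [set t : R | 0 < t < 1].
Proof.
have [hm hc hr hs] := hp; have alt' := open_arc_opposite alt.
have hp' := unit_param_opposite alt hp.
have [|x0 x0D hx0] := hs (1 / 2); first by apply/andP; split; lra.
have hx x : dom lt x -> x <> x0 -> h x < 1 / 2 \/ 1 / 2 < h x.
  move=> xD nx; case: (ltgtP (h x) (1 / 2)) => E; [by left|by right|].
  by case: nx; apply: (param_inj alt hp) => //; rewrite E.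
pose g t : R := if t < 1 / 2 then t + 1 / 2 else t - 1 / 2.
pose kk := ext lt (g \o h) e (1 / 2).
have kkD x : dom lt x -> kk x = g (h x) by move=> xD; rewrite /kk ext_dom.
have kke : kk e = 1 / 2 by exact: extE.
have g1 t : t < 1 / 2 -> g t = t + 1 / 2 by rewrite /g => ->.
have g2 t : 1 / 2 < t -> g t = t - 1 / 2 by move=> ht; rewrite /g ltNge ltW.
exists (~` [set x0]).
  split; first by apply: closed_openC; exact: closed_set1T.
  by move=> E; apply: ne; rewrite E.
have cases x : (~` [set x0]) x -> x = e \/ dom lt x /\
   (h x < 1 / 2 /\ kk x = h x + 1 / 2 \/ 1 / 2 < h x /\ kk x = h x - 1 / 2).
  move=> nx; case: (full x) => [xD|]; [right|by left]; split=> //.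
  by rewrite kkD //; case: (hx x xD nx) => h'; [left; rewrite g1|right; rewrite g2].
apply: (@homeomorphic_coordinate _ _ kk).
- move=> x /cases[->|[xD]]; first by rewrite /= kke; apply/andP; split; lra.
  by have /andP[h0 h1] := hr x xD => -[[? ->]|[? ->]] /=; apply/andP; split; lra.
- move=> t /andP[t0 t1]; case: (ltgtP t (1 / 2)) => ht.
  + have [|x xD E] := hs (t + 1 / 2); first by apply/andP; split; lra.
    exists x; first by move=> E'; move: hx0; rewrite -E' E; lra.
    by rewrite kkD // E g2; lra.
  + have [|x xD E] := hs (t - 1 / 2); first by apply/andP; split; lra.
    exists x; first by move=> E'; move: hx0; rewrite -E' E; lra.
    by rewrite kkD // E g1; lra.
  + by exists e; [move=> E; apply: ne; rewrite E|rewrite kke].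
- move=> x y /cases[->|[xD cx]] /cases[->|[yD cy]] //.
  + have /andP[h0 h1] := hr y yD; rewrite kke.
    by case: cy => -[? ->] ?; exfalso; lra.
  + have /andP[h0 h1] := hr x xD; rewrite kke.
    by case: cx => -[? ->] ?; exfalso; lra.
  + have /andP[h0 h1] := hr x xD; have /andP[h0' h1'] := hr y yD.
    move=> E; apply: (param_inj alt hp) => //; move: cx cy E.
    by case=> -[? ->] []-[? ->]; lra.
- move=> x d /cases[->|[xD cx]] d0.
    exists [set y | y = e \/ dom lt y /\ (h y < d \/ 1 - d < h y)].
      exact: (nbhs_two_limits lcT hT lkT alt hp).
    move=> y /cases[->|[yD cy]]; first by rewrite subrr normr0.
    have /andP[h0 h1] := hr y yD.
    move=> [E|[_ hy]]; first by rewrite E subrr normr0.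
    rewrite kke ltr_norml; apply/andP.
    case: cy => -[? ->]; case: hy => ?; split; lra.
  (* The second bound keeps [y] on the same side of [x0] as [x], where [g] is a translation. *)
  exists [set y | dom lt y /\ `|h y - h x| < Num.min d `|h x - 1 / 2|].
    apply: (nbhs_param alt hp xD); rewrite lt_min d0 normr_gt0 subr_eq0.
    by apply/eqP; case: cx => -[? _]; lra.
  move=> y /cases[E|[_ cy]] [yD]; first by case: ne; rewrite -E.
  rewrite lt_min => /andP[]; move: cx cy; rewrite !ltr_norml.
  case=> -[c1 ->] []-[c2 ->].
  + lra.
  + rewrite (ltr0_norm (_ : h x - 1 / 2 < 0)); lra.
  + rewrite (gtr0_norm (_ : 0 < h x - 1 / 2)); lra.
  + lra.
- move=> x G /cases[->|[xD cx]] Gx.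
    have [d d0 dG] := left_limit_nbhs alt hp le Gx.
    have [d' d0' dG'] := left_limit_nbhs alt' hp' re Gx.
    exists (Num.min d d'); first by rewrite lt_min d0.
    move=> y /cases[->|[yD cy]]; first by move=> _; exact: nbhs_singleton.
    have /andP[h0 h1] := hr y yD; rewrite kke lt_min !ltr_norml => /andP[/andP[? ?] /andP[? ?]].
    case: cy => -[? ky]; [apply: dG => //|apply: dG'; rewrite ?dom_opposite //];
      move: ky; lra.
  have [d d0 dG] := param_nbhs lcT alt hp xD Gx.
  have /andP[hx0' hx1] := hr x xD.
  exists (Num.min d `|kk x - 1 / 2|).
    rewrite lt_min d0 normr_gt0 subr_eq0; apply/eqP.
    by case: cx => -[? ->]; lra.
  move=> y /cases[->|[yD cy]]; rewrite lt_min => /andP[].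
    by rewrite kke distrC ltxx.
  have /andP[h0 h1] := hr y yD.
  move=> h2 h3; apply: dG => //; move: h2 h3 cx cy => + + [[c1 kx]|[c1 kx]] [[c2 ky]|[c2 ky]];
    rewrite kx ky !ltr_norml.
  + lra.
  + rewrite (gtr0_norm (_ : 0 < h x + 1 / 2 - 1 / 2)); lra.
  + rewrite (ltr0_norm (_ : h x - 1 / 2 - 1 / 2 < 0)); lra.
  + lra.
Qed.

End loop.
End charts.

Section classification.
Context {R : realType} {T : topologicalType}.
Implicit Types (lt : set (T * T)) (h : T -> R).
Hypothesis lcT : locally_connected T.
Hypothesis hT : hausdorff_space T.
Hypothesis lkT : forall x : T, exists2 K, compact K & nbhs x K.
Hypothesis scT : @second_countable T.

Lemma open_interval_chart (U : set T) (x : T) : open U -> U x ->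
  homeomorphic U [set t : R | 0 < t < 1] ->
  exists (U : set T) (V : set (half_line R)),
    [/\ open U, U x, open V & homeomorphic U V].
Proof.
move=> oU Ux UI; have oO : open [set t : R | 0 < t < 1].
  rewrite (_ : mkset _ = `]0, 1[%classic); first exact: interval_open.
  by apply/seteqP; split=> t; rewrite /= in_itv.
have [|V [oV UV]] := half_line_chart oO _ UI; last by exists U, V.
apply/seteqP; split=> t; last by case.
by move=> ht; split=> //; have /andP[/ltW] := ht.
Qed.

Lemma half_open_interval_chart (U : set T) (x : T) : open U -> U x ->
  homeomorphic U [set t : R | 0 <= t < 1] ->
  exists (U : set T) (V : set (half_line R)),
    [/\ open U, U x, open V & homeomorphic U V].
Proof.
move=> oU Ux UI; have oO : open [set t : R | t < 1] by exact: open_lt.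
have [|V [oV UV]] := half_line_chart oO _ UI; last by exists U, V.
by apply/seteqP; split=> t; [move=> /andP[]|case=> t0 t1; apply/andP].
Qed.

(** Points off the arc are limits of its ends, and each end has at most one limit. No such point
    gives the line, a common limit of both ends the circle, a single limit of one end the half-line,
    and two limits the segment. *)
Lemma arc_classification lt h : open_arc lt -> unit_param lt h ->
  (forall e, ~ dom lt e -> nbhs e (dom lt `|` [set e]) /\
    (right_limit lt e \/ right_limit (opposite lt) e)) ->
  one_manifold R T /\
  [\/ homeomorphic T R, homeomorphic T (half_line R),
      homeomorphic T (unit_interval R) | homeomorphic T (circle R)].
Proof.
move=> alt hp compl.
have alt' := open_arc_opposite alt; have hp' := unit_param_opposite alt hp.
have openU e : ~ dom lt e -> open (dom lt `|` [set e]).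
  move=> /compl[nb _]; rewrite openE => x [xD|->//].
  apply: (@filterS _ (nbhs x) _ (dom lt)); first by move=> y; left.
  by apply: open_nbhs_nbhs; split=> //; exact: open_dom.
have limitsP e : ~ dom lt e ->
    [\/ right_limit lt e /\ right_limit (opposite lt) e,
        right_limit (opposite lt) e /\ ~ right_limit lt e |
        right_limit lt e /\ ~ right_limit (opposite lt) e].
  move=> /compl[_ lr]; have [r|nr] := pselect (right_limit lt e).
    have [l|nl] := pselect (right_limit (opposite lt) e); first exact: Or31.
    exact: Or33.
  by apply: Or32; split=> //; case: lr.
have half e : ~ dom lt e -> right_limit (opposite lt) e -> ~ right_limit lt e ->
    homeomorphic (dom lt `|` [set e]) [set t : R | 0 <= t < 1].
  move=> ne l nr; have [nb _] := compl e ne.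
  exact: (arc_half_open_interval lcT hT lkT alt hp l nr nb).
have half' e : ~ dom lt e -> right_limit lt e -> ~ right_limit (opposite lt) e ->
    homeomorphic (dom lt `|` [set e]) [set t : R | 0 <= t < 1].
  move=> ne r nl; have [nb _] := compl e ne.
  have := @arc_half_open_interval R T lcT hT lkT (opposite lt) _ e alt' hp' r nl.
  by rewrite dom_opposite //; exact.
have full e : ~ dom lt e -> right_limit lt e -> right_limit (opposite lt) e ->
    forall x, dom lt x \/ x = e.
  move=> ne r l x; have [xD|nx] := pselect (dom lt x); [by left|right].
  have [_ [rx|lx]] := compl x nx; first exact: (right_limit_unique hT alt rx r).
  exact: (right_limit_unique hT alt' lx l).
split.
  split=> // x; have [xD|nx] := pselect (dom lt x).
    apply: (@open_interval_chart (dom lt)) => //; first exact: open_dom.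
    exact: arc_open_interval alt hp.
  have [nb _] := compl x nx.
  case: (limitsP x nx) => -[a b].
  - have [U [oU Ux] UI] := loop_chart lcT hT lkT alt hp b a nb (full x nx a b).
    exact: (open_interval_chart oU Ux UI).
  - by apply: (half_open_interval_chart (openU x nx)); [right|exact: half].
  - by apply: (half_open_interval_chart (openU x nx)); [right|exact: half'].
have whole (A : set T) (U : topologicalType) : (forall x, A x) ->
    homeomorphic A U -> homeomorphic T U.
  move=> AT; have -> : A = setT by apply/seteqP; split=> // x _; exact: AT.
  exact: homeomorphic_trans (homeomorphic_setT T).
have [allD|/existsNP[e ne]] := pselect (forall x, dom lt x).
  apply: Or41; apply: (whole (dom lt)) => //.
  apply: (homeomorphic_trans (arc_open_interval lcT alt hp)).
  exact: open_interval_line.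
have halfT (x : T) : ~ dom lt x -> (forall y, ~ dom lt y -> y = x) ->
    homeomorphic (dom lt `|` [set x]) [set t : R | 0 <= t < 1] ->
    homeomorphic T (half_line R).
  move=> nx only hx; apply: (whole (dom lt `|` [set x])).
    move=> y; have [yD|ny] := pselect (dom lt y); [by left|right; exact: only].
  exact: (homeomorphic_trans hx (half_open_interval_half_line)).
have two x y : ~ dom lt x -> ~ dom lt y -> right_limit (opposite lt) x ->
    ~ right_limit lt x -> y <> x -> homeomorphic T (unit_interval R).
  move=> nx ny lx nrx yx; have [nbx _] := compl x nx.
  have [nby [ry|ly]] := compl y ny; last first.
    by case: yx; exact: (right_limit_unique hT alt' ly lx).
  apply: (arc_closed_interval lcT hT lkT alt hp lx nrx ry _ nbx nby).
    by move=> ly; apply: yx; exact: (right_limit_unique hT alt' ly lx).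
  move=> z; have [zD|nz] := pselect (dom lt z); first exact: Or31.
  have [_ [rz|lz]] := compl z nz.
    by apply: Or33; exact: (right_limit_unique hT alt rz ry).
  by apply: Or32; exact: (right_limit_unique hT alt' lz lx).
have [nb _] := compl e ne.
case: (limitsP e ne) => -[a b].
- apply: Or44.
  exact: (loop_circle lcT hT lkT alt hp b a nb (full e ne a b)).
- have [only|] := pselect (forall y, ~ dom lt y -> y = e).
    by apply: Or42; apply: (halfT e) => //; exact: half.
  move=> /existsNP[y /not_implyP[ny ye]].
  by apply: Or43; exact: (two e y).
- have [only|] := pselect (forall y, ~ dom lt y -> y = e).
    by apply: Or42; apply: (halfT e) => //; exact: half'.
  move=> /existsNP[y /not_implyP[ny ye]].
  apply: Or43; apply: (two y e) => //.
  + have [_ [ry|//]] := compl y ny.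
    by case: ye; exact: (right_limit_unique hT alt ry a).
  + by move=> ry; apply: ye; exact: (right_limit_unique hT alt ry a).
  + by move=> E; apply: ye.
Qed.

Hypothesis cT : connected [set: T].
Hypothesis tT : forall y : T, exists W, [/\ open W, W y & triod_free W].

Theorem curve_classification {X : metricType R} (iota : T -> X) (p p' : T) :
  continuous iota -> injective iota -> p <> p' ->
  one_manifold R T /\
  [\/ homeomorphic T R, homeomorphic T (half_line R),
      homeomorphic T (unit_interval R) | homeomorphic T (circle R)].
Proof.
move=> ic ii pp.
have [lt mlt D0] := exists_maximal_arc lcT hT lkT cT tT pp.
have [h hp] := exists_unit_param lcT ic ii scT mlt.1 D0.
apply: (arc_classification mlt.1 hp) => e ne.
exact: (maximal_arc_complement lcT hT lkT cT tT mlt D0 ne).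
Qed.

(* A component of the complement of [y] meets a small connected neighborhood [G]
   of [y] in a nonempty union of components of [G \ y]. *)
Lemma triod_free_cut_components (y : T) (z : 'I_3 -> T) :
  (forall i, z i <> y) ->
  ~ (forall i j, i != j -> ~ connected_component (~` [set y]) (z i) (z j)).
Proof.
move=> zy zz; have [W [oW Wy tW]] := tT y.
have [G [oG Gy cG _ GW]] := small_nbhd lcT hT lkT (open_nbhs_nbhs (conj oW Wy)).
pose C i := connected_component (~` [set y]) (z i).
have oy : open (~` [set y]) by apply: closed_openC; exact: closed_set1T.
have hq i : {q | C i q /\ G q}.
  have cl : closure (C i) y.
    rewrite /C -setTD; apply: component_limit => //; first exact: openT.
    exact/eqP.
  by apply: cid; exact: (cl G (open_nbhs_nbhs (conj oG Gy))).
pose q i := proj1_sig (hq i).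
have Gq i : (G `\ y) (q i).
  by have [Cq Gq] := proj2_sig (hq i); split=> //; exact: (connected_component_sub Cq).
pose V i := connected_component (G `\ y) (q i).
have VC i : V i `<=` C i.
  have [Cq _] := proj2_sig (hq i); rewrite /C (same_connected_component Cq).
  apply: connected_component_max; first exact: connected_component_refl.
    by move=> w /connected_component_sub[].
  exact: component_connected.
apply: (@triod_free_cut _ lcT hT lkT W y V) => //.
- move=> i; split.
  + by apply: component_open => //; exact: open_remove.
  + exact: component_connected.
  + by move=> w /connected_component_sub[/subset_closure/GW].
  + by have [Gi /eqP ei] := Gq i; exact: component_limit.
- by move=> i /connected_component_sub[_]; exact.
- move=> i j ij; apply/seteqP; split=> // w [/VC wi /VC wj]; apply: (zz i j ij).
  by apply: (connected_component_trans wi); exact: connected_component_sym.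
Qed.

End classification.

(** * The plaque topology *)

Section plaque_topology.
Context {X : topologicalType} (A : preatlas X).
Hypothesis cA : complete_atlas A.
Implicit Types (U V K N : set X).

Local Notation plaque := (fun U x => monotone_restriction (decomp A U) U x).
Local Notation pspace := (plaque_space A).

Lemma plaque_self U x : cover A U -> U x -> plaque U x x.
Proof.
move=> cU Ux; apply: connected_component_refl; split=> //.
have [[_ _ dA _] _] := cA; have [_ self _ _] := dA U cU.
exact/self/subset_closure.
Qed.

Lemma plaque_eq U x y : cover A U -> U x -> plaque U x y ->
  U y /\ plaque U y = plaque U x.
Proof.
move=> cU Ux xy; have [Qy Uy] := connected_component_sub xy; split=> //.
have [[_ _ dA _] _] := cA; have [_ self disj _] := dA U cU.
have Qxy : decomp A U x = decomp A U y.
  case: (disj x y (subset_closure Ux) (subset_closure Uy)) => // E.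
  have : (decomp A U x `&` decomp A U y) y.
    by split=> //; exact/self/subset_closure.
  by rewrite E.
have := same_connected_component xy.
by rewrite /monotone_restriction Qxy.
Qed.

Lemma plaque_connected U x : connected (plaque U x).
Proof. exact: component_connected. Qed.

Lemma open_plaqueP P y : open_plaque A P -> P y ->
  exists U, [/\ cover A U, U y & P = plaque U y].
Proof.
by move=> [U cU [x Ux ->]] /(plaque_eq cU Ux)[Uy E]; exists U; split=> //; rewrite E.
Qed.

Lemma exists_open_plaque x : exists2 P, open_plaque A P & P x.
Proof.
have [[_ covA _ _] _] := cA.
have [U cU Ux] : (\bigcup_(U in cover A) U) x by rewrite covA.
by exists (plaque U x); [exists U => //; exists x|exact: plaque_self].
Qed.

(** Compatibility is here an equality on the closure of [V], where the continuum [decomp A V y] is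
    its own component. Passing to components in [V] gives the claim. *)
Lemma plaque_sub U V y : cover A U -> cover A V -> V `<=` U -> V y ->
  plaque V y = connected_component (plaque U y `&` V) y.
Proof.
move=> cU cV VU Vy.
have [[_ _ dA kA] _] := cA.
have [conV selfV _ _] := dA V cV; have clVy := subset_closure Vy.
have clVU : closure V `<=` closure U by exact: closureS.
have [[_ _ connQ] QV] := conV y clVy.
have := kA V U cV cU y (conj clVy (clVU _ clVy)).
rewrite /monotone_restriction (setIidl clVU) (setIidl QV).
rewrite connected_component_id //; last exact: selfV.
move=> E; have yy : (decomp A V y `&` V) y by split=> //; exact: selfV.
have sub1 : connected_component (decomp A V y `&` V) y `<=`
    connected_component (decomp A U y `&` U) y.
  apply: connected_component_max.
  - exact: connected_component_refl.
  - move=> z /connected_component_sub[]; rewrite {1}E.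
    by move=> /connected_component_sub[Qz _] /VU.
  - exact: component_connected.
have yUV : (connected_component (decomp A U y `&` U) y `&` V) y.
  by split=> //; apply: sub1; exact: connected_component_refl.
apply/seteqP; split; apply: connected_component_max.
- exact: connected_component_refl.
- by move=> z zy; split; [exact: sub1|case: (connected_component_sub zy)].
- exact: component_connected.
- exact: connected_component_refl.
- move=> z zy; have [zU Vz] := connected_component_sub zy; split=> //.
  rewrite E; apply: (@connected_component_max _ _
    (connected_component (connected_component (decomp A U y `&` U) y `&` V) y)) zy.
  + exact: connected_component_refl.
  + move=> w /connected_component_sub[/connected_component_sub[Qw _] Vw].
    by split=> //; exact: subset_closure.
  + exact: component_connected.
- exact: component_connected.
Qed.

Lemma nbhs_plaque P (y : pspace) : open_plaque A P -> P y -> nbhs y P.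
Proof.
move=> oP Py; apply: open_nbhs_nbhs; split=> //.
exact: (open_plaque_basis cA).1.
Qed.

Lemma plaque_nbhsP (y : pspace) (N : set pspace) : nbhs y N ->
  exists P, [/\ open_plaque A P, P y & P `<=` N].
Proof. by move=> /((open_plaque_basis cA).2 y)[P [PA Py] PN]; exists P. Qed.

(** Completeness of the basis makes [W] a member of the cover; its plaque through [y] lies in both
    [P] and [V]. *)
Lemma nbhs_plaque_trace P (y : X) (V : set X) : open_plaque A P -> P y ->
  nbhs y V -> nbhs (y : pspace) (P `&` V).
Proof.
move=> oP Py; have [U [cU Uy ->]] := open_plaqueP oP Py.
rewrite nbhsE => -[M [oM My] MV].
have [[HoA _ _ _] [_ bA]] := cA.
pose W := U `&` M.
have cW : cover A W.
  by apply: (bA W U) => //; [apply: openI => //; exact: HoA|exact: subIsetl].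
have Wy : W y by [].
apply: (@filterS _ (nbhs (y : pspace)) _ (plaque W y)).
  rewrite (plaque_sub cU cW (@subIsetl _ U M) Wy) => z /connected_component_sub.
  by case=> zU [_ /MV].
by apply: nbhs_plaque; [exists W => //; exists y|exact: plaque_self].
Qed.

Lemma plaque_space_id_continuous : continuous (id : pspace -> X).
Proof.
move=> y V yV; have [P oP Py] := exists_open_plaque y.
apply: (@filterS _ (nbhs (y : pspace)) _ (P `&` V)); first by move=> z [].
exact: nbhs_plaque_trace.
Qed.

Lemma plaque_space_hausdorff : hausdorff_space X -> hausdorff_space pspace.
Proof.
move=> hX p q clpq; apply: hX => B C pB qC.
exact: (clpq B C (plaque_space_id_continuous pB) (plaque_space_id_continuous qC)).
Qed.

Lemma locally_connected_sub (P : set X) (y : X) (V : set X) :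
  locally_connected P -> P y -> nbhs y V ->
  exists2 W, nbhs y W & W `&` P `<=` connected_component (P `&` V) y.
Proof.
move=> lcP Py yV; pose y' : P := exist _ y (mem_set Py).
have yV' : nbhs y' (val @^-1` V) by apply/sub_nbhsP; exists V.
have [C [oC Cy CV cC]] := lcP y' _ yV'.
have /sub_nbhsP[W Wy WC] : nbhs y' C by exact: open_nbhs_nbhs.
exists W => // z [Wz Pz].
have Cz : C (exist _ z (mem_set Pz)) by exact: WC.
have cvC : connected (val @` C).
  apply: connected_continuous_connected => //.
  by apply: continuous_subspaceT; exact: initial_continuous.
exists (val @` C); last by exists (exist _ z (mem_set Pz)).
split=> //; first by exists y'.
move=> _ [w Cw <-]; split; last exact: CV.
by apply: set_mem; exact: valP.
Qed.

Hypothesis lcA : forall P, open_plaque A P -> locally_connected P.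

(** With [nbhs_plaque_trace], this says that the plaque topology induces on [P] the topology of [X].
    Local connectedness of [P] makes the component through [y] of its trace on a small chart a
    neighborhood of [y] in [P]. *)
Lemma plaque_trace_nbhs P (y : X) (N : set pspace) : open_plaque A P -> P y ->
  nbhs (y : pspace) N -> exists2 V, nbhs y V & V `&` P `<=` N.
Proof.
move=> oP Py /plaque_nbhsP[P' [oP' P'y P'N]].
have [U [cU Uy EP]] := open_plaqueP oP Py.
have [U' [cU' Uy' EP']] := open_plaqueP oP' P'y.
have [[HoA _ _ _] [_ bA]] := cA.
pose W := U `&` U'.
have oW : open W by apply: openI; exact: HoA.
have cW : cover A W by apply: (bA W U) => //; exact: subIsetl.
have Wy : W y by [].
have nW : nbhs y W by exact: open_nbhs_nbhs.
have [V Vy VW] := locally_connected_sub (lcA oP) Py nW.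
exists V => // z /VW; rewrite {1}EP -(plaque_sub cU cW (@subIsetl _ _ _) Wy).
rewrite (plaque_sub cU' cW (@subIsetr _ _ _) Wy).
by move=> /connected_component_sub[+ _]; rewrite -EP' => /P'N.
Qed.

Lemma connected_plaque_space P (K : set X) : open_plaque A P -> K `<=` P ->
  connected K -> connected (K : set pspace).
Proof.
move=> oP KP cK B B0 [C oC BC] [D cD BD].
have trace (O : set pspace) : open O -> exists2 O' : set X, open O' &
    K `&` O = K `&` O'.
  move=> oO; exists (\bigcup_(V in [set V | open V /\ V `&` P `<=` O]) V).
    by apply: bigcup_open => V [].
  apply/seteqP; split=> z [Kz]; last first.
    by case=> V [_ VO] Vz; split=> //; apply: VO; split=> //; exact: KP.
  move=> Oz; split=> //.
  have [V Vz VO] := plaque_trace_nbhs oP (KP z Kz) (open_nbhs_nbhs (conj oO Oz)).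
  exists (interior V); last exact: Vz.
  split; first exact: open_interior.
  by move=> w [/interior_subset Vw Pw]; exact: VO.
have [C' oC' EC] := trace C oC.
have [D' oD' ED] := trace (~` D) (closed_openC cD).
apply: cK => //; first by exists C' => //; rewrite BC.
exists (~` D'); first exact: open_closedC.
rewrite BD; apply/seteqP; split=> z [Kz h]; split=> //.
  by move=> D'z; have [_] : (K `&` ~` D) z by rewrite ED.
by apply: contrapT => nDz; apply: h; have [] : (K `&` D') z by rewrite -ED.
Qed.

Lemma plaque_space_locally_connected : locally_connected pspace.
Proof.
move=> x N /plaque_nbhsP[P [oP Px PN]]; exists P; split=> //.
  exact: (open_plaque_basis cA).1.
have [U [cU Ux EP]] := open_plaqueP oP Px.
by apply: (connected_plaque_space oP) => //; rewrite EP; exact: plaque_connected.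
Qed.

(** The part of the plaque in a closed neighborhood contained in the chart is compact: a limit [w]
    of it in [X] stays in the decomposition continuum and in the chart, and the plaque remains
    connected when [w] is added, so [w] belongs to it. *)
Lemma plaque_space_locally_compact : hausdorff_space X ->
  (forall (x : X) U, nbhs x U -> exists2 V, nbhs x V & closure V `<=` U) ->
  forall x : pspace, exists2 K : set pspace, compact K & nbhs x K.
Proof.
move=> hX regX x; have [P oP Px] := exists_open_plaque x.
have [U [cU Ux EP]] := open_plaqueP oP Px.
have [[HoA _ dA _] _] := cA.
have [V Vx VU] := regX x U (open_nbhs_nbhs (conj (HoA U cU) Ux)).
have [/(_ x (subset_closure Ux))[[_ cQ _] _] _ _ _] := dA U cU.
pose K := P `&` closure V.
have cK : compact (K : set X).
  apply: (subclosed_compact _ cQ); last first.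
    by move=> w [+ _]; rewrite EP => /connected_component_sub[].
  move=> w clw.
  have wV : closure V w.
    rewrite (closure_id (closure V)).1; last exact: closed_closure.
    by move: clw; apply: closureS; exact: subIsetr.
  split=> //.
  have clP : closure P w by move: clw; apply: closureS; exact: subIsetl.
  rewrite EP; exists (P `|` [set w]); last by right.
  split; first by left.
    move=> z [|->]; first by rewrite EP => /connected_component_sub.
    split; last exact: VU.
    rewrite (closure_id (decomp A U x)).1; last exact: compact_closed.
    by move: clP; apply: closureS; rewrite EP => v /connected_component_sub[].
  apply: (@connected_between _ P).
  - by rewrite EP; exact: plaque_connected.
  - exact: subsetUl.
  - by move=> z [/subset_closure|->].
exists K; last first.
  apply: (nbhs_plaque_trace oP Px); apply: filterS Vx; exact: subset_closure.
move=> F FF FK; have [p [Kp clp]] := cK F FF FK.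
exists p; split=> // B N FB pN.
have [H Hp HN] := plaque_trace_nbhs oP Kp.1 pN.
have [z [[Bz [Pz _]] Hz]] := clp (B `&` K) H (filterI FB FK) Hp.
by exists z; split=> //; exact: HN.
Qed.

Lemma leaf_self x : leaf A x x.
Proof.
by have [P oP Px] := exists_open_plaque x; exists 0%N, (fun=> P).
Qed.

Lemma leaf_plaque x P y : leaf A x y -> open_plaque A P -> P y -> P `<=` leaf A x.
Proof.
move=> [n [Q [oQ Qx Qy QQ]]] oP Py z Pz.
exists n.+1, (fun i => if (i <= n)%N then Q i else P); split=> //.
- by move=> i _; case: ifP => // /oQ.
- by rewrite ltnn.
- move=> i; rewrite ltnS => ni; rewrite ni; case: ltnP => h; first exact: QQ.
  have -> : i = n by apply/eqP; rewrite eqn_leq ni.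
  by exists y.
Qed.

Lemma leaf_open x : open (leaf A x).
Proof.
rewrite openE => y xy; have [P oP Py] := exists_open_plaque y.
apply: (@filterS _ (nbhs (y : pspace)) _ P); last exact: nbhs_plaque.
exact: leaf_plaque xy oP Py.
Qed.

Lemma leaf_closed x : closed (leaf A x).
Proof.
rewrite -openC openE => y nxy; have [P oP Py] := exists_open_plaque y.
apply: (@filterS _ (nbhs (y : pspace)) _ P); last exact: nbhs_plaque.
by move=> z Pz xz; apply: nxy; exact: (leaf_plaque xz oP Pz Py).
Qed.

Lemma leaf_connected x : connected (leaf A x).
Proof.
suff H y : leaf A x y -> exists C : set pspace,
    [/\ connected C, C x, C y & C `<=` leaf A x].
  rewrite (_ : leaf A x = \bigcup_(C in [set C : set pspace |
      [/\ connected C, C x & C `<=` leaf A x]]) C).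
    by apply: bigcup_connected; [exists x => C []|move=> C []].
  apply/seteqP; split=> y; last by case=> C [_ _ CL] /CL.
  by move=> /H[C [? ? ? ?]]; exists C.
move=> [n [Q [oQ Qx Qy QQ]]].
have oc i : (i <= n)%N -> connected (Q i : set pspace).
  move=> /oQ oQi; apply: (connected_plaque_space oQi) => //.
  by have [U cU [z _ ->]] := oQi; exact: plaque_connected.
suff [C [cC Cx QC CL]] : exists C : set pspace,
    [/\ connected C, C x, Q n `<=` C & C `<=` leaf A x].
  by exists C; split=> //; exact: QC.
elim: n {Qy} oQ QQ oc => [|n IH] oQ QQ oc.
  exists (Q 0%N); split=> //; first exact: oc.
  exact: leaf_plaque (leaf_self x) (oQ _ _) Qx.
have [|||C [cC Cx QC CL]] := IH.
- by move=> i h; apply: oQ; exact: leqW.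
- by move=> i h; apply: QQ; exact: leqW.
- by move=> i h; apply: oc; exact: leqW.
have [w [Qw Qw']] := QQ n (ltnSn n).
exists (C `|` Q n.+1); split.
- apply: connectedU => //; last exact: oc.
  by exists w; split=> //; exact: QC.
- by left.
- exact: subsetUr.
- rewrite subUset; split=> //.
  by apply: (leaf_plaque (CL w (QC w Qw)) _ Qw'); exact: oQ.
Qed.

(** Leaves are connected, open and closed for the plaque topology, so two that meet coincide. *)
Lemma leaf_eq x y : leaf A x y -> leaf A x = leaf A y.
Proof.
have sub a b : leaf A a b -> leaf A b `<=` leaf A a.
  move=> ab; suff : leaf A b `&` leaf A a = leaf A b by move=> E z; rewrite -E => -[].
  apply: leaf_connected.
  - by exists b; split=> //; exact: leaf_self.
  - by exists (leaf A a) => //; exact: leaf_open.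
  - by exists (leaf A a) => //; exact: leaf_closed.
move=> xy; apply/seteqP; split; last exact: sub.
have : leaf A y x.
  apply: contrapT => nyx.
  suff : leaf A x `&` leaf A y = leaf A x.
    by move=> E; apply: nyx; have := leaf_self x; rewrite -E => -[].
  apply: leaf_connected.
  - by exists y; split=> //; exact: leaf_self.
  - by exists (leaf A y) => //; exact: leaf_open.
  - by exists (leaf A y) => //; exact: leaf_closed.
exact: sub.
Qed.

End plaque_topology.

(** * Leaves as subspaces *)

Section open_subtypes.
Context {T : topologicalType} (M : set T).

Let valM (x : M) : M (val x). Proof. by apply: set_mem; exact: valP. Qed.

Lemma sub_hausdorff : hausdorff_space T -> hausdorff_space M.
Proof.
move=> hT p q clpq; apply: val_inj; apply: hT => B C pB qC.
have [||z [Bz Cz]] := clpq (val @^-1` B) (val @^-1` C).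
- by apply/sub_nbhsP; exists B.
- by apply/sub_nbhsP; exists C.
by exists (val z).
Qed.

Lemma sub_connected_preimage (C : set T) : connected C -> C `<=` M ->
  connected (val @^-1` C : set M).
Proof.
move=> cC CM B [b Bb] [U oU BU] [D cD BD].
have trace (H : set M) : open H -> exists2 H' : set T, open H' & H = val @^-1` H'.
  by move=> [H' oH' <-]; exists H'.
have [U' oU' EU] := trace U oU.
have [D' oD' ED] := trace (~` D) (closed_openC cD).
have DE z : D z <-> ~ D' (val z).
  have -> : D' (val z) = (~` D) z by rewrite ED.
  by split=> [Dz|/contrapT].
have E : C `&` U' = C.
  apply: cC.
  - by exists (val b); move: Bb; rewrite BU EU.
  - by exists U'.
  - exists (~` D'); first exact: open_closedC.
    apply/seteqP; split=> z [Cz h]; split=> //; pose z' : M := exist _ z (mem_set (CM z Cz)).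
      have : B z' by rewrite BU EU.
      by rewrite BD => -[_ /DE].
    have : B z' by rewrite BD; split=> //; apply/DE.
    by rewrite BU EU => -[].
rewrite BU EU; apply/seteqP; split=> [z []|z Cz] //; split=> //.
by move: Cz; rewrite /preimage /= -E => -[].
Qed.

Lemma sub_connectedT : connected M -> connected [set: M].
Proof.
move=> cM; rewrite (_ : setT = val @^-1` M); first exact: sub_connected_preimage.
by apply/seteqP; split=> z // _; exact: valM.
Qed.

Lemma sub_locally_connected : open M -> locally_connected T -> locally_connected M.
Proof.
move=> oM lcT x A /sub_nbhsP[N Nx NA].
have [C [oC Cx CN cC]] := lcT (val x) _ (filterI Nx (open_nbhs_nbhs (conj oM (valM x)))).
exists (val @^-1` C); split=> //; first exact: sub_open.
  by move=> y /CN[Ny _]; exact: NA.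
by apply: sub_connected_preimage => // y /CN[].
Qed.

Lemma sub_locally_compact : closed M ->
  (forall x : T, exists2 K, compact K & nbhs x K) ->
  forall x : M, exists2 K : set M, compact K & nbhs x K.
Proof.
move=> cM lk x; have [K cK Kx] := lk (val x).
exists (val @^-1` K); last by apply/sub_nbhsP; exists K.
move=> F FF FK.
have FM : (val @ F) (K `&` M).
  by apply: (@filterS _ F _ (val @^-1` K)) => // y Ky; split=> //; exact: valM.
have [p [[Kp Mp] clp]] := compact_closedI cK cM (fmap_proper_filter val FF) FM.
exists (exist _ p (mem_set Mp)); split=> // B N FB /sub_nbhsP[N' N'p NN].
have [|_ [[b Bb <-] Nb]] := clp (val @` B) N' _ N'p.
  by apply: (@filterS _ F _ B) => // b Bb; exists b.
by exists b; split=> //; exact: NN.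
Qed.

End open_subtypes.

Section leaves.
Context {X : topologicalType}.
Variables (F A : preatlas X).
Hypotheses (cF : complete_atlas F) (lcF : forall P, open_plaque F P -> locally_connected P).
Hypotheses (cA : complete_atlas A) (AF : subatlas A F).

Lemma subatlas_open_plaque P : open_plaque A P -> open_plaque F P.
Proof.
move=> [U cU [x Ux ->]]; have [cAF dAF] := AF; exists U; first exact: cAF.
exists x => //; rewrite /monotone_restriction.
by rewrite (dAF U cU) //; exact: subset_closure.
Qed.

(** The leaf of [A] and its complement are unions of plaques of [F]; being open and closed, that
    leaf fills the connected leaf of [F]. This transfers the properties of the cw-atlas. *)
Lemma subatlas_leaf x : (leaf A x : set X) = leaf F x.
Proof.
have sub : (leaf A x : set X) `<=` leaf F x.
  move=> y [n [Q [oQ Qx Qy QQ]]]; exists n, Q; split=> // i h.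
  exact/subatlas_open_plaque/oQ.
apply/seteqP; split; first exact: sub.
suff : leaf F x `&` (leaf A x : set (plaque_space F)) = leaf F x.
  by move=> E y; rewrite -E => -[].
have nb y : exists P : set X, [/\ nbhs (y : plaque_space F) P, P y & open_plaque A P].
  have [P oP Py] := exists_open_plaque cA y.
  exists P; split=> //; apply: (nbhs_plaque cF) => //.
  exact: subatlas_open_plaque.
apply: (leaf_connected cF lcF).
- by exists x; split; exact: leaf_self.
- exists (leaf A x : set (plaque_space F)) => //; rewrite openE => y xy.
  have [P [nP Py oP]] := nb y.
  apply: (@filterS _ (nbhs (y : plaque_space F)) _ P) => //.
  exact: leaf_plaque xy oP Py.
- exists (leaf A x : set (plaque_space F)) => //.
  rewrite -openC openE => y nxy; have [P [nP Py oP]] := nb y.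
  apply: (@filterS _ (nbhs (y : plaque_space F)) _ P) => // z Pz xz.
  by apply: nxy; exact: (leaf_plaque xz oP Pz Py).
Qed.

(** A basis is given by the traces of a countable basis of [X] on the countably many plaques, since
    the two topologies agree on each plaque. *)
Lemma leaf_second_countable x (b : nat -> set X) (P : nat -> set X) :
  (forall n, open (b n)) ->
  (forall x N, nbhs x N -> exists n, b n x /\ b n `<=` N) ->
  (forall i, open_plaque F (P i)) -> (leaf F x : set X) = \bigcup_i P i ->
  @second_countable (leaf F x).
Proof.
move=> ob bb oP LP.
pose B (p : nat * nat) : set (leaf F x) := val @^-1` (P p.1 `&` b p.2).
exists (range B).
  exact: (sub_countable (card_image_le _ _) (countableP _)).
have nPb i n y : P i y -> b n y -> nbhs (y : plaque_space F) (P i `&` b n).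
  move=> Py bny; apply: (nbhs_plaque_trace cF (oP i) Py).
  by apply: open_nbhs_nbhs; split.
split.
  move=> _ [[i n] _ <-]; apply: sub_open; rewrite openE => y [Py bny].
  exact: nPb.
move=> y N /sub_nbhsP[M My MN].
have Ly : (leaf F x : set X) (val y) by apply: set_mem; exact: valP.
have [i _ Py] : (\bigcup_i P i) (val y) by rewrite -LP.
have [V Vy VM] := plaque_trace_nbhs cF lcF (oP i) Py My.
have [n [bny bnV]] := bb _ _ Vy.
exists (B (i, n)); first by split=> //; exists (i, n).
by move=> z [Pz bz]; apply: MN; apply: VM; split=> //; exact: bnV.
Qed.

End leaves.

Section second_countability.
Context {R : realType} {X : metricType R}.

Lemma compact_metric_basis : compact [set: X] -> exists b : nat -> set X,
  (forall n, open (b n)) /\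
  (forall x N, nbhs x N -> exists n, b n x /\ b n `<=` N).
Proof.
move=> cX; have [x0|nX] := pselect (inhabited X); last first.
  by exists (fun=> set0); split=> [_|x]; [exact: open0|case: nX].
have [B /countable_injP[f fi] [oB bB]] : @second_countable X.
  case: x0 => x0.
  pose P : pseudoPMetricType R :=
    HB.pack_for (pseudoPMetricType R) X (isPointed.Build X x0).
  exact: (@compact_second_countable R P cX).
exists (fun n => \bigcup_(U in [set U | B U /\ f U = n]) U); split.
  by move=> n; apply: bigcup_open => U [/oB].
move=> x N Nx; have [U [BU Ux] UN] := bB x N Nx.
exists (f U); split; first by exists U.
move=> y [V [BV fV] Vy]; apply: UN; suff <- : V = U by [].
by apply: fi; rewrite ?inE.
Qed.

End second_countability.

(** * Moore's triod theorem *)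

Section surface_continua.
Context {R : realType}.

Lemma connected_square (a b c d : R) : connected (`[a, b]%classic `*` `[c, d]%classic).
Proof.
have [cI dI] : connected `[a, b]%classic /\ connected `[c, d]%classic.
  by split; apply/connected_intervalP; exact: interval_is_interval.
have [[p [p1 p2]]|E] := pselect (`[a, b]%classic `*` `[c, d]%classic !=set0);
  last first.
  rewrite (_ : _ `*` _ = set0); first exact: connected0.
  by apply/seteqP; split=> // p Ip; apply: E; exists p.
pose cross (x : R) : set (R * R) :=
  (fun t => (t, p.2)) @` `[a, b]%classic `|` (fun t => (x, t)) @` `[c, d]%classic.
rewrite (_ : _ `*` _ = \bigcup_(x in `[a, b]%classic) cross x).
  apply: bigcup_connected.
    by exists p => x _; left; exists p.1 => //; case: (p).
  move=> x Ix; apply: connectedU.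
  - by exists (x, p.2); split; [exists x|exists p.2].
  - apply: connected_continuous_connected => //; apply: continuous_subspaceT => t.
    move=> N [[B C] /= [nB nC] BC]; apply: (@filterS _ (nbhs t) _ B) => // s Bs.
    by apply: BC; split=> //; exact: nbhs_singleton.
  - apply: connected_continuous_connected => //; apply: continuous_subspaceT => t.
    move=> N [[B C] /= [nB nC] BC]; apply: (@filterS _ (nbhs t) _ C) => // s Cs.
    by apply: BC; split=> //; exact: nbhs_singleton.
apply/seteqP; split=> -[x y].
  by move=> [Ix Iy]; exists x => //; right; exists y.
by move=> [z Iz [[t It [<- <-]]|[t It [<- <-]]]].
Qed.

Lemma square_neighbourhood (z : R * R) (N : set (R * R)) : nbhs z N ->
  exists Q : set (R * R), [/\ compact Q, connected Q, nbhs z Q & Q `<=` N].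
Proof.
case=> -[B1 B2] /= [/nbhs_ballP[r1 /= r10 h1] /nbhs_ballP[r2 /= r20 h2]] BN.
pose r := Num.min r1 r2 / 2.
have m0 : 0 < Num.min r1 r2 by rewrite lt_min r10.
have r0 : 0 < r by rewrite divr_gt0.
have [rr1 rr2] : r < r1 /\ r < r2.
  have rm : r < Num.min r1 r2 by rewrite /r ltr_pdivrMr // mulr_natr mulr2n ltrDl.
  by move: rm; rewrite lt_min => /andP.
have itvP (x t : R) : `[x - r, x + r]%classic t <-> `|t - x| <= r.
  by rewrite /= in_itv /= ler_distl.
exists (`[z.1 - r, z.1 + r]%classic `*` `[z.2 - r, z.2 + r]%classic); split.
- by apply: compact_setX; exact: segment_compact.
- exact: connected_square.
- exists (ball z.1 r, ball z.2 r); first by split; exact: nbhsx_ballx.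
  move=> [x y] [/= hx hy]; split; apply/itvP; rewrite distrC; exact: ltW.
- move=> [x y] [/itvP hx /itvP hy]; apply: BN; split.
    by apply: h1; rewrite /ball /= distrC; exact: le_lt_trans hx rr1.
  by apply: h2; rewrite /ball /= distrC; exact: le_lt_trans hy rr2.
Qed.

Lemma chart_functions (S : topologicalType) (U : set S) : open U -> U !=set0 ->
  homeomorphic U (R * R)%type -> exists (f : S -> R * R) (g : R * R -> S),
    [/\ forall s, U s -> {for s, continuous f}, continuous g,
        forall s, U s -> g (f s) = s & forall z, U (g z) /\ f (g z) = z].
Proof.
move=> oU [u0 Uu0] [f0 [g0 [fc gc fK gK]]].
have valU (s : U) : U (val s) by apply: set_mem; exact: valP.
pose toU s : U := if pselect (U s) is left Us then exist _ s (mem_set Us)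
  else exist _ u0 (mem_set Uu0).
have toUK s : U s -> val (toU s) = s by rewrite /toU; case: pselect.
have toUval (s : U) : toU (val s) = s by apply: val_inj; rewrite toUK.
exists (f0 \o toU), (val \o g0); split.
- move=> s Us N Nfs.
  have /sub_nbhsP[M Ms MN] : nbhs (toU s) (f0 @^-1` N) := fc (toU s) N Nfs.
  rewrite toUK // in Ms.
  apply: filterS (filterI Ms (open_nbhs_nbhs (conj oU Us))) => w [Mw Uw].
  by apply: MN; rewrite toUK.
- by move=> z; apply: continuous_comp; [exact: gc|exact: initial_continuous].
- by move=> s Us /=; rewrite fK toUK.
- by move=> z; split=> /=; [exact: valU|rewrite toUval gK].
Qed.

Lemma surface_small_continuum (S : metricType R) (x : S) (V : set S) :
  compact_surface S -> nbhs x V ->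
  exists D : set S, [/\ compact D, connected D, nbhs x D & D `<=` V].
Proof.
move=> [_ hS] Vx; have [U [oU Ux hU]] := hS x.
have [f [g [fc gc fK gK]]] := chart_functions oU (ex_intro _ x Ux) hU.
have [|Q [cQ nQ Qx QV]] := @square_neighbourhood (f x) (g @^-1` V).
  by apply: gc; rewrite fK.
exists (g @` Q); split.
- by apply: continuous_compact => //; exact: continuous_subspaceT.
- by apply: connected_continuous_connected => //; exact: continuous_subspaceT.
- have h1 : nbhs x (f @^-1` Q) := fc x Ux Q Qx.
  apply: filterS (filterI h1 (open_nbhs_nbhs (conj oU Ux))) => w [Qw Uw].
  by exists (f w) => //; exact: fK.
- by move=> _ [z Qz <-]; exact: QV.
Qed.

(** [D (n1, n2)] is a compact connected set between the basic sets [b n1] and [b n2] if there is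
    one, and empty otherwise. Small closed squares in charts provide enough such pairs. *)
Lemma countable_continua (S : metricType R) : compact_surface S ->
  exists D : nat * nat -> set S, forall x V, nbhs x V ->
    exists p, [/\ compact (D p), connected (D p), D p x & D p `<=` V].
Proof.
move=> hS; have [b [ob bb]] := compact_metric_basis hS.1.
have /choice[D hD] : forall p : nat * nat, exists D : set S,
    forall D', compact D' -> connected D' -> b p.1 `<=` D' -> D' `<=` b p.2 ->
    [/\ compact D, connected D, b p.1 `<=` D & D `<=` b p.2].
  move=> p; have [[D hD]|nD] := pselect (exists D : set S,
    [/\ compact D, connected D, b p.1 `<=` D & D `<=` b p.2]); first by exists D.
  by exists set0 => D' ? ? ? ?; case: nD; exists D'.
exists D => x V Vx; have [n2 [bx2 b2V]] := bb x V Vx.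
have [D' [cD' nD' Dx D2]] := surface_small_continuum hS (open_nbhs_nbhs (conj (ob n2) bx2)).
have [n1 [bx1 b1D]] := bb x D' Dx.
have [cD nD b1 b2] := hD (n1, n2) D' cD' nD' b1D D2.
by exists (n1, n2); split=> //; [exact: b1|exact: subset_trans b2 b2V].
Qed.

End surface_continua.

Section moore.
Context {R : realType} {S : topologicalType}.
Implicit Types (M B : set S) (D : 'I_3 -> set S).

Definition triod_spanning B D M : Prop :=
  [/\ forall j, [/\ compact (D j), connected (D j) & D j `<=` B],
      forall i j, i != j -> D i `&` D j = set0 &
      exists (o : S) (L : 'I_3 -> set S),
        (forall j, [/\ compact (L j), connected (L j), L j `<=` M `&` B, L j o &
           L j `&` D j !=set0]) /\
        (forall i j, i != j -> L i `&` D j = set0)].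

(** The vertices are the three centres and one point in each [D j]. Edges with different [i] and
    different [j] are disjoint: their legs lie in disjoint sets [M i], a leg misses the other [D j],
    and the [D j] are disjoint. *)
Lemma no_three_triods B U D (M : 'I_3 -> set S) : open U -> B `<=` U ->
  homeomorphic U (R * R)%type -> (forall i j, i != j -> M i `&` M j = set0) ->
  ~ (forall i, triod_spanning B D (M i)).
Proof.
move=> oU BU hU dM tM.
have [hD dD _] := tM 0.
have hL i : {oL : S * ('I_3 -> set S) |
    (forall j, [/\ compact (oL.2 j), connected (oL.2 j), oL.2 j `<=` M i `&` B,
      oL.2 j oL.1 & oL.2 j `&` D j !=set0]) /\
    (forall i j, i != j -> oL.2 i `&` D j = set0)}.
  by apply: cid; have [_ _ [p [L h]]] := tM i; exists (p, L).
pose p i := (proj1_sig (hL i)).1; pose L i := (proj1_sig (hL i)).2.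
have hL1 i j : [/\ compact (L i j), connected (L i j), L i j `<=` M i `&` B,
      L i j (p i) & L i j `&` D j !=set0] by exact: (proj2_sig (hL i)).1.
have hL2 i j j' : j != j' -> L i j `&` D j' = set0.
  by move=> jj; exact: (proj2_sig (hL i)).2.
have hd j : {d | D j d}.
  by apply: cid; have [_ _ _ _ [d [_ Dd]]] := hL1 0 j; exists d.
pose d j := proj1_sig (hd j).
have U0 : U !=set0.
  by exists (p 0); apply: BU; have [_ _ s Lp _] := hL1 0 0; case: (s _ Lp).
have [f [g [fc gc fK gK]]] := chart_functions oU U0 hU.
pose K i j := L i j `|` D j.
have KU i j : K i j `<=` U.
  have [_ _ LB _ _] := hL1 i j; have [_ _ DB] := hD j.
  by move=> z [/LB[_ /BU]|/DB/BU].
have fcK i j : {within K i j, continuous f}.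
  by apply: continuous_in_subspaceT => z /set_mem /KU; exact: fc.
apply: (@planar_K33 R (f \o p) (f \o d) (fun i j => f @` K i j)).
  move=> i j; have [cL nL LB Lp LD] := hL1 i j; have [cD nD DB] := hD j; split.
  - by apply: continuous_compact; [exact: fcK|exact: compactU].
  - apply: connected_continuous_connected; last exact: fcK.
    exact: connectedU.
  - by exists (p i) => //; left.
  - by exists (d j) => //; right; exact: proj2_sig (hd j).
move=> i i' j j' ii jj; apply/seteqP; split=> // _ [[x Kx <-] [y Ky E]].
have xy : x = y by rewrite -(fK x (KU i j x Kx)) -(fK y (KU i' j' y Ky)) E.
have jj' : j' != j by rewrite eq_sym.
rewrite -xy in Ky; case: Kx Ky => [Lx|Dx] [Lx'|Dx'].
- have [_ _ LB _ _] := hL1 i j; have [_ _ LB' _ _] := hL1 i' j'.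
  have : (M i `&` M i') x by split; [case: (LB x Lx)|case: (LB' x Lx')].
  by rewrite dM.
- by have : (L i j `&` D j') x by []; rewrite hL2.
- by have : (L i' j' `&` D j) x by []; rewrite hL2.
- by have : (D j `&` D j') x by []; rewrite dD.
Qed.

Lemma nowhere_dense0 : nowhere_dense (set0 : set S).
Proof. by rewrite /nowhere_dense closure0 interior0. Qed.

Lemma nowhere_dense_dense (N : set S) : nowhere_dense N -> dense (~` closure N).
Proof.
move=> nN V [x Vx] oV; apply: contrapT => h.
have : (closure N)° x.
  apply: (@filterS _ (nbhs x) _ V); last exact: open_nbhs_nbhs.
  by move=> y Vy; apply: contrapT => ny; apply: h; exists y.
by rewrite nN.
Qed.

(** For one index at most two classes are bad, so one meagre set contains them; the two sequences of
    nowhere dense sets are interleaved by parity. There are countably many indices. *)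
Lemma residual_avoiding (P : S -> set S) (J : countType) (bad : J -> set S -> Prop) :
  (forall x, P x x) -> (forall x y, P x `&` P y !=set0 -> P x = P y) ->
  (forall x, meagre (P x)) ->
  (forall d (x : 'I_3 -> S), (forall i j, i != j -> P (x i) `&` P (x j) = set0) ->
     ~ (forall i, bad d (P (x i)))) ->
  exists2 G, Gdelta_dense G & forall x, G x -> forall d, ~ bad d (P x).
Proof.
move=> Px Peq Pm P3.
have /choice[N hN] : forall d, exists N : nat -> set S,
    (forall i, nowhere_dense (N i)) /\
    forall x, bad d (P x) -> P x `<=` \bigcup_i N i.
  move=> d; have [[x1 b1]|nx] := pselect (exists x, bad d (P x)); last first.
    exists (fun=> set0); split=> [_|x bx]; first exact: nowhere_dense0.
    by case: nx; exists x.
  have [N1 n1 E1] := Pm x1.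
  have [[x2 b2 n12]|only] := pselect (exists2 x, bad d (P x) & P x <> P x1);
    last first.
    exists N1; split=> // x bx; rewrite -E1.
    by have -> : P x = P x1 by apply: contrapT => ne; apply: only; exists x.
  have [N2 n2 E2] := Pm x2.
  exists (fun i => if odd i then N2 i./2 else N1 i./2); split.
    by move=> i; case: ifP.
  move=> x bx y Pxy.
  have [E|ne1] := pselect (P x = P x1).
    have [i _ hi] : (\bigcup_i N1 i) y by rewrite -E1 -E.
    by exists i.*2 => //; rewrite odd_double doubleK.
  have [E|ne2] := pselect (P x = P x2).
    have [i _ hi] : (\bigcup_i N2 i) y by rewrite -E2 -E.
    by exists i.*2.+1 => //; rewrite /= odd_double /= uphalf_double.
  have dj a c : P a <> P c -> P a `&` P c = set0.
    by move=> ac; apply: contrapT => /eqP/set0P/Peq.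
  case: (P3 d (fun i => nth x [:: x; x1; x2] i)).
    by case=> -[|[|[|//]]] ? [] [|[|[|//]]] ? //= _; apply: dj => //;
      exact: nesym.
  by case=> -[|[|[|]]].
(* A number that codes no pair contributes the whole space. *)
pose F n := if (unpickle n : option (J * nat)) is Some (d, i)
  then ~` closure (N d i) else setT.
exists (\bigcap_n F n).
  exists F => // n; rewrite /F; case: unpickle => [[d i]|].
    split; first by apply: closed_openC; exact: closed_closure.
    by apply: nowhere_dense_dense; exact: (hN d).1.
  by split; [exact: openT|move=> V [x Vx] _; exists x].
move=> x Gx d bx; have [i _ Nx] := (hN d).2 x bx x (Px x).
have := Gx (pickle (d, i)) I; rewrite /F pickleK; apply.
exact: subset_closure.
Qed.

End moore.

(** * Leaves without triods *)

Section leaf_space.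
Context {R : realType} {S : metricType R}.
Variables (F : preatlas S).
Hypotheses (cF : complete_atlas F) (lcF : forall P, open_plaque F P -> locally_connected P).

Definition leaf_inclusion (x : S) (t : leaf F x) : S := val t.

Lemma leaf_inclusion_continuous x : continuous (@leaf_inclusion x).
Proof.
move=> t N Nt.
have Nt' : nbhs (val t : plaque_space F) N := plaque_space_id_continuous cF Nt.
by apply/sub_nbhsP; exists N.
Qed.

Lemma leaf_inclusion_inj x : injective (@leaf_inclusion x).
Proof. by move=> s t; exact: val_inj. Qed.

(* The ends of the legs of a triod are enclosed one after the other in disjoint
   members of the countable family [D]. *)
Lemma triod_in_leaf_spans (x : S) (B : set S) (D : nat * nat -> set S) :
  open B ->
  (forall (e : S) V, nbhs e V ->
    exists p, [/\ compact (D p), connected (D p), D p e & D p `<=` V]) ->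
  (forall q : {ffun 'I_3 -> nat * nat},
    ~ triod_spanning B (fun j => D (q j)) (leaf F x)) ->
  triod_free (@leaf_inclusion x @^-1` B).
Proof.
move=> oB hD nospan p L e hL Le.
pose i x := @leaf_inclusion x.
have hS : hausdorff_space S by exact: metric_hausdorff.
pose K j := i x @` L j; pose f j := i x (e j).
have cK j : compact (K j).
  have [[_ cL _] _ _ _] := hL j; apply: continuous_compact => //.
  by apply: continuous_subspaceT; exact: leaf_inclusion_continuous.
have nK j : connected (K j).
  have [[_ _ cL] _ _ _] := hL j; apply: connected_continuous_connected => //.
  by apply: continuous_subspaceT; exact: leaf_inclusion_continuous.
have clK j : closed (K j) by exact: compact_closed.
have Kf j : K j (f j) by have [_ _ _ Lj] := hL j; exists (e j).
have nKf j j' : j != j' -> ~ K j (f j').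
  by move=> jj [t Lt /leaf_inclusion_inj E]; apply: (Le j j' jj); rewrite -E.
have ff j j' : j != j' -> f j <> f j'.
  by move=> jj E; apply: (nKf j j' jj); rewrite -E.
have Bf j : B (f j) by have [_ LB _ Lj] := hL j; exact: LB.
have cl1 (s : S) : closed [set s] by exact: closed_set1T.
have pick j (C : set S) : closed C -> ~ C (f j) -> exists q,
    [/\ compact (D q), connected (D q), D q (f j) & D q `<=` B `&` ~` C].
  move=> cC nC; apply: hD; apply: filterI; apply: open_nbhs_nbhs; split=> //.
  exact: closed_openC.
have [n01 n02 n12] : [/\ (0 : 'I_3) != 1, (0 : 'I_3) != 2 & (1 : 'I_3) != 2] by [].
have [n10 n20 n21] : [/\ (1 : 'I_3) != 0, (2 : 'I_3) != 0 & (2 : 'I_3) != 1] by [].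
have [||q0 [c0 d0 D0 s0]] :=
    pick 0 (K 1 `|` K 2 `|` ([set f 1] `|` [set f 2])).
- by apply: closedU; apply: closedU.
- by move=> [[|]|[|]]; [exact: nKf|exact: nKf|exact: ff|exact: ff].
have [||q1 [c1 d1 D1 s1]] := pick 1 (K 0 `|` K 2 `|` (D q0 `|` [set f 2])).
- by apply: closedU; apply: closedU => //; exact: compact_closed.
- move=> [[|]|[|]]; [exact: nKf|exact: nKf| |exact: ff].
  by move=> /s0[_]; apply; right; left.
have [||q2 [c2 d2 D2 s2]] := pick 2 (K 0 `|` K 1 `|` (D q0 `|` D q1)).
- by apply: closedU; apply: closedU => //; exact: compact_closed.
- move=> [[|]|[|]]; [exact: nKf|exact: nKf| |].
    by move=> /s0[_]; apply; right; right.
  by move=> /s1[_]; apply; right; right.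
pose q : {ffun 'I_3 -> nat * nat} := [ffun j : 'I_3 => nth q0 [:: q0; q1; q2] j].
have [E0 E1 E2] : [/\ q 0 = q0, q 1 = q1 & q 2 = q2] by rewrite !ffunE.
have D01 : D q0 `&` D q1 = set0.
  by apply/seteqP; split=> // s [h /s1[_]]; apply; right; left.
have D02 : D q0 `&` D q2 = set0.
  by apply/seteqP; split=> // s [h /s2[_]]; apply; right; left.
have D12 : D q1 `&` D q2 = set0.
  by apply/seteqP; split=> // s [h /s2[_]]; apply; right; right.
apply: (nospan q); split.
- apply: ord3_ind; rewrite ?E0 ?E1 ?E2; split=> //.
  + by move=> s /s0[].
  + by move=> s /s1[].
  + by move=> s /s2[].
- apply: ord3_ind; apply: ord3_ind; rewrite ?eqxx // ?E0 ?E1 ?E2 // => _; by rewrite setIC.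
exists (i x p), K; split.
  move=> j; have [_ LB Lp Lj] := hL j; split=> //.
  - move=> _ [t Lt <-]; split; last exact: LB.
    by apply: set_mem; exact: valP.
  - by exists p.
  - exists (f j); split=> //; move: j {LB Lp Lj}.
    by apply: ord3_ind; rewrite ?E0 ?E1 ?E2.
apply: ord3_ind; apply: ord3_ind; rewrite ?eqxx // ?E0 ?E1 ?E2 => _;
  apply/seteqP; split=> // s [Ks].
- by move=> /s1[_]; apply; left; left.
- by move=> /s2[_]; apply; left; left.
- by move=> /s0[_]; apply; left; left.
- by move=> /s2[_]; apply; left; right.
- by move=> /s0[_]; apply; left; right.
- by move=> /s1[_]; apply; left; right.
Qed.

(** Points in three different components for the plaque space stay in different components for the
    subspace [leaf F x], as the inclusion is continuous; [triod_free_cut_components] excludes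
    this. *)
Lemma leaf_no_ramification (x : S) (y : plaque_space F) :
  (forall t : leaf F x, exists W, [/\ open W, W t & triod_free W]) ->
  (forall t : plaque_space F, exists2 K : set (plaque_space F), compact K & nbhs t K) ->
  ~ ramification_point F x y.
Proof.
move=> tW lkP [xy /pcard_leP[h]].
have hz i : {z : plaque_space F | (leaf F x `\ y) z &
    h i = connected_component (leaf F x `\ y) z}.
  apply: cid2; have : [set connected_component (leaf F x `\ y) z |
    z in leaf F x `\ y] (h i) by exact: funS.
  by case=> z hz <-; exists z.
pose z i := s2val (hz i).
have zL i : (leaf F x `\ y) (z i) := s2valP (hz i).
have hE i : h i = connected_component (leaf F x `\ y) (z i) := s2valP' (hz i).
pose y' : leaf F x := exist _ y (mem_set xy).
pose z' i : leaf F x := exist _ (z i) (mem_set (zL i).1).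
have hP : hausdorff_space (plaque_space F).
  by apply: (plaque_space_hausdorff cF); exact: metric_hausdorff.
apply: (@triod_free_cut_components _ _ _ _ _ tW y' z') => //.
- apply: sub_locally_connected; first exact: leaf_open.
  exact: plaque_space_locally_connected.
- exact: sub_hausdorff.
- by apply: sub_locally_compact => //; exact: leaf_closed.
- by apply: sub_connectedT; exact: leaf_connected.
- by move=> i E; have [_] := zL i; apply; rewrite -[y]/(val y') -E.
move=> i j ij zz; have /eqP := ij; apply.
suff E : h i = h j by apply: (@inj _ _ _ h); rewrite ?inE.
rewrite !hE; apply: same_connected_component.
exists (val @` connected_component (~` [set y']) (z' i)); last by exists (z' j).
split.
- by exists (z' i) => //; apply: connected_component_refl => E; have [_] := zL i;
    apply; rewrite -[y]/(val y') -E.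
- move=> _ [w wi <-]; split; first by apply: set_mem; exact: valP.
  by move=> E; apply: (connected_component_sub wi); apply: val_inj.
- apply: connected_continuous_connected; first exact: component_connected.
  by apply: continuous_subspaceT; exact: initial_continuous.
Qed.

End leaf_space.

Theorem theorem6p2p7 (R : realType) (S : metricType R) (F : preatlas S)
    (hS : compact_surface S) (hF : dendritation F) :
  exists2 G : set S, Gdelta_dense G &
    (forall x, G x -> forall y, ~ ramification_point F x y) /\
    (forall x, G x ->
      one_manifold R (leaf F x) /\
      [\/ homeomorphic (leaf F x) R,
          homeomorphic (leaf F x) (half_line R),
          homeomorphic (leaf F x) (unit_interval R) |
          homeomorphic (leaf F x) (circle R)]).
Proof.
have [[[cF lcF] _] [A [cA ctA mA [d d0 dA]] AF]] := hF.
have hX : hausdorff_space S by exact: metric_hausdorff.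
have leafAF x : (leaf A x : set S) = leaf F x by exact: subatlas_leaf.
have [b [ob bb]] := compact_metric_basis hS.1.
have [D hD] := countable_continua hS.
(* The index records a basic set and three of the continua. That the basic set lies in a planar
   chart is part of [bad], so that [no_three_triods] applies. *)
pose bad (p : nat * {ffun 'I_3 -> nat * nat}) (M : set S) :=
  (exists U : set S, [/\ open U, b p.1 `<=` U & homeomorphic U (R * R)%type]) /\
  triod_spanning (b p.1) (fun j => D (p.2 j)) M.
have [||||G dG Gbad] := @residual_avoiding S (fun x => leaf F x : set S) _ bad.
- by move=> x; exact: leaf_self.
- by move=> x y [z [xz yz]]; rewrite (leaf_eq cF lcF xz) (leaf_eq cF lcF yz).
- by move=> x; rewrite -leafAF.
- move=> p x dx hbad; have [[U [oU bU hU]] _] := hbad 0.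
  apply: (no_three_triods oU bU hU dx) => i.
  exact: (hbad i).2.
exists G => //.
(* A leaf through [G] has no triod inside a basic set contained in a chart, and such sets cover the
   surface. *)
have tW x : G x -> forall t : leaf F x, exists W, [/\ open W, W t & triod_free W].
  move=> Gx t; pose s := @leaf_inclusion _ _ F x t.
  have [U [oU Us hU]] := hS.2 s.
  have [k [bs bU]] := bb s U (open_nbhs_nbhs (conj oU Us)).
  exists (@leaf_inclusion _ _ F x @^-1` b k); split=> //.
    by apply: open_comp; [move=> y _; exact: leaf_inclusion_continuous|].
  apply: (triod_in_leaf_spans cF) (ob k) hD _ => q hq.
  by apply: (Gbad x Gx (k, q)); split=> //; exists U.
have lkP : forall t : plaque_space F,
    exists2 K : set (plaque_space F), compact K & nbhs t K.
  apply: (plaque_space_locally_compact cF lcF hX) => x U Ux.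
  by have [V Vx VU] := uniform_regular Ux; exists V.
split=> x Gx; first by move=> y; exact: (leaf_no_ramification cF lcF (tW x Gx) lkP).
have [P oP LP] := ctA x.
(* The lower bound on diameters excludes leaves reduced to a point. *)
have [t [t' tt]] : exists t t' : leaf F x, t <> t'.
  apply: contrapT => same; have := dA x; apply/negP; rewrite -ltNge.
  apply: (@le_lt_trans _ _ 0%E); last by rewrite lte_fin.
  apply: ge_ereal_sup => _ [[u v] [/= Lu Lv] <-].
  rewrite -!/(leaf A x _) in Lu Lv.
  have Fu : (leaf F x) u by rewrite -[leaf F x]leafAF.
  have Fv : (leaf F x) v by rewrite -[leaf F x]leafAF.
  have -> : u = v.
    apply: contrapT => uv; apply: same.
    by exists (exist _ u (mem_set Fu)), (exist _ v (mem_set Fv)) => -[].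
  by rewrite mdistxx.
apply: (@curve_classification R (leaf F x) _ _ _ _ _ _ S (@leaf_inclusion _ _ F x) t t') => //.
- apply: sub_locally_connected; first exact: leaf_open.
  exact: plaque_space_locally_connected.
- by apply: sub_hausdorff; exact: plaque_space_hausdorff.
- by apply: sub_locally_compact => //; exact: leaf_closed.
- apply: (leaf_second_countable cF lcF ob bb (P := P)).
    by move=> i; apply: (subatlas_open_plaque AF).
  by rewrite -leafAF.
- by apply: sub_connectedT; exact: leaf_connected.
- exact: tW.
- exact: leaf_inclusion_continuous.
Qed.
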